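(* Let $\mathbf X_i=(X^{(1)}_i,X^{(2)}_i)$, $i\in\mathbb N$, be a sequence of independent bivariate Gaussian random vectors such that $X^{(1)}_i$ and $X^{(2)}_i$ are standard normal with correlation $\rho_i$. Let $b_n$ be the solution of $b_n=n\phi(b_n)$, $\phi$ the standard normal density, and let $$\nu_n=\frac1n\sum_{i=1}^n\delta_{\sqrt{b_n^2(1-\rho_i)/2}},$$ a probability measure on $[0,\infty]$. For $\nu\in\mathcal M_1([0,\infty])$ define the distribution function $F_\nu$ by $$-\log F_\nu(x,y)=\int_{[0,\infty]}\left[\Phi\Big(\lambda+\frac{y-x}{2\lambda}\Big)e^{-x}+\Phi\Big(\lambda+\frac{x-y}{2\lambda}\Big)e^{-y}\right]\nu(d\lambda),\qquad x,y\in\mathbb R.$$ Then, as $n\to\infty$, the normalized componentwise maximum $$\max_{i=1,\dots,n}b_n(\mathbf X_i-b_n)$$ converges in distribution if and only if $\nu_n$ converges weakly to some probability measure $\nu$ on $[0,\infty]$, and in this case the limit has distribution function $F_\nu$. Furthermore, for every $\nu\in\mathcal M_1([0,\infty])$, the distribution $F_\nu$ is attained as the limit of $\max_{i=1,\dots,n}b_n(\mathbf X_i-b_n)$ for a suitable sequence $(\mathbf X_i)_{i\in\mathbb N}$ of this kind.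
   Context: $\Phi$ is the standard normal distribution function. $\delta_a$ is the Dirac measure at $a$. $[0,\infty]$ carries the metric $d(x,y)=|e^{-x}-e^{-y}|$ (with $e^{-\infty}=0$), which makes it compact; $\mathcal M_1([0,\infty])$ is the space of Borel probability measures on it with the topology of weak convergence. Operations between a vector and the scalar $b_n$, and the maximum of vectors, are componentwise. The integrand in $-\log F_\nu$ at $\lambda=0$ and $\lambda=\infty$ is understood as its limit, i.e. it equals $e^{-\min(x,y)}$ at $\lambda=0$ and $e^{-x}+e^{-y}$ at $\lambda=\infty$. *)

(* Defs.v *)
From HB Require Import structures.
From mathcomp Require Import all_boot all_order all_algebra finmap.
From mathcomp Require Import all_classical all_reals all_analysis.
From mathcomp Require Import measurable_realfun.

Set Implicit Arguments.
Unset Strict Implicit.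
Unset Printing Implicit Defensive.

Import Order.TTheory GRing.Theory Num.Theory.
Import numFieldNormedType.Exports.

Local Open Scope classical_set_scope.
Local Open Scope ring_scope.

Definition bounded_continuous (R : realType) (T : topologicalType) :
    set (T -> R) :=
  [set f | continuous f /\ bounded_fun f].

(* The class C of test functions is a parameter because the library has no
   structure joining topologies and sigma-algebras: C is always
   bounded_continuous R T for the topology under consideration on T. *)
Definition weak_cvg d (T : measurableType d) (R : realType) (C : set (T -> R))
    (mu_ : nat -> probability T R) (mu : probability T R) : Prop :=
  forall f, C f -> (fun n => \int[mu_ n]_t f t) @ \oo --> \int[mu]_t f t.

Section extended_halfline.
Context {R : realType}.

Definition ext_nneg := {x : \bar R | (0 <= x)%E}.

Definition ext_nneg_of_real (r : R) (r0 : 0 <= r) : ext_nneg :=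
  exist _ r%:E r0.

(* expeR -oo = 0, so the value at +oo is 0. *)
Definition expN (x : ext_nneg) : R := fine (expeR (- \val x)).

Definition ext_nneg_dist (x y : ext_nneg) : R := `|expN x - expN y|.

Let dist0 x : ext_nneg_dist x x = 0.
Proof. by rewrite /ext_nneg_dist subrr normr0. Qed.

Let dist_eq0 x y : ext_nneg_dist x y = 0 -> x = y.
Proof.
move=> /normr0_eq0/subr0_eq; rewrite /expN => xy; apply: val_inj.
case: x xy => -[r| |]//= r0; case: y => -[s| |]//= s0.
- by move=> /expR_inj/oppr_inj ->.
- by move=> /eqP; rewrite gt_eqF// expR_gt0.
- by move=> /esym/eqP; rewrite gt_eqF// expR_gt0.
Qed.

Let dist_sym x y : ext_nneg_dist x y = ext_nneg_dist y x.
Proof. exact: distrC. Qed.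

Let dist_triangle y x z :
  ext_nneg_dist x z <= ext_nneg_dist x y + ext_nneg_dist y z.
Proof. exact: ler_distD. Qed.

HB.instance Definition _ := Choice.on ext_nneg.
HB.instance Definition _ :=
  isPointed.Build ext_nneg (ext_nneg_of_real (lexx 0)).
HB.instance Definition _ :=
  isMetric.Build R ext_nneg dist0 dist_eq0 dist_sym dist_triangle.

HB.instance Definition _ :=
  Measurable.copy ext_nneg (g_sigma_algebraType (@open ext_nneg)).

End extended_halfline.
Arguments ext_nneg : clear implicits.

Section random_vectors.
Context d (T : measurableType d) (R : realType) (P : probability T R).
Local Open Scope ereal_scope.

(* The normal law with mean m and standard deviation s, a Dirac mass if s = 0;
   the library's normal_prob m 0 is a uniform law instead. *)
Definition normal_law (m s : R) (A : set R) : \bar R :=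
  if s == 0%R then \d_m A else normal_prob m s A.

Definition has_law (Y : T -> R) (L : set R -> \bar R) : Prop :=
  forall A, measurable A -> P (Y @^-1` A) = L A.

(* Possibly degenerate, so that correlations -1 and 1 are allowed. *)
Definition gaussian_vector (X : T -> R * R) : Prop :=
  forall a c : R, exists m s : R, (0 <= s)%R /\
    has_law (fun t => a * (X t).1 + c * (X t).2)%R (normal_law m s).

Definition correlation (Y Z : T -> R) : R :=
  (fine (covariance P Y Z) /
   (Num.sqrt (fine 'V_P[Y]) * Num.sqrt (fine 'V_P[Z])))%R.

Definition std_gaussian_vector (rho : R) (X : T -> R * R) : Prop :=
  [/\ gaussian_vector X,
      has_law (fun t => (X t).1) (normal_prob 0 1),
      has_law (fun t => (X t).2) (normal_prob 0 1) &
      correlation (fun t => (X t).1) (fun t => (X t).2) = rho].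

Definition independent (X : nat -> T -> R * R) : Prop :=
  forall (J : {fset nat}) (A : nat -> set (R * R)),
    (forall i, measurable (A i)) ->
    P (\bigcap_(i in [set` J]) (X i @^-1` A i)) =
    \prod_(i <- J) P (X i @^-1` A i).

End random_vectors.

Section normalized_maximum.
Context d (T : measurableType d) (R : realType) (P : probability T R).
Variables (beta : R) (X : nat -> {RV P >-> (R * R)%type}).

Definition max_upto (u : nat -> R) (n : nat) : R :=
  \big[Num.max/u 0]_(i < n.+1) u i.

(* Indices are 0-based: X i is the (i+1)-st vector of the sequence, so this is
   the maximum of n+1 vectors, to be used with beta = b_(n+1). *)
Definition normalized_max (n : nat) (t : T) : R * R :=
  (max_upto (fun i => beta * ((X i t).1 - beta)) n,
   max_upto (fun i => beta * ((X i t).2 - beta)) n).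

Let measurable_max_upto (u : nat -> T -> R) n :
  (forall i, measurable_fun setT (u i)) ->
  measurable_fun setT (fun t => max_upto (u ^~ t) n).
Proof.
move=> mu; rewrite /max_upto; elim: (index_enum _) => [|i s ih].
  by under eq_fun do rewrite big_nil; exact: mu.
by under eq_fun do rewrite big_cons; exact: measurable_maxr.
Qed.

Let measurable_normalized_max n : measurable_fun setT (normalized_max n).
Proof.
have m1 i : measurable_fun setT (fun t => (X i t).1).
  by apply: measurableT_comp => //; exact: measurable_funPT.
have m2 i : measurable_fun setT (fun t => (X i t).2).
  by apply: measurableT_comp => //; exact: measurable_funPT.
apply/measurable_fun_pairP; split; apply: measurable_max_upto => i;
  by apply: measurable_funM => //; apply: measurable_funB.
Qed.

HB.instance Definition _ n :=
  isMeasurableFun.Build _ _ _ _ (normalized_max n) (measurable_normalized_max n).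

End normalized_maximum.

Section empirical_measure.
Context {R : realType}.
Variables (beta : R) (rho : nat -> R).

Definition lambda_of (r : R) : ext_nneg R :=
  ext_nneg_of_real (sqrtr_ge0 (beta ^+ 2 * (1 - r) / 2)).

(* With the same shift: empirical n, for beta = b_(n+1), is nu_(n+1). *)
Definition empirical (n : nat) : set (ext_nneg R) -> \bar R :=
  mscale (n.+1%:R^-1)%:nng (msum (fun i => \d_(lambda_of (rho i))) n.+1).

HB.instance Definition _ n := Measure.on (empirical n).

Let empirical_setT n : empirical n setT = 1%E.
Proof.
rewrite /empirical /mscale/= /msum.
under eq_bigr do rewrite /= diracT.
rewrite sumEFin sumr_const card_ord -EFinM mulVf// pnatr_eq0//.
Qed.

HB.instance Definition _ n :=
  Measure_isProbability.Build _ _ _ (empirical n) (empirical_setT n).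

End empirical_measure.

Section limit_distribution.
Context {R : realType}.

Definition std_normal_cdf (x : R) : R := fine (normal_prob 0 1 `]-oo, x]).

(* The values at 0 and +oo are the limits of the generic expression. *)
Definition limit_integrand (x y : R) (l : ext_nneg R) : R :=
  match \val l with
  | r%:E => if r == 0 then expR (- Num.min x y)
            else std_normal_cdf (r + (y - x) / (2 * r)) * expR (- x) +
                 std_normal_cdf (r + (x - y) / (2 * r)) * expR (- y)
  | _ => expR (- x) + expR (- y)
  end.

Definition limit_cdf (nu : probability (ext_nneg R) R) (x y : R) : R :=
  expR (- \int[nu]_l limit_integrand x y l).

Definition has_joint_cdf (mu : probability (R * R)%type R) (G : R -> R -> R) :
    Prop :=
  forall x y, mu (`]-oo, x] `*` `]-oo, y]) = (G x y)%:E.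

End limit_distribution.

(* Main.v *)
(* Let h_(x,y) denote the integrand of -log F_nu. The distribution function of the
   normalized maximum at (x, y) is the product of the
   P(X_i <= b_n + (x, y) / b_n), and n times one minus the i-th factor is, uniformly
   in rho_i, close to h_(x,y) at lambda = sqrt(b_n^2 (1 - rho_i) / 2). Hence the
   product differs by o(1) from exp(- int h_(x,y) dnu_n). As h_(x,y) is continuous on
   [0, +oo], nu_n --> nu implies convergence to F_nu, which is the distribution
   function of a law with Gumbel first marginal and explicit conditional laws.

   Conversely, if the maxima converge, then int f dnu_n converges for every
   f = h_(x,y), and so for all uniform limits of linear combinations of these.
   Differentiating in x and then in z = y - x yields the functions
   lambda |-> exp(- lambda^2 / 2) / lambda * exp(- t / lambda^2) for t > 0, and, by
   the Weierstrass theorem in the variable exp(- 1 / lambda^2), all continuous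
   functions on [0, +oo]; as in the Riesz theorem, the limits are the integrals
   with respect to a probability measure.

   To attain nu, choose rho_i so that exp(- b_i sqrt((1 - rho_i) / 2)) is
   essentially a quantile of the law of exp(- lambda) under nu at the i-th point
   of an equidistributed sequence; since b_n / b_i --> 1 for i proportional to n,
   nu_n --> nu. The i.i.d. Gaussian pairs are functions of one uniform variable,
   whose binary digits are repeatedly split into two independent halves. *)
Require Import Defs.
From HB Require Import structures.
From mathcomp Require Import all_boot all_order all_algebra finmap.
From mathcomp Require Import all_classical all_reals all_analysis.
From mathcomp Require Import measurable_realfun ring lra zify.

Set Implicit Arguments.
Unset Strict Implicit.
Unset Printing Implicit Defensive.

Import Order.TTheory GRing.Theory Num.Theory.
Import numFieldNormedType.Exports.

Local Open Scope classical_set_scope.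
Local Open Scope ring_scope.

(** * Bounded measurable functions on probability spaces *)

Section bounded_measurable.
Context d (T : measurableType d) (R : realType).
Implicit Types f g : T -> R.

(** A Gaussian vector is specified here only through the laws of its linear combinations, so even
    the value of its distribution function at a point is a uniqueness question; it is settled by a
    trigonometric Cramér-Wold argument without Fourier inversion. Uniformity in the correlation does
    not come from a single estimate: for bounded $\lambda$ one conditions on one coordinate, with an
    error of order $b_n^{-2}$; for large $\lambda$ a bound on the sum of the two coordinates shows
    that joint exceedances are negligible. In the converse direction nothing is known in advance
    about the limit law of the maxima, but the means of $h_{(x,y)}$ are Lipschitz in $(e^{-x},
    e^{-y})$ uniformly in $n$, which gives convergence of the distribution functions at every point.
    Differentiation is replaced by difference quotients converging uniformly on $[0,\infty]$,
    because convergence of integrals passes to uniform limits. At $\lambda = 0$ the integrand has a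
    kink, so the construction of the law $F_\nu$ also uses two-sided bounds on increments instead of
    derivatives. *)

Definition bmeas f := measurable_fun setT f /\ exists M : R, forall x, `|f x| <= M.

Lemma bmeas_cst (r : R) : bmeas (fun=> r).
Proof. by split; [exact: measurable_cst|exists `|r|]. Qed.

Lemma bmeasD f g : bmeas f -> bmeas g -> bmeas (fun x => f x + g x).
Proof.
move=> [mf [M fM]] [mg [N gN]]; split; first exact: measurable_funD.
by exists (M + N) => x; rewrite (le_trans (ler_normD _ _))// lerD.
Qed.

Lemma bmeasM f g : bmeas f -> bmeas g -> bmeas (fun x => f x * g x).
Proof.
move=> [mf [M fM]] [mg [N gN]]; split; first exact: measurable_funM.
by exists (M * N) => x; rewrite normrM ler_pM.
Qed.

Lemma bmeasZ (r : R) f : bmeas f -> bmeas (fun x => r * f x).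
Proof. by move=> bf; apply: bmeasM => //; exact: bmeas_cst. Qed.

Lemma bmeasB f g : bmeas f -> bmeas g -> bmeas (fun x => f x - g x).
Proof.
move=> bf bg; rewrite (_ : (fun x => _) = (fun x => f x + (-1) * g x)).
  by apply: bmeasD => //; exact: bmeasZ.
by apply/funext => x; rewrite mulN1r.
Qed.

Lemma bmeas_sum I (r : seq I) (F : I -> T -> R) :
  (forall i, bmeas (F i)) -> bmeas (fun x => \sum_(i <- r) F i x).
Proof.
move=> bF; elim: r => [|i r ih].
  by under eq_fun do rewrite big_nil; exact: bmeas_cst.
by under eq_fun do rewrite big_cons; exact: bmeasD.
Qed.

Lemma bmeas_indic (A : set T) : measurable A -> bmeas (\1_A : T -> R).
Proof.
move=> mA; split; first exact: measurable_indic.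
by exists 1 => x; rewrite indicE; case: (x \in A); rewrite ?normr1 ?normr0.
Qed.

Lemma bmeas_norm f : bmeas f -> bmeas (fun x => `|f x|).
Proof.
move=> [mf [M fM]]; split; first exact: measurableT_comp.
by exists M => x; rewrite normr_id.
Qed.

Variable P : probability T R.

Lemma bmeas_integrable f : bmeas f -> P.-integrable setT (EFin \o f).
Proof.
move=> [mf [M fM]]; apply: measurable_bounded_integrable => //.
  exact: le_lt_trans (probability_le1 P measurableT) (ltry _).
exists M; split; first by rewrite num_real.
by move=> x Mx y _ /=; rewrite (le_trans (fM y))// ltW.
Qed.

Lemma bmeas_RintegralD f g : bmeas f -> bmeas g ->
  \int[P]_x (f x + g x) = \int[P]_x f x + \int[P]_x g x.
Proof. by move=> bf bg; rewrite RintegralD//; exact: bmeas_integrable. Qed.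

Lemma bmeas_RintegralB f g : bmeas f -> bmeas g ->
  \int[P]_x (f x - g x) = \int[P]_x f x - \int[P]_x g x.
Proof. by move=> bf bg; rewrite RintegralB//; exact: bmeas_integrable. Qed.

Lemma bmeas_RintegralZ (r : R) f : bmeas f ->
  \int[P]_x (r * f x) = r * \int[P]_x f x.
Proof. by move=> bf; rewrite RintegralZl//; exact: bmeas_integrable. Qed.

Lemma Rintegral_prob_cst (r : R) : \int[P]_x r = r.
Proof.
rewrite -[RHS]mulr1 Rintegral_cst//; congr (_ * _).
by rewrite -[RHS]/(fine 1%E); congr fine; exact: probability_setT.
Qed.

Lemma bmeas_Rintegral_sum I (r : seq I) (F : I -> T -> R) :
  (forall i, bmeas (F i)) ->
  \int[P]_x (\sum_(i <- r) F i x) = \sum_(i <- r) \int[P]_x F i x.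
Proof.
move=> bF; elim: r => [|i r ih].
  under eq_Rintegral do rewrite big_nil.
  by rewrite big_nil Rintegral_prob_cst.
under eq_Rintegral do rewrite big_cons.
by rewrite bmeas_RintegralD ?ih ?big_cons//; exact: bmeas_sum.
Qed.

Lemma le_bmeas_Rintegral f g : bmeas f -> bmeas g -> (forall x, f x <= g x) ->
  \int[P]_x f x <= \int[P]_x g x.
Proof.
by move=> bf bg fg; apply: le_Rintegral => //; exact: bmeas_integrable.
Qed.

Lemma bmeas_Rintegral_dist_le f g h : bmeas f -> bmeas g -> bmeas h ->
  (forall x, `|f x - g x| <= h x) ->
  `|\int[P]_x f x - \int[P]_x g x| <= \int[P]_x h x.
Proof.
move=> bf bg bh fgh; rewrite -bmeas_RintegralB//.
have bfg := bmeasB bf bg.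
apply: (le_trans (le_normr_Rintegral _ _)) => //; first exact: bmeas_integrable.
by apply: le_bmeas_Rintegral => //; exact: bmeas_norm.
Qed.

Lemma Rintegral_prob_indic (A : set T) : measurable A ->
  \int[P]_x (\1_A x : R) = fine (P A).
Proof. by move=> mA; rewrite /Rintegral integral_indic// setIT. Qed.

Lemma bounded_cvg_Rintegral (f_ : nat -> T -> R) f (M : R) :
  (forall n, measurable_fun setT (f_ n)) -> (forall n x, `|f_ n x| <= M) ->
  (forall x, f_ ^~ x @ \oo --> f x) ->
  (fun n => \int[P]_x f_ n x) @ \oo --> \int[P]_x f x.
Proof.
move=> mf fM ff.
have mflim : measurable_fun setT f.
  by apply: (measurable_fun_cvg _ (fun x _ => ff x)).
have bf : bmeas f.
  split=> //; exists M => x.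
  have fn : `|f_ n x| @[n --> \oo] --> `|f x| by apply: cvg_norm; exact: ff.
  rewrite -(cvg_lim _ fn)//; apply: limr_le.
    by apply/cvg_ex; exists `|f x|.
  exact: nearW.
rewrite /Rintegral; apply: fine_cvg.
rewrite fineK; last by apply: integrable_fin_num => //; exact: bmeas_integrable.
apply: (@dominated_cvg _ _ _ P setT _ _ _ (cst M%:E)) => //.
- by move=> n; apply/measurable_EFinP.
- by move=> x _; apply: cvg_EFin; [exact: nearW|exact: ff].
- by apply: (bmeas_integrable (bmeas_cst M)).
- by move=> n x _ /=; rewrite lee_fin.
Qed.

End bounded_measurable.

Lemma bmeas_comp d d' (T : measurableType d) (T' : measurableType d')
    (R : realType) (f : T' -> R) (X : T -> T') :
  bmeas f -> measurable_fun setT X -> bmeas (f \o X).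
Proof.
move=> [mf [M fM]] mX; split; first exact: measurableT_comp.
by exists M => x /=.
Qed.

Lemma Rintegral_distribution d d' (T : measurableType d)
    (T' : measurableType d') (R : realType) (P : probability T R)
    (X : {mfun T >-> T'}) (f : T' -> R) : bmeas f ->
  \int[distribution P X]_y f y = \int[P]_x f (X x).
Proof.
move=> bf; rewrite /Rintegral integral_distribution//.
  by apply/measurable_EFinP; case: bf.
by apply: (bmeas_integrable P (bmeas_comp bf _)).
Qed.

Lemma measurable_preimage d d' (T : measurableType d) (T' : measurableType d')
    (f : T -> T') (A : set T') :
  measurable_fun setT f -> measurable A -> measurable (f @^-1` A).
Proof. by move=> mf mA; rewrite -[X in measurable X]setTI; exact: mf. Qed.

Lemma same_law_integral d d' d1 (T : measurableType d) (T' : measurableType d')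
    (E : measurableType d1) (R : realType) (P : probability T R)
    (Q : probability T' R) (X : T -> E) (Y : T' -> E) (f : E -> \bar R) :
  measurable_fun setT X -> measurable_fun setT Y ->
  (forall A, measurable A -> P (X @^-1` A) = Q (Y @^-1` A)) ->
  measurable_fun setT f -> (forall y, (0 <= f y)%E) ->
  (\int[P]_x f (X x) = \int[Q]_x f (Y x))%E.
Proof.
move=> mX mY XY mf f0.
pose X' : {mfun T >-> E} := mfun_Sub (mem_set mX).
pose Y' : {mfun T' >-> E} := mfun_Sub (mem_set mY).
rewrite -[LHS](ge0_integral_distribution X')// -[RHS](ge0_integral_distribution Y')//.
by apply: eq_measure_integral => A mA _; exact: XY.
Qed.

Lemma same_law_Rintegral d d' d1 (T : measurableType d) (T' : measurableType d')
    (E : measurableType d1) (R : realType) (P : probability T R)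
    (Q : probability T' R) (X : T -> E) (Y : T' -> E) (f : E -> R) :
  measurable_fun setT X -> measurable_fun setT Y ->
  (forall A, measurable A -> P (X @^-1` A) = Q (Y @^-1` A)) ->
  bmeas f -> \int[P]_x f (X x) = \int[Q]_x f (Y x).
Proof.
move=> mX mY XY bf.
pose X' : {mfun T >-> E} := mfun_Sub (mem_set mX).
pose Y' : {mfun T' >-> E} := mfun_Sub (mem_set mY).
rewrite -[LHS](Rintegral_distribution P X')// -[RHS](Rintegral_distribution Q Y')//.
by congr fine; apply: eq_measure_integral => A mA _; exact: XY.
Qed.

Section uniqueness.
Context {R : realType}.

Let measure_oy (m : {measure set R -> \bar R}) x : (m setT < +oo)%E ->
  m (`]x, +oo[%classic) = (m setT - m (`]-oo, x]%classic))%E.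
Proof.
move=> moo.
have -> : m setT = (m (`]-oo, x]%classic) + m (`]x, +oo[%classic))%E.
  rewrite -measureU//.
    by congr (m _); apply/seteqP; split => // z _ /=; rewrite !in_itv/= andbT; case: (leP z x); [left|right].
  by apply/seteqP; split => // z [] /=; rewrite !in_itv/= andbT leNgt => /negP.
rewrite [X in (X - _)%E]addeC addeK// ge0_fin_numE//.
by apply: le_lt_trans moo; apply: le_measure; rewrite ?inE.
Qed.

(** Complementation, which uses the equal finite total masses, turns the hypothesis into equality on
    the half-lines []x, +oo[]. These form a π-system that generates the Borel sets and exhausts the
    line. *)
Lemma measure_Nyc_unique (m1 m2 : {measure set R -> \bar R}) :
  (forall x : R, m1 (`]-oo, x]%classic) = m2 (`]-oo, x]%classic)) ->
  m1 setT = m2 setT -> (m1 setT < +oo)%E ->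
  forall A, measurable A -> m1 A = m2 A.
Proof.
move=> m12 mT m1oo A mA.
apply: (@measure_unique _ _ _ (@RGenOInfty.G R) (fun n => `]- n%:R, +oo[%classic)) => //.
- exact: RGenOInfty.measurableE.
- move=> _ _ [x ->] [y ->]; exists (Num.max x y).
  apply/seteqP; split => z /=; rewrite !in_itv/= !andbT gt_max.
    by move=> [-> ->].
  by move=> /andP.
- by move=> i; eexists.
- rewrite -subTset => x _; exists (Num.trunc `|x|).+1 => //=.
  rewrite in_itv/= andbT ltrNl (le_lt_trans (ler_norm _))// normrN.
  by rewrite truncnS_gt.
- by move=> _ [x ->]; rewrite !measure_oy -?mT// m12.
- by move=> k; apply: le_lt_trans m1oo; apply: le_measure; rewrite ?inE.
Qed.

End uniqueness.

(** Heine-Cantor in which only the centre has to lie in [K]; the second point, typically a grid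
    point, may leave it. In the near-covering form of compactness the radius is the parameter,
    tending to 0 from the right. *)
Lemma compact_unif_dist (R : realType) (U : pseudoMetricType R) (f : U -> R)
    (K : set U) (e : R) : compact K -> continuous f -> 0 < e ->
  exists2 r : R, 0 < r & forall x y, K x -> ball x r y -> `|f x - f y| < e.
Proof.
move=> /compact_near_coveringP cK cf e0.
have := cK R (0^'+) (fun r x => forall y, ball x r y -> `|f x - f y| < e) _.
move=> /(_ _)[x Kx|r0 /= r0_gt0 Hr].
  have e20 : 0 < e / 2 by rewrite divr_gt0.
  have /cvgrPdist_lt/(_ _ e20) := cf x.
  move=> /nbhs_ballP[r /= r0 fr].
  have r20 : 0 < r / 2 by rewrite divr_gt0.
  exists (ball x (r / 2), [set t | t < r / 2]) => /=.
    split; first exact: nbhsx_ballx.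
    exact: nbhs_right_lt.
  move=> [y t] /= [xy tr] z yz.
  rewrite (splitr e) -(subrKA (f x)) (le_lt_trans (ler_normD _ _))// ltrD//.
    rewrite distrC; apply: fr => /=; apply: le_ball xy.
    by rewrite ler_pdivrMr// mulr_natr mulr2n lerDl ltW.
  apply: fr => /=; rewrite (splitr r); apply: ball_triangle xy _.
  by apply: le_ball yz; exact: ltW.
exists (r0 / 2); first by rewrite divr_gt0.
move=> x y Kx; apply: Hr => //=; last by rewrite divr_gt0.
by rewrite sub0r normrN gtr0_norm ?divr_gt0// ltr_pdivrMr// mulr_natr mulr2n ltrDl.
Qed.

(** * Bernstein polynomials and the Weierstrass theorem on [0, 1] *)

Section bernstein.
Context {R : realType}.

(** De Casteljau's recursion: the value at [x] is the expectation of [g S] for [S] binomial with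
    parameters [n] and [x], obtained by conditioning on one trial. Since [g] is indexed by the
    number of successes, monotonicity, linearity and the variance follow by induction without
    binomial coefficients. *)
Fixpoint bernstein n (g : nat -> R) : {poly R} :=
  if n is m.+1 then
    'X * bernstein m (fun k => g k.+1) + (1%:P - 'X) * bernstein m g
  else (g 0%N)%:P.

Lemma bernstein_le n (g h : nat -> R) (x : R) : 0 <= x <= 1 ->
  (forall k, (k <= n)%N -> g k <= h k) -> (bernstein n g).[x] <= (bernstein n h).[x].
Proof.
move=> /andP[x0 x1]; elim: n g h => [|n ih] g h gh /=.
  by rewrite !hornerC gh.
rewrite !hornerE; apply: lerD; apply: ler_wpM2l; rewrite ?subr_ge0//.
  by apply: ih => k kn /=; apply: gh.
by apply: ih => k kn /=; apply: gh; rewrite ltnW.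
Qed.

Lemma bernsteinD n (g h : nat -> R) (x : R) :
  (bernstein n (fun k => g k + h k)).[x] = (bernstein n g).[x] + (bernstein n h).[x].
Proof.
elim: n g h => [|n ih] g h /=; first by rewrite !hornerC.
rewrite !(hornerD, hornerM, hornerN, hornerX, hornerC).
by rewrite (ih (fun k => g k.+1) (fun k => h k.+1)) (ih g h); ring.
Qed.

Lemma bernsteinZ n (g : nat -> R) (a x : R) :
  (bernstein n (fun k => a * g k)).[x] = a * (bernstein n g).[x].
Proof.
elim: n g => [|n ih] g /=; first by rewrite !hornerC.
by rewrite !hornerE (ih (fun k => g k.+1)) ih; ring.
Qed.

Lemma bernstein_cst n (a x : R) : (bernstein n (fun=> a)).[x] = a.
Proof.
elim: n => [|n ih] /=; first by rewrite !hornerC.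
by rewrite !hornerE ih; ring.
Qed.

(** Variance plus squared bias of a binomial variable. The centre [c] is arbitrary because a success
    in the recursion moves it to [c - 1]. *)
Lemma bernstein_sqr n (c x : R) :
  (bernstein n (fun k => (k%:R - c) ^+ 2)).[x] =
  n%:R * x * (1 - x) + (n%:R * x - c) ^+ 2.
Proof.
elim: n c => [|n ih] c /=; first by rewrite !hornerC; ring.
rewrite !hornerE ih.
rewrite (_ : (fun k => _) = fun k => (k%:R - (c - 1)) ^+ 2).
  by rewrite ih -natr1; ring.
by apply/funext => k /=; rewrite -natr1; ring.
Qed.

Lemma weierstrass01 (f : R -> R) (e : R) : continuous f -> 0 < e ->
  exists p : {poly R}, forall x : R, 0 <= x <= 1 -> `|f x - p.[x]| <= e.
Proof.
move=> cf e0.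
have e20 : 0 < e / 2 by rewrite divr_gt0.
have [r r0 fr] := compact_unif_dist (segment_compact (a := 0) (b := 1)) cf e20.
have [M fM] : exists M : R, forall x : R, 0 <= x <= 1 -> `|f x| <= M.
  have := @EVT_max R (fun x => `|f x|) 0 1 ler01.
  case=> [|c c01 fc].
    by apply: continuous_subspaceT => x; apply: continuous_comp; [exact: cf|exact: norm_continuous].
  by exists `|f c| => x x01; apply: fc; rewrite in_itv.
have M0 : 0 <= M by rewrite (le_trans _ (fM 0 _))// lexx ler01.
(* This [N] makes the Chebyshev term [2 * M / (r ^+ 2 * N%:R)] at most [e / 2]. *)
pose N := (Num.trunc (4 * M / (e * r ^+ 2))).+1.
have N0 : 0 < N%:R :> R by rewrite ltr0n.
pose g k := f (k%:R / N%:R).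
exists (bernstein N g) => x x01.
(* A quadratic majorant of the error: the constant serves for nodes closer than [r] to [x], the
   square for the others. Its Bernstein value at [x] is explicit. *)
pose q k := e / 2 + 2 * M / (r ^+ 2 * N%:R ^+ 2) * (k%:R - N%:R * x) ^+ 2.
have gq k : (k <= N)%N -> `|f x - g k| <= q k.
  move=> kN; rewrite /g /q.
  have k01 : 0 <= (k%:R / N%:R : R) <= 1.
    by rewrite divr_ge0//= ler_pdivrMr// mul1r ler_nat.
  have [xr|xr] := ltP `|x - k%:R / N%:R| r.
    apply: (@le_trans _ _ (e / 2)).
      by apply/ltW/fr => //=; rewrite in_itv.
    by rewrite lerDl mulr_ge0 ?sqr_ge0// divr_ge0 ?mulr_ge0 ?exprn_ge0// ltW.
  rewrite (le_trans (ler_normB _ _))// (@le_trans _ _ (2 * M))//.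
    by rewrite mulr2n mulrDl mul1r lerD// fM.
  rewrite (@le_trans _ _ (2 * M * ((k%:R - N%:R * x) ^+ 2 / (r ^+ 2 * N%:R ^+ 2))))//.
    rewrite ler_peMr// ?mulr_ge0//.
    rewrite ler_pdivlMr ?mulr_gt0 ?exprn_gt0// mul1r -exprMn.
    rewrite -[leRHS]real_normK ?num_real// ler_pXn2r// ?nnegrE ?mulr_ge0 ?(ltW r0)//.
    rewrite (_ : k%:R - _ = - ((x - k%:R / N%:R) * N%:R)).
      by rewrite normrN normrM (gtr0_norm N0) ler_pM2r.
    by field; rewrite gt_eqF.
  by rewrite mulrA mulrAC [leRHS]addrC lerDl ltW.
have qe : (bernstein N q).[x] <= e.
  rewrite bernsteinD bernstein_cst bernsteinZ bernstein_sqr subrr expr0n/= addr0.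
  rewrite [leRHS](splitr e) lerD2l.
  have r2 : 0 < r ^+ 2 by rewrite exprn_gt0.
  have xx : x * (1 - x) <= 1 by nra.
  have x1x : 0 <= x * (1 - x) by nra.
  have NM : 4 * M <= e * r ^+ 2 * N%:R.
    by rewrite [leRHS]mulrC -ler_pdivrMr ?mulr_gt0//; exact: ltW (truncnS_gt _).
  rewrite (_ : _ * _ = 2 * M / (r ^+ 2 * N%:R) * (x * (1 - x))).
    rewrite (@le_trans _ _ (2 * M / (r ^+ 2 * N%:R)))//.
      by rewrite ler_piMr// divr_ge0 ?mulr_ge0// ltW.
    by rewrite ler_pdivrMr ?mulr_gt0//; nra.
  by field; rewrite !gt_eqF.
rewrite ler_norml; apply/andP; split.
  rewrite -subr_ge0 opprK [X in 0 <= X](_ : _ = f x + e - (bernstein N g).[x]); last by ring.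
  rewrite subr_ge0 -[X in X + _](bernstein_cst N (f x) x).
  rewrite (le_trans _ (lerD (lexx _) qe))// -bernsteinD.
  apply: bernstein_le => // k kN; have := gq k kN; rewrite ler_norml => /andP[].
  lra.
rewrite lerBlDr (le_trans _ (lerD qe (lexx _)))// -bernsteinD -{1}(bernstein_cst N (f x) x).
apply: bernstein_le => // k kN; have := gq k kN; rewrite ler_norml => /andP[].
lra.
Qed.

End bernstein.

(* [normal_prob] and the Lebesgue-Stieltjes measures live on [measurableTypeR R],
   whose display differs from the one of [R]. *)
Section probability_on_R.
Context {R : realType}.

Let measurable_idR :
  @measurable_fun _ _ (measurableTypeR R) R setT (fun x : R => x).
Proof. by move=> _ Y mY; rewrite setTI. Qed.

Definition probR (P : probability (measurableTypeR R) R) : probability R R :=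
  distribution P
    (@mfun_Sub _ _ (measurableTypeR R) R _ (mem_set measurable_idR)).

Lemma probRE P A : probR P A = P A.
Proof. by []. Qed.

Lemma Rintegral_probR P (f : R -> R) : bmeas f ->
  \int[probR P]_x f x = \int[P]_x f x.
Proof. by move=> bf; rewrite /probR Rintegral_distribution. Qed.

Lemma probability_Nyc_unique (P Q : probability R R) :
  (forall x : R, P (`]-oo, x]%classic) = Q (`]-oo, x]%classic)) ->
  forall A, measurable A -> P A = Q A.
Proof.
move=> PQ; apply: measure_Nyc_unique => //.
  exact: etrans (probability_setT P) (esym (probability_setT Q)).
exact: le_lt_trans (probability_le1 P measurableT) (ltry _).
Qed.

Variable P : probability R R.
Let measurable_id' : measurable_fun setT (fun x : R => x).
Proof. by []. Qed.
Let X : {RV P >-> R} := mfun_Sub (mem_set measurable_id').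

Lemma cvg_Nyc_y : fine (P (`]-oo, x]%classic)) @[x --> +oo] --> (1:R).
Proof.
have /fine_cvgP[_ h] := cvg_cdfy1 X; exact: h.
Qed.

Lemma cvg_Nyc_Ny : fine (P (`]-oo, x]%classic)) @[x --> -oo] --> (0:R).
Proof.
have /fine_cvgP[_ h] := cvg_cdfNy0 X; exact: h.
Qed.

End probability_on_R.

(** * Continuous approximation of half-line indicators *)

Section ramp.
Context {R : realType}.
Implicit Types k t u x y : R.

Lemma lipschitz_continuous (f : R -> R) (k : R) :
  (forall x y, `|f x - f y| <= k * `|x - y|) -> continuous f.
Proof.
move=> fk x; apply/cvgrPdist_le => e e0.
have k0 : 0 < `|k| + 1 by rewrite ltr_wpDl.
near=> y; apply: (le_trans (fk _ _)).
apply: (@le_trans _ _ ((`|k| + 1) * `|x - y|)).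
  by rewrite ler_wpM2r// (le_trans (ler_norm _))// lerDl.
rewrite mulrC -ler_pdivlMr//; apply/ltW; near: y.
by apply: cvgr_dist_lt; [exact: cvg_id|rewrite divr_gt0].
Unshelve. all: by end_near. Qed.

(** For [k > 0] it is 1 up to [t], has slope [- k] and vanishes from [t + k^-1] on; it decreases to
    the indicator of []-oo, t]] as [k] grows. For [k = 0] it is constantly 1. *)
Definition ramp k t u := Num.max 0 (Num.min 1 (1 + k * (t - u))).

Lemma ramp_ge0 k t u : 0 <= ramp k t u.
Proof. by rewrite /ramp le_max lexx. Qed.

Lemma ramp_le1 k t u : ramp k t u <= 1.
Proof. by rewrite /ramp ge_max ler01 ge_min lexx. Qed.

Lemma norm_ramp_le1 k t u : `|ramp k t u| <= 1.
Proof. by rewrite ger0_norm ?ramp_ge0// ramp_le1. Qed.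

Lemma ramp_eq1 k t u : 0 <= k -> u <= t -> ramp k t u = 1.
Proof.
move=> k0 ut; rewrite /ramp min_l ?max_r// lerDl mulr_ge0// subr_ge0//.
Qed.

Lemma ramp_eq0 k t u : 1 <= k * (u - t) -> ramp k t u = 0.
Proof.
move=> kut; rewrite /ramp max_l// ge_min; apply/orP; right.
by move: kut; rewrite -[t - u]opprB mulrN; lra.
Qed.

Let clip_lip x y : `|Num.max 0 (Num.min 1 x) - Num.max 0 (Num.min 1 y)| <= `|x - y|.
Proof.
move: (ler_norm (x - y)) (ler_norm (y - x)); rewrite (distrC y x).
move: `|x - y| => n h1 h2; rewrite ler_norml.
case: (leP 1 x) => ?; case: (leP 1 y) => ?; rewrite ?(max_r ler01).
- lra.
- case: (leP 0 y) => ?; lra.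
- case: (leP 0 x) => ?; lra.
- case: (leP 0 x) => ?; case: (leP 0 y) => ?; lra.
Qed.

Lemma ramp_lip k t t' u u' : 0 <= k ->
  `|ramp k t u - ramp k t' u'| <= k * `|(t - u) - (t' - u')|.
Proof.
move=> k0; apply: (le_trans (clip_lip _ _)).
by rewrite opprD addrACA subrr add0r -mulrBr normrM ger0_norm.
Qed.

Lemma ramp_continuous k t : 0 <= k -> continuous (ramp k t).
Proof.
move=> k0; apply: (@lipschitz_continuous _ k) => x y.
apply: (le_trans (ramp_lip t t x y k0)).
rewrite (_ : t - x - (t - y) = - (x - y)) ?normrN//; ring.
Qed.

Lemma ramp_homo k t t' u : 0 <= k -> t <= t' -> ramp k t u <= ramp k t' u.
Proof.
move=> k0 tt'; have : 1 + k * (t - u) <= 1 + k * (t' - u).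
  by rewrite lerD2l ler_wpM2l// lerD2r.
rewrite /ramp; move: (1 + _) (1 + _) => a b ab.
by rewrite ge_max !le_max !le_min lexx !ge_min ab ler01 lexx ?orbT//= orbT.
Qed.

Lemma ramp_cvg t u : ramp n%:R t u @[n --> \oo] --> (\1_`]-oo, t] u : R).
Proof.
apply: cvg_near_cst; have [ut|tu] := leP u t.
  apply: nearW => n; rewrite indicE mem_set/= ?in_itv//=.
  by rewrite ramp_eq1.
have ut : 0 < u - t by rewrite subr_gt0.
near=> n; rewrite indicE memNset/= ?in_itv/= ?leNgt ?tu//.
rewrite ramp_eq0// -ler_pdivrMr// mul1r.
by near: n; exact: nbhs_infty_ger.
Unshelve. all: by end_near. Qed.

End ramp.

(** * The standard normal law *)

Section normal.
Context {R : realType}.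
Implicit Types (m s x y : R) (A : set R).
Local Notation mu := (@lebesgue_measure R).
Local Notation N01 := (probR (normal_prob (0:R) 1)).
Local Notation Phi := (@std_normal_cdf R).
Local Notation phi := (normal_pdf (0:R) 1).

Lemma integral_normal_prob m s (f : R -> \bar R) :
  (normal_prob m s).-integrable setT f ->
  (\int[normal_prob m s]_x f x = \int[mu]_x (f x * (normal_pdf m s x)%:E))%E.
Proof.
move=> intf; have mf := measurable_int _ intf.
rewrite -(Radon_Nikodym_change_of_variables (normal_prob_dominates m s))//=.
apply: ae_eq_integral => //.
- apply: emeasurable_funM => //; apply: (measurable_int mu).
  apply: (integrableS _ _ (@subsetT _ _)) => //=.
  by apply: Radon_Nikodym_integrable; exact: normal_prob_dominates.
- apply: emeasurable_funM => //=; apply/measurableT_comp => //=.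
  exact: measurable_normal_pdf.
- apply: ae_eqe_mul2l => /=.
  rewrite Radon_NikodymE//=; first exact: normal_prob_dominates.
  move=> abmu; case: cid => /= h [h1 h2 h3].
  apply: integral_ae_eq => //=.
  + by apply/measurableT_comp => //; exact: measurable_normal_pdf.
  + by move=> E _ mE; rewrite -h3.
Qed.

Lemma Rintegral_normal_prob m s (f : R -> R) : bmeas f ->
  \int[probR (normal_prob m s)]_x f x = \int[mu]_x (f x * normal_pdf m s x).
Proof.
move=> bf; rewrite Rintegral_probR// /Rintegral integral_normal_prob//.
exact: (bmeas_integrable (normal_prob m s) bf).
Qed.

Lemma std_pdfE x : phi x = normal_peak 1 * expR (- (x ^+ 2 / 2)).
Proof.
by rewrite normal_pdfE ?oner_eq0// /normal_fun subr0 expr1n mulr2n mulNr.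
Qed.

Lemma normal_pdf_affine m s x : 0 < s -> normal_pdf m s x = phi ((x - m) / s) / s.
Proof.
move=> s0; rewrite std_pdfE normal_pdfE ?gt_eqF// /normal_fun.
rewrite (_ : normal_peak s = normal_peak 1 / s).
  rewrite mulrAC; congr (_ * expR _ / _).
  by field; rewrite gt_eqF.
rewrite /normal_peak -[_ *+ 2]mulr_natr -mulrA sqrtrM ?sqr_ge0// sqrtr_sqr.
by rewrite gtr0_norm// invfM mulrC expr1n mul1r mulr_natr.
Qed.

Lemma phi_gt0 x : 0 < phi x.
Proof. by rewrite std_pdfE mulr_gt0 ?expR_gt0// normal_peak_gt0// oner_eq0. Qed.

Lemma normal_peak1_le1 : normal_peak (1:R) <= 1.
Proof.
have pi2 : (1:R) <= pi *+ 2 by have := pi_ge2 R; rewrite mulr2n; lra.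
have pi0 : (0:R) < pi *+ 2 by exact: lt_le_trans pi2.
rewrite /normal_peak expr1n mul1r invf_le1 ?sqrtr_gt0//.
by rewrite -[leLHS]sqrtr1 ler_sqrt// ltW.
Qed.

Lemma phi_le1 x : phi x <= 1.
Proof.
apply: le_trans normal_peak1_le1; exact: normal_pdf_ub.
Qed.

Lemma norm_phi_le1 x : `|x| * phi x <= 1.
Proof.
rewrite std_pdfE; have p0 := normal_peak_ge0 (1:R); have p1 := normal_peak1_le1.
have e0 := expR_gt0 (- (x ^+ 2 / 2)).
have : `|x| * expR (- (x ^+ 2 / 2)) <= 1.
  rewrite expRN ler_pdivrMr ?expR_gt0// mul1r.
  apply: le_trans (expR_ge1Dx _); rewrite -[x ^+ 2]real_normK ?num_real//.
  by have := sqr_ge0 (`|x| - 1); nra.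
have := normr_ge0 x; nra.
Qed.

Lemma phiN x : phi (- x) = phi x.
Proof. by rewrite !std_pdfE sqrrN. Qed.

Lemma continuous_phi : continuous phi.
Proof. by apply: continuous_normal_pdf; rewrite oner_eq0. Qed.

Lemma N01_Nyc x : N01 (`]-oo, x]%classic) = (Phi x)%:E.
Proof. by rewrite /std_normal_cdf fineK// fin_num_measure. Qed.

Lemma is_derive_Phi x : is_derive x 1 Phi (phi x).
Proof.
have h := @continuous_FTC1 R phi -oo%O x (x + 1) _ _ _ (continuous_phi (x:=x)).
have [|||d1 d2] := h; first by rewrite ltrDl.
- by apply: (integrableS measurableT) => //; exact: integrable_normal_pdf.
- first [exact: ltNyr|by rewrite lt_neqAle /= bnd_simp|by rewrite /Order.lt/=].
- by split; [exact: d1|rewrite -d2 derive1E].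
Qed.

Lemma Phi_ge0 x : 0 <= Phi x.
Proof. by rewrite fine_ge0. Qed.

Lemma Phi_le1 x : Phi x <= 1.
Proof. by rewrite -lee_fin -N01_Nyc probability_le1. Qed.

Lemma Phi_homo : {homo Phi : x y / x <= y}.
Proof.
move=> x y xy; rewrite -lee_fin -!N01_Nyc le_measure ?inE//.
by move=> z /=; rewrite !in_itv/= => /le_trans; apply.
Qed.

Lemma continuous_Phi : continuous Phi.
Proof.
move=> x; apply: differentiable_continuous; apply/derivable1_diffP.
by have [] := is_derive_Phi x.
Qed.

Lemma Phi_MVT x y : exists2 c, Num.min x y <= c <= Num.max x y &
  Phi y - Phi x = phi c * (y - x).
Proof.
wlog xy : x y / x <= y => [hw|].
  have [xy|yx] := leP x y; first by have := hw x y xy; rewrite min_l// max_r.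
  have [c cxy e] := hw y x (ltW yx); exists c; last by rewrite -opprB e; ring.
  by move: cxy; rewrite min_l ?max_r //; exact: ltW.
rewrite min_l// max_r//.
have [||c] := @MVT_segment R Phi phi x y xy.
- by move=> z _; exact: is_derive_Phi.
- by apply: continuous_subspaceT; exact: continuous_Phi.
- by rewrite in_itv/= => cxy e; exists c.
Qed.

Lemma Phi_lip x y : `|Phi y - Phi x| <= `|y - x|.
Proof.
have [c _ ->] := Phi_MVT x y.
by rewrite normrM ler_piMl// gtr0_norm ?phi_gt0// phi_le1.
Qed.

(** The mean value point [c] lies farther from 0 than [x], and $|c|\varphi(c) \le 1$. A relative
    perturbation of the argument therefore costs no more for large arguments than for small ones. *)
Lemma Phi_scale r x : 1 <= r -> `|Phi (r * x) - Phi x| <= r - 1.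
Proof.
move=> r1; have [c cx ->] := Phi_MVT x (r * x).
have {cx} cx : `|x| <= `|c|.
  have [x0|x0] := leP 0 x.
    have rx : x <= r * x by rewrite ler_peMl.
    by move: cx; rewrite min_l// max_r// => /andP[xc _]; rewrite !ger0_norm// (le_trans x0).
  have rx : r * x <= x by nra.
  move: cx; rewrite min_r// max_l// => /andP[_ cx]; rewrite !ltr0_norm//; first by rewrite lerN2.
  exact: le_lt_trans x0.
rewrite (_ : r * x - x = (r - 1) * x); last by ring.
rewrite normrM normrM (ger0_norm (ltW (phi_gt0 c))) (ger0_norm (_ : 0 <= r - 1)) ?subr_ge0//.
rewrite mulrCA ler_piMr ?subr_ge0// (le_trans _ (norm_phi_le1 c))// mulrC.
by rewrite ler_wpM2r// ltW// phi_gt0.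
Qed.

Lemma N01_opp A : measurable A -> N01 (-%R @^-1` A) = N01 A.
Proof.
move=> mA; have mN : measurable_fun setT (-%R : R -> R) by [].
pose X : {mfun R >-> R} := mfun_Sub (mem_set mN).
rewrite -[LHS]/(distribution N01 X A) -?probRE.
apply: (probability_Nyc_unique (P := distribution N01 X) (Q := N01)) => [x|]; last exact: mA.
rewrite /distribution/= /pushforward/= ?probRE.
rewrite (_ : _ @^-1` _ = `[-x, +oo[%classic); last first.
  by apply/seteqP; split=> z /=; rewrite !in_itv/= andbT lerNl.
rewrite /= (_ : id @^-1` _ = `]-oo, x]%classic)// /normal_prob.
have := @ge0_integration_by_substitutionNy R phi (- x).
rewrite opprK => ->.
- by apply: eq_integral => z _ /=; rewrite phiN.
- by apply: continuous_subspaceT; exact: continuous_phi.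
- by move=> z _; exact: normal_pdf_ge0.
Qed.

Lemma N01_affine_gt0 m s A : 0 < s -> measurable A ->
  N01 ((fun z => m + s * z) @^-1` A) = normal_prob m s A.
Proof.
move=> s0 mA; have mN : measurable_fun setT (fun z : R => m + s * z).
  by apply: measurable_funD => //; exact: measurable_funM.
pose X : {mfun R >-> R} := mfun_Sub (mem_set mN).
rewrite -[LHS]/(distribution N01 X A) -?probRE.
apply: (probability_Nyc_unique (P := distribution N01 X) (Q := probR (normal_prob m s))) => [x|]; last exact: mA.
rewrite /distribution/= /pushforward/= ?probRE.
pose F z := (z - m) / s.
have dF (z : R) : is_derive z 1 F s^-1.
  by rewrite /F; apply: is_derive_eq; rewrite scaler0 add0r subr0 scaler1.
have F'E : F^`()%classic = cst s^-1.
  by apply/funext => z; rewrite derive1E; have [] := dF z.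
rewrite (_ : _ @^-1` _ = `]-oo, F x]%classic); last first.
  by apply/seteqP; split=> z /=; rewrite !in_itv/= /F ler_pdivlMr// mulrC lerBrDl.
rewrite /normal_prob increasing_ge0_integration_by_substitutionNy//.
- apply: eq_integral => z _ /=; rewrite F'E /F /=.
  by rewrite (normal_pdf_affine _ _ s0).
- by move=> y z _ _ yz; rewrite /F ltr_pM2r ?invr_gt0// ltrD2r.
- by rewrite F'E => ? _; exact: cvg_cst.
- by rewrite F'E; exact: is_cvg_cst.
- by rewrite F'E; exact: cvg_cst.
- split; first by move=> z _; have [] := dF z.
  apply: cvg_at_left_filter; apply: differentiable_continuous; apply/derivable1_diffP.
  by have [] := dF x.
- apply/gt0_cvgMlNy; last exact: cvg_addrr_Ny.
  by rewrite invr_gt0.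
- by apply: continuous_subspaceT; exact: continuous_phi.
- by move=> z _; exact: normal_pdf_ge0.
Qed.

Lemma N01_affine m s A : 0 <= s -> measurable A ->
  N01 ((fun z => m + s * z) @^-1` A) = normal_law m s A.
Proof.
rewrite le_eqVlt /normal_law => /predU1P[<-|s0] mA; last first.
  by rewrite (gt_eqF s0); exact: N01_affine_gt0.
rewrite eqxx diracE (_ : (fun z => _) = cst m); last first.
  by apply/funext => z; rewrite mul0r addr0.
have [mAi|mAn] := boolP (m \in A).
  rewrite (_ : _ @^-1` _ = setT); first exact: probability_setT.
  by apply/seteqP; split=> z //= _; exact: set_mem.
rewrite (_ : _ @^-1` _ = set0) ?measure0//.
by apply/seteqP; split=> z //= /mem_set; rewrite (negbTE mAn).
Qed.

Lemma N01_scale s A : measurable A ->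
  N01 ((fun z => s * z) @^-1` A) = normal_law 0 `|s| A.
Proof.
move=> mA; rewrite -N01_affine//; have [s0|s0] := leP 0 s.
  by congr (N01 _); apply/seteqP; split=> z /=; rewrite add0r (ger0_norm s0).
rewrite -N01_opp; last first.
  by apply: measurable_preimage => //; exact: measurable_funM.
by congr (N01 _); apply/seteqP; split=> z /=; rewrite add0r (ltr0_norm s0) mulrN mulNr.
Qed.

(** Both sides are the joint density at [(w, v)] of a standard normal $W$ and of $V = aW + sZ$, with
    $Z$ standard normal and independent of $W$: disintegrated along $W$ on the left, along $V$ on
    the right. *)
Lemma normal_pdf_gaussian_mul a s v w : 0 < s ->
  phi w * normal_pdf (a * w) s v =
  normal_pdf 0 (Num.sqrt (a ^+ 2 + s ^+ 2)) v *
  normal_pdf (a * v / (a ^+ 2 + s ^+ 2)) (s / Num.sqrt (a ^+ 2 + s ^+ 2)) w.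
Proof.
move=> s0; set r := Num.sqrt _.
have r2 : r ^+ 2 = a ^+ 2 + s ^+ 2 by rewrite sqr_sqrtr// addr_ge0// sqr_ge0.
have r0 : 0 < r by rewrite sqrtr_gt0 ltr_wpDl ?sqr_ge0// exprn_gt0.
rewrite !(normal_pdf_affine _ _ s0) (normal_pdf_affine _ _ r0).
rewrite -r2 (normal_pdf_affine _ w (divr_gt0 s0 r0)) subr0 !std_pdfE.
rewrite [LHS](_ : _ = normal_peak 1 ^+ 2 / s * expR (- (w ^+ 2 / 2) - (((v - a * w) / s) ^+ 2 / 2))).
  rewrite [RHS](_ : _ = normal_peak 1 ^+ 2 / s * expR (- ((v / r) ^+ 2 / 2) -
    (((w - a * v / r ^+ 2) / (s / r)) ^+ 2 / 2))).
    congr (_ * expR _).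
    apply/eqP; rewrite -subr_eq0; apply/eqP.
    (* Isolating the factor that vanishes lets [field] treat [r] as a free variable. *)
    transitivity ((r ^+ 2 - (a ^+ 2 + s ^+ 2)) * (w ^+ 2 * r ^+ 2 - v ^+ 2) / (2 * s ^+ 2 * r ^+ 2)).
      by field; rewrite !gt_eqF.
    by rewrite r2 subrr !mul0r.
  by rewrite expRD; field; rewrite !gt_eqF.
by rewrite expRD; field; rewrite gt_eqF.
Qed.

Let T := measurableTypeR R.

Let measurable_pdf2 a s : s != 0 -> measurable_fun setT
  (fun z : T * T => normal_pdf (a * z.1) s z.2).
Proof.
move=> s0.
have -> : (fun z : T * T => normal_pdf (a * z.1) s z.2) =
    (fun z => normal_peak s * expR (- (z.2 - a * z.1) ^+ 2 / (s ^+ 2 *+ 2))).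
  by apply/funext => z; rewrite normal_pdfE.
apply: measurable_funM => //; apply: measurableT_comp => //.
apply: measurable_funM => //; apply: measurableT_comp => //.
apply: measurable_funX; apply: measurable_funB => //.
exact: measurable_funM.
Qed.

Lemma normal_prob_convolution a s A : 0 < s -> measurable A ->
  (\int[normal_prob 0 1]_w normal_prob (a * w) s A =
   normal_prob 0 (Num.sqrt (a ^+ 2 + s ^+ 2)) A)%E.
Proof.
move=> s0 mA; set r := Num.sqrt _.
have mA' : (measurable : set (set T)) A by [].
pose g (z : T * T) : \bar R := (normal_pdf (a * z.1) s z.2 * \1_A z.2)%:E.
have mg : measurable_fun setT g.
  apply/measurable_EFinP; apply: measurable_funM.
    by apply: measurable_pdf2; rewrite gt_eqF.
  exact: (measurableT_comp (measurable_indic mA') measurable_snd).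
have g0 z : (0 <= g z)%E by rewrite lee_fin mulr_ge0// normal_pdf_ge0.
have gE w : normal_prob (a * w) s A = (\int[mu]_v g (w, v))%E.
  rewrite /normal_prob integral_mkcond; apply: eq_integral => v _.
  rewrite patchE /g /= indicE; case: ifPn => _; first by rewrite mulr1.
  by rewrite mulr0.
have mG : measurable_fun setT (fun w : T => normal_prob (a * w) s A).
  under eq_fun do rewrite gE.
  have := @measurable_fun_fubini_tonelli_F _ _ T T R mu g mg g0.
  by rewrite /fubini_F.
rewrite integral_normal_prob; last first.
  apply/integrableP; split => //.
  apply: (@le_lt_trans _ _ (\int[normal_prob 0 1]_x cst 1%E x)%E).
    apply: ge0_le_integral => //.
      exact: measurableT_comp.
    by move=> x _; rewrite gee0_abs// probability_le1.
  rewrite integral_cst// mul1e.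
  exact: le_lt_trans (probability_le1 (normal_prob 0 1) measurableT) (ltry _).
transitivity (\int[mu]_w \int[mu]_v ((phi w)%:E * g (w, v)))%E.
  apply: eq_integral => w _; rewrite gE muleC ge0_integralZl//.
    exact: measurableT_comp.
  by rewrite lee_fin ltW// phi_gt0.
pose f (z : T * T) := ((phi z.1)%:E * g z)%E.
have mf : measurable_fun setT f.
  apply: emeasurable_funM => //; apply/measurable_EFinP.
  exact: (measurableT_comp (measurable_normal_pdf 0 1) measurable_fst).
have f0 z : (0 <= f z)%E by rewrite mule_ge0// lee_fin ltW// phi_gt0.
transitivity (\int[mu]_v \int[mu]_w f (w, v))%E.
  exact: (@fubini_tonelli _ _ T T R mu mu f mf f0).
rewrite [in RHS]/normal_prob [RHS]integral_mkcond; apply: eq_integral => v _.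
have r2 : r ^+ 2 = a ^+ 2 + s ^+ 2 by rewrite sqr_sqrtr// addr_ge0// sqr_ge0.
pose c := a * v / (a ^+ 2 + s ^+ 2).
transitivity (\int[mu]_w ((normal_pdf 0 r v * \1_A v)%:E * (normal_pdf c (s / r) w)%:E))%E.
  apply: eq_integral => w _; rewrite /f /g /= -!EFinM; congr EFin.
  by rewrite mulrA normal_pdf_gaussian_mul// -/r -/c; ring.
rewrite ge0_integralZl//.
- rewrite integral_normal_pdf mule1 patchE indicE.
  by case: ifPn => _; rewrite ?mulr1 ?mulr0.
- by apply/measurable_EFinP; exact: measurable_normal_pdf.
- by move=> w _; rewrite lee_fin normal_pdf_ge0.
- by rewrite lee_fin mulr_ge0// normal_pdf_ge0.
Qed.

Lemma N01_linear_combination a c A : measurable A ->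
  (N01 \x N01)%E [set z | A (a * z.1 + c * z.2)] =
  normal_law 0 (Num.sqrt (a ^+ 2 + c ^+ 2)) A.
Proof.
move=> mA.
have mz : measurable [set z : R * R | A (a * z.1 + c * z.2)].
  apply: (@measurable_preimage _ _ _ _ (fun z : R * R => a * z.1 + c * z.2)) => //.
  by apply: measurable_funD; apply: measurable_funM.
have E w : xsection [set z : R * R | A (a * z.1 + c * z.2)] w =
   (fun z => a * w + c * z) @^-1` A.
  by apply/seteqP; split => z; rewrite /xsection /= inE.
rewrite /product_measure1 /=.
(* For [c = 0] the law given the first variable is a Dirac mass, which [normal_prob] does not
   represent. *)
have [->|c0] := eqVneq c 0.
  rewrite expr0n/= addr0 sqrtr_sqr -N01_scale//.
  have mS : measurable ((fun z => a * z) @^-1` A).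
    by apply: measurable_preimage => //; exact: measurable_funM.
  rewrite -[RHS]mule1 -[in RHS](setIT (_ @^-1` _)) -integral_indic// -[RHS]muleC mul1e.
  apply: eq_integral => w _.
  rewrite indicE; case: (boolP (w \in _)) => wA.
    rewrite (_ : xsection _ _ = setT); first exact: probability_setT.
    apply/seteqP; split => z // _; rewrite /xsection /= inE /= mul0r addr0.
    exact: (set_mem wA).
  rewrite (_ : xsection _ _ = set0); first exact: measure0.
  apply/seteqP; split => z //; rewrite /xsection /= inE /= mul0r addr0.
  by move=> Aw; move: wA; rewrite notin_setE => /(_ Aw).
have c1 : 0 < `|c| by rewrite normr_gt0.
rewrite /normal_law gt_eqF; last first.
  by rewrite sqrtr_gt0 ltr_wpDl ?sqr_ge0// exprn_even_gt0.
rewrite -(real_normK (num_real c)) -(normal_prob_convolution a c1 mA).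
transitivity (\int[normal_prob 0 1]_w N01 (xsection [set z : R * R | A (a * z.1 + c * z.2)%R] w))%E.
  rewrite /probR ge0_integral_distribution//.
  exact: (measurable_fun_xsection N01 mz).
apply: eq_integral => w _; rewrite E -N01_affine_gt0//.
have [c2|c2] := leP 0 c; first by rewrite ger0_norm.
rewrite -N01_opp.
  by congr (N01 _); apply/seteqP; split=> z /=; rewrite (ltr0_norm c2) mulrN mulNr.
apply: measurable_preimage => //.
by apply: measurable_funD => //; exact: measurable_funM.
Qed.

Lemma Phi_cvg_y : Phi x @[x --> +oo] --> (1:R).
Proof. exact: (cvg_Nyc_y N01). Qed.

Lemma is_derive_phi x : is_derive x 1 phi (- x * phi x).
Proof.
rewrite (_ : phi = fun x => normal_peak 1 * expR (- (x ^+ 2 / 2))); last first.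
  by apply/funext => y; exact: std_pdfE.
apply: is_derive_eq; rewrite /GRing.scale/=.
by field.
Qed.

Lemma cvg_mul_phi_y : x * phi x @[x --> +oo] --> (0:R).
Proof.
apply/cvgrPdist_le => e e0; near=> x.
have x0 : 0 < x by [].
have xe : 2 / e <= x by [].
rewrite sub0r normrN ger0_norm ?mulr_ge0 ?(ltW x0) ?(ltW (phi_gt0 _))//.
have p0 := normal_peak_ge0 (1:R); have p1 := normal_peak1_le1.
rewrite std_pdfE expRN.
apply: (@le_trans _ _ (x / expR (x ^+ 2 / 2))).
  by rewrite mulrCA ler_piMl// mulr_ge0 ?invr_ge0 ?expR_ge0 ?ltW.
rewrite ler_pdivrMr ?expR_gt0//.
apply: le_trans (ler_wpM2l (ltW e0) (expR_ge1Dx _)).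
have : 2 <= e * x by rewrite mulrC -ler_pdivrMr.
nra.
Unshelve. all: by end_near. Qed.

(** An antiderivative of $x^2\varphi(x)$ is $\Phi(x) - x\varphi(x)$. Evenness reduces the line to a
    half-line; the same computation for $\varphi$ itself gives $\Phi(0) = 1/2$. *)
Lemma integral_sqr_phi : (\int[mu]_x (x ^+ 2 * phi x)%:E = 1)%E.
Proof.
have sym (f : R -> R) (l : R) (F : R -> R) : (forall x, 0 <= f x) -> continuous f ->
   f =1 f \o -%R -> F x @[x --> +oo] --> l -> (forall x, is_derive x 1 F (f x)) ->
   (\int[mu]_x (f x)%:E = (2 * (l - F 0))%:E)%E.
  move=> f0 cf fN Fl dF.
  rewrite ge0_symfun_integralT// (_ : [set x | _] = `[0, +oo[%classic); last first.
    by apply/seteqP; split => x /=; rewrite in_itv/= andbT.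
  rewrite (@ge0_continuous_FTC2y _ f F 0 l)// ?EFinM//.
  - by apply: continuous_subspaceT.
  - apply: cvg_at_right_filter; apply: differentiable_continuous.
    by apply/derivable1_diffP; have [] := dF 0.
  - by move=> x _; rewrite derive1E; have [] := dF x.
have Phi0 : Phi 0 = 2^-1.
  have := sym phi 1 Phi (fun x => ltW (phi_gt0 x)) continuous_phi
    (fun x => esym (phiN x)) Phi_cvg_y is_derive_Phi.
  by rewrite integral_normal_pdf => -[]; lra.
transitivity (2 * (1 - (Phi 0 - 0 * phi 0)))%:E; last first.
  by rewrite Phi0 mul0r subr0; congr EFin; lra.
apply: (sym _ 1 (fun x => Phi x - x * phi x)).
- by move=> x; rewrite mulr_ge0 ?sqr_ge0// ltW// phi_gt0.
- by move=> x; apply: cvgM; [exact: exprn_continuous|exact: continuous_phi].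
- by move=> x /=; rewrite sqrrN phiN.
- rewrite -[X in _ --> X]subr0; apply: cvgB; [exact: Phi_cvg_y|exact: cvg_mul_phi_y].
- move=> x; have h1 := is_derive_Phi x; have h2 := is_derive_phi x.
  by apply: is_derive_eq; rewrite /GRing.scale/=; ring.
Qed.

(** [integral_normal_prob] presupposes integrability, which for the square is what has to be shown.
    It is applied to the truncations at [n], and monotone convergence is used on both sides. *)
Lemma integral_sqr_N01 : (\int[N01]_x (x ^+ 2)%:E = 1)%E.
Proof.
pose f n x := (Num.min (x ^+ 2) n%:R).
have bf n : bmeas (f n).
  split.
    apply: measurable_minr => //; exact: measurable_funX.
  by exists n%:R => x; rewrite ger0_norm ?ge_min ?lexx ?orbT// le_min sqr_ge0/=.
have ndf x : nondecreasing_seq (f ^~ x).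
  by move=> m n mn; rewrite /f le_min !ge_min lexx/= ler_nat mn orbT.
have fcvg x : f n x @[n --> \oo] --> x ^+ 2.
  apply: cvg_near_cst; near=> n; rewrite /f min_l//.
  by near: n; exact: nbhs_infty_ger.
have L1 : (\int[N01]_x (f n x)%:E @[n --> \oo] --> \int[N01]_x (x ^+ 2)%:E)%E.
  have -> : (\int[N01]_x (x ^+ 2)%:E = \int[N01]_x (lim ((f n x)%:E @[n --> \oo])))%E.
    apply: eq_integral => x _; apply/esym/cvg_lim => //.
    by apply: cvg_EFin; [exact: nearW|exact: fcvg].
  apply: cvg_monotone_convergence => //.
  - by move=> n; apply/measurable_EFinP; case: (bf n).
  - by move=> n x _; rewrite lee_fin le_min sqr_ge0/=.
  - by move=> x _ m n mn; rewrite lee_fin; exact: ndf.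
have L2 : (\int[N01]_x (f n x)%:E @[n --> \oo] --> \int[mu]_x (x ^+ 2 * phi x)%:E)%E.
  have E n : (\int[N01]_x (f n x)%:E = \int[mu]_x (f n x * phi x)%:E)%E.
    rewrite /probR integral_distribution//.
    - by rewrite integral_normal_prob//; exact: (bmeas_integrable (normal_prob 0 1) (bf n)).
    - by apply/measurable_EFinP; case: (bf n).
    - exact: (bmeas_integrable (normal_prob 0 1) (bf n)).
  under eq_fun do rewrite E.
  have -> : (\int[mu]_x (x ^+ 2 * phi x)%:E = \int[mu]_x (lim ((f n x * phi x)%:E @[n --> \oo])))%E.
    apply: eq_integral => x _; apply/esym/cvg_lim => //.
    by apply: cvg_EFin; [exact: nearW|apply: cvgMl; exact: fcvg].
  apply: cvg_monotone_convergence => //.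
  - move=> n; apply/measurable_EFinP; apply: measurable_funM; first by case: (bf n).
    exact: measurable_normal_pdf.
  - by move=> n x _; rewrite lee_fin mulr_ge0 ?(ltW (phi_gt0 _))// le_min sqr_ge0/=.
  - by move=> x _ m n mn; rewrite lee_fin ler_wpM2r ?(ltW (phi_gt0 _))//; exact: ndf.
rewrite -integral_sqr_phi; exact: cvg_unique L1 L2.
Unshelve. all: by end_near. Qed.

End normal.

(** * Bivariate Gaussian vectors *)

(** This recovers an unbounded linear form as a pointwise limit of bounded sines, the only functions
    of it that are accessible in the uniqueness argument below. *)
Lemma sin_scale_cvg {R : realType} (x : R) :
  sin (n.+1%:R^-1 * x) / n.+1%:R^-1 @[n --> \oo] --> x.
Proof.
have d : is_derive (0:R) 1 (fun t => sin (t * x)) x.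
  by apply: is_derive_eq; rewrite /GRing.scale/= mul0r cos0; ring.
have [dd dE] := d.
have dc : (h^-1 *: (sin ((h *: 1 + 0) * x) - sin (0 * x)) : R) @[h --> (0:R)^'] --> x.
  by rewrite -[X in _ --> X]dE; exact: dd.
have h0 : (n.+1%:R^-1 : R) @[n --> \oo] --> (0:R)^'.
  move=> A [r /= r0 rA]; have := @cvg_harmonic R.
  move=> /cvgrPdist_lt/(_ _ r0)[N _ NA]; exists N => // n /= Nn.
  apply: rA; first exact: NA.
  by rewrite invr_neq0// pnatr_eq0.
have := cvg_comp _ _ h0 dc.
rewrite /comp; under eq_fun do rewrite mul0r sin0 subr0 addr0 /GRing.scale/= mulr1 mulrC.
by [].
Qed.

(** * Cramér-Wold uniqueness on quadrants *)

Section cramer_wold.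
Context {R : realType}.
Variables mu nu : probability (R * R)%type R.
Hypothesis linear_law : forall (a c : R) (A : set R), measurable A ->
  mu [set z | A (a * z.1 + c * z.2)] = nu [set z | A (a * z.1 + c * z.2)].
Implicit Types f g : R * R -> R.
Implicit Types a c : R.

Let lin a c (z : R * R) : R := a * z.1 + c * z.2.

Let measurable_lin a c : measurable_fun setT (lin a c).
Proof. by apply: measurable_funD; apply: measurable_funM. Qed.

Let bmeas_cos a c : bmeas (fun z => cos (lin a c z)).
Proof.
split; last by exists 1 => z; rewrite ler_norml cos_geN1 cos_le1.
exact: measurableT_comp (continuous_measurable_fun (@continuous_cos R)) _.
Qed.

Let bmeas_sin a c : bmeas (fun z => sin (lin a c z)).
Proof.
split; last by exists 1 => z; rewrite ler_norml sin_geN1 sin_le1.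
exact: measurableT_comp (continuous_measurable_fun (@continuous_sin R)) _.
Qed.

(* Multiplication by [sin (lin a c z)] only shifts the frequencies, so the
   functions with this property are stable under it. *)
Let agree f := [/\ bmeas f,
  forall a c, \int[mu]_z (f z * cos (lin a c z)) = \int[nu]_z (f z * cos (lin a c z)) &
  forall a c, \int[mu]_z (f z * sin (lin a c z)) = \int[nu]_z (f z * sin (lin a c z))].

Let agree1 : agree (fun=> 1).
Proof.
split=> [|a c|a c]; first exact: bmeas_cst.
- under eq_Rintegral do rewrite mul1r; under [RHS]eq_Rintegral do rewrite mul1r.
  apply: (same_law_Rintegral (f := cos)) => //; first exact: linear_law.
  split; first exact: continuous_measurable_fun (@continuous_cos R).
  by exists 1 => z; rewrite ler_norml cos_geN1 cos_le1.
- under eq_Rintegral do rewrite mul1r; under [RHS]eq_Rintegral do rewrite mul1r.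
  apply: (same_law_Rintegral (f := sin)) => //; first exact: linear_law.
  split; first exact: continuous_measurable_fun (@continuous_sin R).
  by exists 1 => z; rewrite ler_norml sin_geN1 sin_le1.
Qed.

Let agreeD f g : agree f -> agree g -> agree (fun z => f z + g z).
Proof.
move=> [bf fc fs] [bg gc gs]; split=> [|a c|a c]; first exact: bmeasD.
- under eq_Rintegral do rewrite mulrDl; under [RHS]eq_Rintegral do rewrite mulrDl.
  by rewrite !bmeas_RintegralD ?fc ?gc//; exact: bmeasM.
- under eq_Rintegral do rewrite mulrDl; under [RHS]eq_Rintegral do rewrite mulrDl.
  by rewrite !bmeas_RintegralD ?fs ?gs//; exact: bmeasM.
Qed.

Let agreeZ (r : R) f : agree f -> agree (fun z => r * f z).
Proof.
move=> [bf fc fs]; split=> [|a c|a c]; first exact: bmeasZ.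
- under eq_Rintegral do rewrite -mulrA; under [RHS]eq_Rintegral do rewrite -mulrA.
  by rewrite !bmeas_RintegralZ ?fc//; exact: bmeasM.
- under eq_Rintegral do rewrite -mulrA; under [RHS]eq_Rintegral do rewrite -mulrA.
  by rewrite !bmeas_RintegralZ ?fs//; exact: bmeasM.
Qed.

Let agree_sin f a0 c0 : agree f -> agree (fun z => f z * sin (lin a0 c0 z)).
Proof.
move=> [bf fc fs]; split=> [|a c|a c]; first exact: bmeasM.
- have E z : f z * sin (lin a0 c0 z) * cos (lin a c z) =
     2^-1 * (f z * sin (lin (a + a0) (c + c0) z)) -
     2^-1 * (f z * sin (lin (a - a0) (c - c0) z)).
    rewrite (_ : lin (a + a0) (c + c0) z = lin a c z + lin a0 c0 z); last by rewrite /lin; ring.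
    rewrite (_ : lin (a - a0) (c - c0) z = lin a c z - lin a0 c0 z); last by rewrite /lin; ring.
    by rewrite sinB sinD; field.
  under eq_Rintegral do rewrite E; under [RHS]eq_Rintegral do rewrite E.
  rewrite !bmeas_RintegralB ?bmeas_RintegralZ ?fs//;
    by repeat (apply: bmeasZ || apply: bmeasM).
- have E z : f z * sin (lin a0 c0 z) * sin (lin a c z) =
     2^-1 * (f z * cos (lin (a - a0) (c - c0) z)) -
     2^-1 * (f z * cos (lin (a + a0) (c + c0) z)).
    rewrite (_ : lin (a + a0) (c + c0) z = lin a c z + lin a0 c0 z); last by rewrite /lin; ring.
    rewrite (_ : lin (a - a0) (c - c0) z = lin a c z - lin a0 c0 z); last by rewrite /lin; ring.
    by rewrite cosB cosD; field.
  under eq_Rintegral do rewrite E; under [RHS]eq_Rintegral do rewrite E.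
  rewrite !bmeas_RintegralB ?bmeas_RintegralZ ?fc//;
    by repeat (apply: bmeasZ || apply: bmeasM).
Qed.

Let agree_horner f (p : {poly R}) a0 c0 : agree f ->
  agree (fun z => f z * p.[(1 + sin (lin a0 c0 z)) / 2]).
Proof.
elim/poly_ind: p f => [|p r ih] f af.
  rewrite (_ : (fun z => _) = fun z => 0 * f z); first exact: agreeZ.
  by apply/funext => z; rewrite horner0 mulr0 mul0r.
rewrite (_ : (fun z => _) = fun z => ((2^-1 * f z + 2^-1 * (f z * sin (lin a0 c0 z))) *
  p.[(1 + sin (lin a0 c0 z)) / 2]) + r * f z).
  apply: agreeD; last exact: agreeZ.
  by apply: ih; apply: agreeD; apply: agreeZ => //; exact: agree_sin.
by apply/funext => z; rewrite hornerD hornerM hornerX hornerC; ring.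
Qed.

Let agree_lim (f_ : nat -> R * R -> R) f (M : R) :
  (forall n, agree (f_ n)) -> (forall n z, `|f_ n z| <= M) ->
  (forall z, f_ n z @[n --> \oo] --> f z) -> agree f.
Proof.
move=> af fM ff.
have key (m : probability (R * R)%type R) h : bmeas h -> (forall z, `|h z| <= 1) ->
    \int[m]_z (f_ n z * h z) @[n --> \oo] --> \int[m]_z (f z * h z).
  move=> bh h1; apply: (@bounded_cvg_Rintegral _ _ _ m _ _ M).
  - by move=> n; apply: measurable_funM; [case: (af n) => -[]|case: bh].
  - move=> n z; rewrite normrM (le_trans _ (fM n z))// ler_piMr//.
  - by move=> z; apply: cvgMl; exact: ff.
have mf : measurable_fun setT f.
  by apply: (measurable_fun_cvg _ (fun x _ => ff x)) => n; case: (af n) => -[].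
split=> [|a c|a c].
- split=> //; exists M => z.
  have fn : `|f_ n z| @[n --> \oo] --> `|f z| by apply: cvg_norm; exact: ff.
  rewrite -(cvg_lim _ fn)//; apply: limr_le.
    by apply/cvg_ex; exists `|f z|.
  exact: nearW.
- have k1 := key mu _ (bmeas_cos a c); have k2 := key nu _ (bmeas_cos a c).
  have h1 z : `|cos (lin a c z)| <= 1 by rewrite ler_norml cos_geN1 cos_le1.
  apply: (cvg_unique _ (k1 h1)) => //.
  have -> : (fun n => \int[mu]_z (f_ n z * cos (lin a c z))) =
      (fun n => \int[nu]_z (f_ n z * cos (lin a c z))).
    by apply/funext => n; case: (af n) => _ -> _.
  exact: k2.
- have k1 := key mu _ (bmeas_sin a c); have k2 := key nu _ (bmeas_sin a c).
  have h1 z : `|sin (lin a c z)| <= 1 by rewrite ler_norml sin_geN1 sin_le1.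
  apply: (cvg_unique _ (k1 h1)) => //.
  have -> : (fun n => \int[mu]_z (f_ n z * sin (lin a c z))) =
      (fun n => \int[nu]_z (f_ n z * sin (lin a c z))).
    by apply/funext => n; case: (af n) => _ _ ->.
  exact: k2.
Qed.

(** The substitution $v = (1 + \sin)/2$ takes values in [0, 1], where [G] composed with its inverse
    is a uniform limit of polynomials; these are covered by [agree_horner]. *)
Let agree_comp_sin f (G : R -> R) (M e : R) a0 c0 : e != 0 -> agree f ->
  continuous G -> (forall x, `|G x| <= M) ->
  agree (fun z => f z * G (sin (lin a0 c0 z) / e)).
Proof.
move=> e0 af cG GM; have [_ [K fK]] := (let: And3 b _ _ := af in b).
have cF : continuous (fun v : R => G ((2 * v - 1) / e)).
  move=> v; apply: continuous_comp; last exact: cG.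
  apply: cvgMl; apply: cvgB; last exact: cvg_cst.
  by apply: cvgMr; exact: cvg_id.
have /choice[p pF] : forall n, exists p : {poly R}, forall v, 0 <= v <= 1 ->
    `|G ((2 * v - 1) / e) - p.[v]| <= n.+1%:R^-1.
  by move=> n; apply: weierstrass01.
have s01 z : 0 <= (1 + sin (lin a0 c0 z)) / 2 <= 1.
  by have := sin_geN1 (lin a0 c0 z); have := sin_le1 (lin a0 c0 z); lra.
have pG n z : `|G (sin (lin a0 c0 z) / e) - (p n).[(1 + sin (lin a0 c0 z)) / 2]| <= n.+1%:R^-1.
  have := pF n _ (s01 z).
  by rewrite (_ : 2 * ((1 + sin (lin a0 c0 z)) / 2) - 1 = sin (lin a0 c0 z)); last by field.
apply: (@agree_lim (fun n z => f z * (p n).[(1 + sin (lin a0 c0 z)) / 2]) _ (K * (M + 1))).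
- by move=> n; exact: agree_horner.
- move=> n z; rewrite normrM ler_pM//.
  rewrite -[X in `|X|](subrK (G (sin (lin a0 c0 z) / e))) addrC.
  rewrite (le_trans (ler_normD _ _))// lerD// distrC (le_trans (pG n z))//.
  by rewrite invf_le1 ?ler1n// ltr0n.
- move=> z; apply: cvgMr; apply/cvgrPdist_le => r r0; near=> n.
  apply: (le_trans (pG n z)); rewrite invf_ple ?posrE ?ltr0n//.
  rewrite (@le_trans _ _ n%:R) ?ler_nat//; near: n; exact: nbhs_infty_ger.
Unshelve. all: by end_near. Qed.

Let agree_comp f (G : R -> R) (M : R) a0 c0 : agree f ->
  continuous G -> (forall x, `|G x| <= M) ->
  agree (fun z => f z * G (lin a0 c0 z)).
Proof.
move=> af cG GM; have [_ [K fK]] := (let: And3 b _ _ := af in b).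
apply: (@agree_lim (fun n z => f z *
  G (sin (lin (n.+1%:R^-1 * a0) (n.+1%:R^-1 * c0) z) / n.+1%:R^-1)) _ (K * M)).
- by move=> n; apply: (@agree_comp_sin _ _ M) => //; rewrite invr_neq0// pnatr_eq0.
- by move=> n z; rewrite normrM ler_pM.
- move=> z; apply: cvgMr; apply: continuous_cvg; first exact: cG.
  have := @sin_scale_cvg R (lin a0 c0 z).
  suff E (n : nat) : n.+1%:R^-1 * lin a0 c0 z = lin (n.+1%:R^-1 * a0) (n.+1%:R^-1 * c0) z.
    by under eq_fun do rewrite E.
  by rewrite /lin; ring.
Qed.

Let agree_indic f (x : R) a0 c0 : agree f ->
  agree (fun z => f z * \1_`]-oo, x] (lin a0 c0 z)).
Proof.
move=> af; have [_ [K fK]] := (let: And3 b _ _ := af in b).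
apply: (@agree_lim (fun n z => f z * ramp n%:R x (lin a0 c0 z)) _ K).
- move=> n; apply: (@agree_comp _ _ 1) => //; first exact: ramp_continuous.
  exact: norm_ramp_le1.
- move=> n z; rewrite normrM (le_trans _ (fK z))// ler_piMr//.
  exact: norm_ramp_le1.
- by move=> z; apply: cvgMr; exact: ramp_cvg.
Qed.

Theorem linear_law_quadrant (x y : R) :
  mu (`]-oo, x]%classic `*` `]-oo, y]%classic) =
  nu (`]-oo, x]%classic `*` `]-oo, y]%classic).
Proof.
(* Starting from the constant 1, one multiplies by the indicators of the two half-planes; the cosine
   of frequency 0 is then 1. *)
have [_ h _] := agree_indic y 0 1 (agree_indic x 1 0 agree1).
have := h 0 0.
set A := _ `*` _.
have mA : measurable A by apply: measurableX.
have E z : 1 * \1_`]-oo, x] (lin 1 0 z) * \1_`]-oo, y] (lin 0 1 z) * cos (lin 0 0 z) = \1_A z :> R.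
  rewrite /lin !mul0r !mul1r !add0r !addr0 cos0 mulr1 !indicE -natrM mulnb.
  by rewrite /A in_setX.
under eq_Rintegral do rewrite E; under [RHS]eq_Rintegral do rewrite E.
rewrite !Rintegral_prob_indic// => muA.
by rewrite -[LHS]fineK ?fin_num_measure// muA fineK ?fin_num_measure.
Qed.

End cramer_wold.

Section gaussian_moments.
Context d (T : measurableType d) (R : realType) (P : probability T R).
Local Notation N01 := (probR (normal_prob (0:R) 1)).
Implicit Types Y Z : T -> R.

Lemma same_law_integral_N01 (Y : T -> R) (m s : R) (f : R -> \bar R) :
  0 <= s -> measurable_fun setT Y -> has_law P Y (normal_law m s) ->
  measurable_fun setT f ->
  (\int[P]_x f (Y x) = \int[N01]_z f (m + s * z)%R)%E.
Proof.
move=> s0 mY Ylaw mf; rewrite [LHS]integralE [RHS]integralE.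
have mz : measurable_fun setT (fun z : R => m + s * z).
  by apply: measurable_funD => //; exact: measurable_funM.
have law A : measurable A -> P (Y @^-1` A) = N01 ((fun z => m + s * z) @^-1` A).
  by move=> mA; rewrite Ylaw// N01_affine.
congr (_ - _)%E.
- have h := same_law_integral (f := (f^\+)%E) mY mz law (measurable_funepos mf)
    (fun y => funepos_ge0 f y).
  by apply: etrans (etrans h _); apply: eq_integral => x _; rewrite unlock.
- have h := same_law_integral (f := (f^\-)%E) mY mz law (measurable_funeneg mf)
    (fun y => funeneg_ge0 f y).
  by apply: etrans (etrans h _); apply: eq_integral => x _; rewrite unlock.
Qed.

Lemma Lfun2_sqr Y : measurable_fun setT Y ->
  (\int[P]_x (Y x ^+ 2)%:E < +oo)%E -> Y \in Lfun P 2%:E.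
Proof.
move=> mY iY; rewrite inE; apply/andP; split; rewrite inE//=.
rewrite /finite_norm unlock poweR_lty//; apply: le_lt_trans iY.
rewrite le_eqVlt; apply/orP; left; apply/eqP; apply: eq_integral => x _ /=.
by rewrite powR_mulrn// real_normK// num_real.
Qed.

Let Lfun1W Y : Y \in Lfun P 2%:E -> Y \in Lfun P 1.
Proof. by apply: Lfun_subset12; exact: fin_num_measure. Qed.

End gaussian_moments.

Section gaussian_laws.
Context {R : realType}.
Local Notation N01 := (probR (normal_prob (0:R) 1)).

Lemma Lfun2_N01 : (fun z : R => z) \in Lfun N01 2%:E.
Proof. by apply: Lfun2_sqr => //; rewrite integral_sqr_N01 ltry. Qed.

Let iN : N01.-integrable setT (fun z : R => z%:E).
Proof.
apply/(Lfun1_integrable N01 (fun z : R => z)).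
by apply: Lfun_subset12 Lfun2_N01; exact: fin_num_measure.
Qed.

Let iN2 : N01.-integrable setT (fun z : R => (z ^+ 2)%:E).
Proof. exact: Lfun2_integrable_sqr Lfun2_N01. Qed.

Lemma integral_N01_id : (\int[N01]_z z%:E = 0)%E.
Proof.
have h : has_law N01 (fun z : R => - z) (normal_law 0 1).
  by move=> A mA; rewrite /normal_law oner_eq0 N01_opp.
have h1 : has_law N01 (fun z : R => z) (normal_law 0 1).
  by move=> A mA; rewrite /normal_law oner_eq0.
have E : (\int[N01]_z (- z)%:E = \int[N01]_z z%:E)%E.
  have mE : measurable_fun setT (EFin : R -> \bar R) by [].
  have mopp : measurable_fun setT (fun z : R => - z) by exact: measurableT_comp.
  have mid : measurable_fun setT (fun z : R => z) by [].
  rewrite (same_law_integral_N01 ler01 mopp h mE).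
  by rewrite -(same_law_integral_N01 ler01 mid h1 mE).
have fin : (\int[N01]_z z%:E)%E \is a fin_num by exact: integrable_fin_num iN.
move: E; rewrite (_ : (fun z : R => (- z)%:E) = (fun z => - (z%:E)))%E; last by [].
rewrite integralN; last by apply: integrable_add_def.
by rewrite -(fineK fin) => -[] h'; congr EFin; lra.
Qed.

Lemma integral_N01_affine (m s : R) : (\int[N01]_z (m + s * z)%:E = m%:E)%E.
Proof.
under eq_integral do rewrite EFinD EFinM.
rewrite integralD//; last 2 first.
- by apply: (bmeas_integrable N01 (bmeas_cst _ m)).
- exact: integrableZl.
rewrite integralZl// integral_N01_id mule0 adde0 integral_cst//.
by rewrite -[RHS]mule1; congr (_ * _)%E; exact: probability_setT.
Qed.

Lemma integral_N01_affine_sqr (m s : R) :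
  (\int[N01]_z ((m + s * z) ^+ 2)%:E = (m ^+ 2 + s ^+ 2)%:E)%E.
Proof.
rewrite (_ : (fun z => _) = fun z : R => ((m ^+ 2 + (2 * m * s) * z)%:E + (s ^+ 2)%:E * (z ^+ 2)%:E)%E); last first.
  by apply/funext => z; rewrite -EFinM -EFinD; congr EFin; ring.
rewrite integralD//; last 2 first.
- rewrite (_ : (fun z => _) = fun z : R => ((m ^+ 2)%:E + (2 * m * s)%:E * z%:E)%E)//.
  apply: integrableD => //; last exact: integrableZl.
  by apply: (bmeas_integrable N01 (bmeas_cst _ (m ^+ 2))).
- exact: integrableZl.
by rewrite integral_N01_affine integralZl// integral_sqr_N01 mule1.
Qed.

Context d (T : measurableType d) (P : probability T R).
Implicit Types Y Z : T -> R.

Lemma normal_law_Lfun2 Y (m s : R) : 0 <= s -> measurable_fun setT Y ->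
  has_law P Y (normal_law m s) -> Y \in Lfun P 2%:E.
Proof.
move=> s0 mY hY; apply: Lfun2_sqr => //.
rewrite (same_law_integral_N01 (f := fun y => (y ^+ 2)%:E) s0 mY hY).
  by rewrite integral_N01_affine_sqr ltry.
by apply/measurable_EFinP; exact: measurable_funX.
Qed.

Lemma normal_law_expectation Y (m s : R) : 0 <= s -> measurable_fun setT Y ->
  has_law P Y (normal_law m s) -> ('E_P[Y] = m%:E)%E.
Proof.
move=> s0 mY hY; rewrite unlock.
by rewrite (same_law_integral_N01 (f := EFin) s0 mY hY)// integral_N01_affine.
Qed.

Lemma normal_law_variance Y (m s : R) : 0 <= s -> measurable_fun setT Y ->
  has_law P Y (normal_law m s) -> ('V_P[Y] = (s ^+ 2)%:E)%E.
Proof.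
move=> s0 mY hY.
rewrite varianceE; last exact: normal_law_Lfun2 s0 mY hY.
rewrite (normal_law_expectation s0 mY hY) unlock.
rewrite (same_law_integral_N01 (f := fun y => (y ^+ 2)%:E) s0 mY hY).
  by rewrite integral_N01_affine_sqr expe2 -EFinM -EFinB; congr EFin; ring.
by apply/measurable_EFinP; exact: measurable_funX.
Qed.

Lemma variance_linear Y Z (a c : R) : Y \in Lfun P 2%:E -> Z \in Lfun P 2%:E ->
  ('V_P[(fun t => a * Y t + c * Z t)%R] = (a ^+ 2)%:E * 'V_P[Y] + (c ^+ 2)%:E * 'V_P[Z] +
   (2 * a * c)%:E * covariance P Y Z)%E.
Proof.
move=> Y2 Z2.
have L1 V : V \in Lfun P 2%:E -> V \in Lfun P 1.
  by apply: Lfun_subset12; exact: fin_num_measure.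
have sc (k : R) V : V \in Lfun P 2%:E -> (k \o* V) \in Lfun P 2%:E.
  by apply: Lfun_scale; rewrite ler1n.
rewrite (_ : (fun t => _) = (a \o* Y) \+ (c \o* Z)); last first.
  by apply/funext => t /=; rewrite ![_ * a]mulrC ![_ * c]mulrC.
have YZ : Y * Z \in Lfun P 1 by exact: Lfun2_mul_Lfun1 Y2 Z2.
have YcZ : Y * (c \o* Z) \in Lfun P 1 by exact: Lfun2_mul_Lfun1 Y2 (sc c _ Z2).
rewrite (varianceD (sc a _ Y2) (sc c _ Z2)) (varianceZ a Y2) (varianceZ c Z2).
rewrite (covarianceZl a (L1 _ Y2) (L1 _ (sc c _ Z2)) YcZ).
by rewrite (covarianceZr c (L1 _ Y2) (L1 _ Z2) YZ) !muleA -!EFinM.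
Qed.

End gaussian_laws.

Section bivariate.
Context {R : realType}.
Local Notation N01 := (probR (normal_prob (0:R) 1)).

(** The conditioning variable is the second coordinate, placed as [z.1]: a section of the product
    measure at [z.1] then gives the conditional law of the first coordinate, an affine image of a
    standard normal. *)
Definition gauss_pair (rho : R) (z : R * R) : R * R :=
  (rho * z.1 + Num.sqrt (1 - rho ^+ 2) * z.2, z.1).

Lemma measurable_gauss_pair rho : measurable_fun setT (gauss_pair rho).
Proof.
apply/measurable_fun_pairP; split; last exact: measurable_fst.
by apply: measurable_funD; apply: measurable_funM.
Qed.

Let quad (rho a c : R) := a ^+ 2 + c ^+ 2 + 2 * a * c * rho.

Lemma gauss_pair_linear_law rho (a c : R) A : -1 <= rho <= 1 -> measurable A ->
  (N01 \x N01)%E [set z | A (a * (gauss_pair rho z).1 + c * (gauss_pair rho z).2)] =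
  normal_law 0 (Num.sqrt (quad rho a c)) A.
Proof.
move=> r1 mA.
have -> : quad rho a c = (a * rho + c) ^+ 2 + (a * Num.sqrt (1 - rho ^+ 2)) ^+ 2.
  by rewrite exprMn sqr_sqrtr ?/quad; [ring|nra].
rewrite -(N01_linear_combination _ _ mA); congr ((N01 \x N01)%E _).
apply/seteqP; split => z /=; rewrite /gauss_pair/=;
  by have -> : a * (rho * z.1 + Num.sqrt (1 - rho ^+ 2) * z.2) + c * z.1 =
    (a * rho + c) * z.1 + a * Num.sqrt (1 - rho ^+ 2) * z.2 by ring.
Qed.

Context d (T : measurableType d) (P : probability T R).

(** [gaussian_vector] only provides some [m] and [s]; they are identified as mean and standard
    deviation, which the marginals and the correlation determine. The bounds on [rho] say that the
    variances of the sum and of the difference are nonnegative. *)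
Lemma std_gaussian_linear_law rho (X : T -> R * R) : measurable_fun setT X ->
  std_gaussian_vector P rho X ->
  [/\ -1 <= rho <= 1 & forall a c,
    has_law P (fun t => a * (X t).1 + c * (X t).2) (normal_law 0 (Num.sqrt (quad rho a c)))].
Proof.
move=> mX [gX l1 l2 corr].
have m1 : measurable_fun setT (fun t => (X t).1) by exact: measurableT_comp.
have m2 : measurable_fun setT (fun t => (X t).2) by exact: measurableT_comp.
have L1 : has_law P (fun t => (X t).1) (normal_law 0 1).
  by move=> A mA; rewrite /normal_law oner_eq0 l1.
have L2 : has_law P (fun t => (X t).2) (normal_law 0 1).
  by move=> A mA; rewrite /normal_law oner_eq0 l2.
have X1 := normal_law_Lfun2 ler01 m1 L1; have X2 := normal_law_Lfun2 ler01 m2 L2.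
have i1 : (fun t => (X t).1) \in Lfun P 1 by apply: Lfun_subset12 X1; exact: fin_num_measure.
have i2 : (fun t => (X t).2) \in Lfun P 1 by apply: Lfun_subset12 X2; exact: fin_num_measure.
have V1 := normal_law_variance ler01 m1 L1; have V2 := normal_law_variance ler01 m2 L2.
have covE : covariance P (fun t => (X t).1) (fun t => (X t).2) = rho%:E.
  rewrite -corr /correlation V1 V2 /= !expr1n sqrtr1 mulr1 divr1 fineK//.
  apply: covariance_fin_num => //; exact: Lfun2_mul_Lfun1.
have VE a c : ('V_P[(fun t => a * (X t).1 + c * (X t).2)%R] = (quad rho a c)%:E)%E.
  rewrite variance_linear// V1 V2 covE -!EFinM -!EFinD /quad; congr EFin; ring.
have q0 a c : 0 <= quad rho a c by rewrite -lee_fin -VE variance_ge0.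
split; first by have := q0 1 1; have := q0 1 (-1); rewrite /quad; lra.
move=> a c; have [m [s [s0 law]]] := gX a c.
have mY : measurable_fun setT (fun t => a * (X t).1 + c * (X t).2).
  by apply: measurable_funD; apply: measurable_funM.
have := normal_law_variance s0 mY law; rewrite VE => -[qE].
have s1 : (a \o* (fun t => (X t).1)) \in Lfun P 1 by exact: (Lfun_scale a (lexx 1) i1).
have s2 : (c \o* (fun t => (X t).2)) \in Lfun P 1 by exact: (Lfun_scale c (lexx 1) i2).
have E0 : ('E_P[(fun t => a * (X t).1 + c * (X t).2)%R] = 0)%E.
  rewrite (_ : (fun t => _) = (a \o* (fun t => (X t).1)) \+ (c \o* (fun t => (X t).2))); last first.
    by apply/funext => t /=; rewrite ![_ * a]mulrC ![_ * c]mulrC.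
  rewrite (expectationD s1 s2) (expectationZl a i1) (expectationZl c i2).
  rewrite (normal_law_expectation ler01 m1 L1) (normal_law_expectation ler01 m2 L2).
  by rewrite !mule0 adde0.
have := normal_law_expectation s0 mY law; rewrite E0 => -[m0].
by move: law; rewrite -m0 qE sqrtr_sqr (ger0_norm s0).
Qed.

Lemma std_gaussian_quadrant rho (X : T -> R * R) (x y : R) : measurable_fun setT X ->
  std_gaussian_vector P rho X ->
  P (X @^-1` (`]-oo, x]%classic `*` `]-oo, y]%classic)) =
  (N01 \x N01)%E (gauss_pair rho @^-1` (`]-oo, x]%classic `*` `]-oo, y]%classic)).
Proof.
move=> mX gX; have [r1 law] := std_gaussian_linear_law mX gX.
pose X' : {mfun T >-> (R * R)%type} := mfun_Sub (mem_set mX).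
pose Y' : {mfun (R * R)%type >-> (R * R)%type} := mfun_Sub (mem_set (measurable_gauss_pair rho)).
apply: (@linear_law_quadrant R (distribution P X') (distribution (N01 \x N01)%E Y')).
move=> a c A mA.
by rewrite /distribution /pushforward/= [RHS]gauss_pair_linear_law// -(law a c A mA).
Qed.

Lemma gauss_pair_std_gaussian rho (Z : T -> R * R) : -1 <= rho <= 1 ->
  measurable_fun setT Z ->
  (forall A, measurable A -> P (Z @^-1` A) = (N01 \x N01)%E A) ->
  std_gaussian_vector P rho (gauss_pair rho \o Z).
Proof.
move=> r1 mZ lZ.
have law a c : has_law P (fun t => a * (gauss_pair rho (Z t)).1 + c * (gauss_pair rho (Z t)).2)
    (normal_law 0 (Num.sqrt (quad rho a c))).
  move=> A mA; rewrite -(gauss_pair_linear_law a c r1 mA) -lZ//.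
  apply: (measurable_preimage (f := fun z => a * (gauss_pair rho z).1 + c * (gauss_pair rho z).2)) => //.
  have mg := measurable_gauss_pair rho.
  by apply: measurable_funD; apply: measurable_funM => //; apply: measurableT_comp mg.
have q1 : quad rho 1 0 = 1 by rewrite /quad; ring.
have q2 : quad rho 0 1 = 1 by rewrite /quad; ring.
have l1 : has_law P (fun t => (gauss_pair rho (Z t)).1) (normal_law 0 1).
  have := law 1 0; rewrite q1 sqrtr1 (_ : (fun t => _) = fun t => (gauss_pair rho (Z t)).1)//.
  by apply/funext => t; rewrite mul1r mul0r addr0.
have l2 : has_law P (fun t => (gauss_pair rho (Z t)).2) (normal_law 0 1).
  have := law 0 1; rewrite q2 sqrtr1 (_ : (fun t => _) = fun t => (gauss_pair rho (Z t)).2)//.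
  by apply/funext => t; rewrite mul1r mul0r add0r.
have mG : measurable_fun setT (fun t => gauss_pair rho (Z t)).
  exact: measurableT_comp (measurable_gauss_pair rho) mZ.
have m1 : measurable_fun setT (fun t => (gauss_pair rho (Z t)).1) by exact: measurableT_comp.
have m2 : measurable_fun setT (fun t => (gauss_pair rho (Z t)).2) by exact: measurableT_comp.
split.
- by move=> a c; exists 0, (Num.sqrt (quad rho a c)); split; [exact: sqrtr_ge0|exact: law].
- by move=> A mA; have := l1 A mA; rewrite /normal_law oner_eq0.
- by move=> A mA; have := l2 A mA; rewrite /normal_law oner_eq0.
have V1 := normal_law_variance ler01 m1 l1; have V2 := normal_law_variance ler01 m2 l2.
have X1 := normal_law_Lfun2 ler01 m1 l1; have X2 := normal_law_Lfun2 ler01 m2 l2.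
have i1 : (fun t => (gauss_pair rho (Z t)).1) \in Lfun P 1.
  by apply: Lfun_subset12 X1; exact: fin_num_measure.
have i2 : (fun t => (gauss_pair rho (Z t)).2) \in Lfun P 1.
  by apply: Lfun_subset12 X2; exact: fin_num_measure.
rewrite /correlation V1 V2 /= !expr1n sqrtr1 mulr1 divr1.
(* Polarization: the covariance is read off the variance of the sum, which is already known to be
   [quad rho 1 1]. *)
have mY : measurable_fun setT (fun t => 1 * (gauss_pair rho (Z t)).1 + 1 * (gauss_pair rho (Z t)).2).
  by apply: measurable_funD; apply: measurable_funM.
have := normal_law_variance (sqrtr_ge0 _) mY (law 1 1).
rewrite variance_linear// V1 V2 sqr_sqrtr; last by rewrite /quad; lra.
have /fineK <- : covariance P (fun t => (gauss_pair rho (Z t)).1)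
    (fun t => (gauss_pair rho (Z t)).2) \is a fin_num.
  by apply: covariance_fin_num => //; exact: Lfun2_mul_Lfun1.
rewrite -!EFinM -!EFinD => -[]; rewrite /quad /=; lra.
Qed.

End bivariate.

(** * The extended half-line and the limit integrand *)

Section extended_halfline_topology.
Context {R : realType}.
Local Notation E := (ext_nneg R).
Implicit Types (l : E) (r u : R).

Let max0_ge0 r : 0 <= Num.max 0 r.
Proof. by rewrite le_max lexx. Qed.

Definition ext_real r : E := ext_nneg_of_real (max0_ge0 r).

Let oo_ge0 : (0 <= +oo :> \bar R)%E.
Proof. by []. Qed.

Definition ext_oo : E := exist _ (+oo%E : \bar R) oo_ge0.

Lemma ext_cases l : l = ext_oo \/ exists2 r, 0 <= r & l = ext_real r.
Proof.
case: l => -[r| |] l0.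
- right; exists r; first by rewrite lee_fin in l0.
  by apply: val_inj => /=; rewrite max_r// -lee_fin.
- by left; apply: val_inj.
- by [].
Qed.

Lemma val_ext_real r : 0 <= r -> val (ext_real r) = r%:E.
Proof. by move=> r0 /=; rewrite max_r. Qed.

Lemma expN_real r : 0 <= r -> expN (ext_real r) = expR (- r).
Proof. by move=> r0; rewrite /expN val_ext_real. Qed.

Lemma expN_oo : expN ext_oo = 0 :> R.
Proof. by []. Qed.

Lemma expN_ge0 l : 0 <= expN l.
Proof. by case: (ext_cases l) => [->|[r r0 ->]]; rewrite ?expN_oo// expN_real// expR_ge0. Qed.

Lemma expN_le1 l : expN l <= 1.
Proof.
case: (ext_cases l) => [->|[r r0 ->]]; rewrite ?expN_oo ?ler01// expN_real//.
by rewrite expR_le1 oppr_le0.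
Qed.

Lemma expN_inj : injective (@expN R).
Proof.
move=> l l'; case: (ext_cases l) => [->|[r r0 ->]]; case: (ext_cases l') => [->|[s s0 ->]];
  rewrite ?expN_oo ?expN_real//.
- by move=> /eqP; rewrite eq_sym gt_eqF// expR_gt0.
- by move=> /eqP; rewrite gt_eqF// expR_gt0.
- by move=> /expR_inj/oppr_inj ->.
Qed.

(** The inverse of [expN], made total by clamping: nonpositive reals go to infinity and reals above
    1 go to 0. Being defined on the whole line, it transports laws and continuous functions between
    the two spaces. *)
Definition einv u : E :=
  if u <= 0 then ext_oo else ext_real (- ln u).

Lemma expN_einv u : expN (einv u) = Num.max 0 (Num.min 1 u).
Proof.
rewrite /einv; case: (leP u 0) => u0; first by rewrite expN_oo min_r ?max_l// (le_trans u0).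
have [u1|u1] := leP 1 u.
  rewrite (_ : ext_real _ = ext_real 0); last first.
    by apply: val_inj => /=; rewrite !max_l// oppr_le0 ln_ge0.
  by rewrite expN_real// oppr0 expR0 max_r.
rewrite expN_real; last by rewrite oppr_ge0 ln_le0// ltW.
by rewrite opprK lnK// max_r// ltW.
Qed.

Lemma expNK : cancel (@expN R) einv.
Proof.
by move=> l; apply: expN_inj; rewrite expN_einv min_r ?expN_le1// max_r// expN_ge0.
Qed.

Lemma ext_ballE l (e : R) l' : ball l e l' = (`|expN l - expN l'| < e) :> Prop.
Proof. by []. Qed.

Lemma continuous_expN : continuous (@expN R : E -> R).
Proof.
move=> l; apply/(@cvgrPdist_lt _ _ _ (nbhs l) (nbhs_filter l)) => e e0.
by apply/nbhs_ballP; exists e => //= l'.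
Qed.

Lemma continuous_einv : continuous einv.
Proof.
move=> u; apply/cvg_ballP => e e0; near=> v; rewrite ext_ballE !expN_einv.
(* The clamp of [u] to [0, 1] is the ramp of slope 1 at [1 - u], so its Lipschitz bound is already
   available. *)
have := @ramp_lip R 1 0 0 (1 - u) (1 - v) ler01.
rewrite /ramp (_ : 1 + 1 * (0 - (1 - u)) = u); last by ring.
rewrite (_ : 1 + 1 * (0 - (1 - v)) = v); last by ring.
rewrite mul1r (_ : 0 - (1 - u) - (0 - (1 - v)) = u - v); last by ring.
move=> /le_lt_trans; apply; near: v.
by apply: cvgr_dist_lt => //; exact: cvg_id.
Unshelve. all: by end_near. Qed.

Lemma continuous_ext_real : continuous ext_real.
Proof.
rewrite (_ : ext_real = einv \o (fun r => expR (- Num.max 0 r))); last first.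
  apply/funext => r /=; apply: expN_inj; rewrite expN_einv.
  have e1 : expR (- Num.max 0 r) <= 1 by rewrite expR_le1 oppr_le0.
  rewrite (min_r e1) (max_r (expR_ge0 _)) -expN_real//; congr expN.
  by apply: val_inj => /=; rewrite [in RHS]max_r.
move=> r; apply: continuous_comp; last exact: continuous_einv.
apply: continuous_comp; last exact: continuous_expR.
apply: cvgN.
have : continuous (fun r => Num.max 0 r : R).
  by apply: (@lipschitz_continuous _ _ 1) => x y; rewrite mul1r;
    case: (leP 0 x) => ?; case: (leP 0 y) => ?; rewrite ?subrr ?normr0//;
    rewrite ler_norml; move: (ler_norm (x - y)) (ler_norm (y - x));
    rewrite (distrC y x) => ? ?; apply/andP; split; lra.
exact.
Qed.

Lemma ext_continuous (F : E -> R) :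
  (forall r, 0 < r -> {for r, continuous (F \o ext_real)}) ->
  F (ext_real r) @[r --> 0^'+] --> F (ext_real 0) ->
  F (ext_real r) @[r --> +oo] --> F ext_oo ->
  continuous F.
Proof.
move=> Fr F0 Foo l; apply/(@cvgrPdist_lt _ _ _ (nbhs l) (nbhs_filter l)) => e e0.
apply/nbhs_ballP.
case: (ext_cases l) => [->|[r r0 ->]].
  have /cvgrPdist_lt/(_ _ e0)[M [_ FM]] := Foo.
  (* The ball of this radius about infinity consists of the points beyond [Num.max 0 M]. *)
  exists (expR (- Num.max 0 M)) => /=; first exact: expR_gt0.
  move=> l' /=; rewrite ext_ballE expN_oo sub0r normrN ger0_norm ?expN_ge0//.
  case: (ext_cases l') => [->|[s s0 ->]]; first by rewrite subrr normr0.
  rewrite expN_real// ltr_expR ltrN2 gt_max => /andP[_ Ms].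
  exact: FM.
move: r0; rewrite le_eqVlt => /predU1P[<-|r0].
  have /cvgrPdist_lt/(_ _ e0)[/= t /= t0 Ft] := F0.
  exists (1 - expR (- t)) => /=; first by rewrite subr_gt0 expR_lt1 oppr_lt0.
  move=> l' /=; rewrite ext_ballE expN_real// oppr0 expR0.
  rewrite ger0_norm ?subr_ge0 ?expN_le1// ltrD2l ltrN2.
  case: (ext_cases l') => [->|[s s0 ->]]; first by rewrite expN_oo ltNge expR_ge0.
  rewrite expN_real// ltr_expR ltrN2 => st.
  move: s0; rewrite le_eqVlt => /predU1P[<-|s0]; first by rewrite subrr normr0.
  by apply: Ft => //=; rewrite sub0r normrN gtr0_norm.
have /cvgrPdist_lt/(_ _ e0)/nbhs_ballP[t /= t0 Ft] := Fr r r0.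
pose t' := Num.min (t / 2) (r / 2).
have t'0 : 0 < t' by rewrite lt_min !divr_gt0.
have t't : t' < t by rewrite /t' gt_min ltr_pdivrMr// mulr_natr mulr2n ltrDl t0.
have t'r : t' < r by rewrite /t' gt_min [r / 2 < r]ltr_pdivrMr// mulr_natr mulr2n ltrDl r0 orbT.
exists (Num.min (expR (- r) - expR (- (r + t'))) (expR (- (r - t')) - expR (- r))) => /=.
  by rewrite lt_min !subr_gt0 !ltr_expR !ltrN2 ltrDl gtrBl t'0.
move=> l' /=; rewrite ext_ballE (expN_real (ltW r0)) lt_min => /andP[h1 h2].
case: (ext_cases l') => [l'E|[s s0 l'E]]; move: h1 h2; rewrite l'E ?expN_oo.
  rewrite subr0 ger0_norm ?expR_ge0// => h1.
  by have := expR_gt0 (- (r + t')); lra.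
rewrite expN_real// => h1 h2.
have sr : s < r + t'.
  rewrite ltNge; apply/negP => rs; move: h1; rewrite ltNge => /negP; apply.
  apply: le_trans (ler_norm _); rewrite lerD2l lerN2 ler_expR lerN2//.
have rs : r - t' < s.
  rewrite ltNge; apply/negP => sr'; move: h2; rewrite ltNge => /negP; apply.
  rewrite distrC; apply: le_trans (ler_norm _); rewrite lerD2r ler_expR lerN2//.
apply: Ft => /=; rewrite /ball/= ltr_norml; apply/andP; split; lra.
Qed.

Lemma ext_continuous_measurable (F : E -> R) : continuous F -> measurable_fun setT F.
Proof.
move=> cF; apply: (measurability _ (RGenOInfty.measurableE R)) => _ [_ [x ->] <-].
rewrite setTI; apply: sub_sigma_algebra.
by apply: open_comp => //; exact: open_gt.
Qed.

Lemma measurable_einv : measurable_fun setT einv.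
Proof.
apply: (@measurability _ _ _ _ _ _ (@open E)) => // _ [A oA <-].
rewrite setTI; apply: open_measurable.
by apply: open_comp => // u _; exact: continuous_einv.
Qed.

Lemma bmeas_ext (F : E -> R) : @bounded_continuous R E F -> bmeas F.
Proof.
move=> [cF [M [_ FM]]]; split; first exact: ext_continuous_measurable.
by exists (M + 1) => l; apply: FM => //; rewrite ltrDl.
Qed.

Lemma measurable_expN : measurable_fun setT (@expN R).
Proof. exact: ext_continuous_measurable continuous_expN. Qed.

End extended_halfline_topology.

(** * The limit integrand: increments, integral formula, continuity *)

Section limit_integrand_theory.
Context {R : realType}.
Local Notation E := (ext_nneg R).
Local Notation mu := (@lebesgue_measure R).
Local Notation Phi := (@std_normal_cdf R).
Local Notation phi := (normal_pdf (0:R) 1).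
Local Notation h := (@limit_integrand R).
Implicit Types (l : E) (r s t x y z : R).

Let hreal r x y := Phi (r + (y - x) / (2 * r)) * expR (- x) +
                   Phi (r + (x - y) / (2 * r)) * expR (- y).

Lemma limit_integrand_real r x y : 0 < r ->
  h x y (ext_real r) = Phi (r + (y - x) / (2 * r)) * expR (- x) +
                       Phi (r + (x - y) / (2 * r)) * expR (- y).
Proof. by move=> r0; rewrite /limit_integrand/= max_r ?ltW// gt_eqF. Qed.

Lemma limit_integrand0 x y : h x y (ext_real 0) = expR (- Num.min x y).
Proof. by rewrite /limit_integrand/= max_r// eqxx. Qed.

Lemma limit_integrand_oo x y : h x y ext_oo = expR (- x) + expR (- y).
Proof. by []. Qed.

Lemma ext_cases3 l : [\/ l = ext_oo, l = ext_real 0 | exists2 r, 0 < r & l = ext_real r].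
Proof.
case: (ext_cases l) => [->|[r]]; first exact: Or31.
by rewrite le_eqVlt => /predU1P[<- ->|r0 ->]; [exact: Or32|apply: Or33; exists r].
Qed.

Lemma limit_integrandC x y l : h x y l = h y x l.
Proof.
case: (ext_cases3 l) => [->|->|[r r0 ->]].
- by rewrite !limit_integrand_oo addrC.
- by rewrite !limit_integrand0 minC.
- by rewrite !limit_integrand_real// addrC.
Qed.

(** Because of this identity the two density terms cancel when the integrand is differentiated in
    [x], and a single [Phi] term remains. *)
Lemma phi_exp_swap r x y : 0 < r ->
  phi (r + (y - x) / (2 * r)) * expR (- x) = phi (r + (x - y) / (2 * r)) * expR (- y).
Proof.
move=> r0; rewrite !std_pdfE -!mulrA -!expRD; congr (_ * expR _).
by field; rewrite gt_eqF.
Qed.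

Let is_derive_hreal r x y : 0 < r ->
  is_derive x 1 (fun x => hreal r x y) (- expR (- x) * Phi (r + (y - x) / (2 * r))).
Proof.
move=> r0.
have d1 : is_derive x 1 (fun x => Phi (r + (y - x) / (2 * r)))
    (- (phi (r + (y - x) / (2 * r)) / (2 * r))).
  have g : is_derive x 1 (fun x => r + (y - x) / (2 * r)) (- (2 * r)^-1).
    by apply: is_derive_eq; rewrite /GRing.scale/= ; ring.
  have := @is_derive1_comp _ Phi (fun x => r + (y - x) / (2 * r)) _ _ _ (is_derive_Phi _) g.
  by move=> H; apply: is_derive_eq; rewrite /GRing.scale/=; ring.
have d2 : is_derive x 1 (fun x => Phi (r + (x - y) / (2 * r)))
    (phi (r + (x - y) / (2 * r)) / (2 * r)).
  have g : is_derive x 1 (fun x => r + (x - y) / (2 * r)) (2 * r)^-1.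
    by apply: is_derive_eq; rewrite /GRing.scale/= ; ring.
  have := @is_derive1_comp _ Phi (fun x => r + (x - y) / (2 * r)) _ _ _ (is_derive_Phi _) g.
  by move=> H; apply: is_derive_eq; rewrite /GRing.scale/=; ring.
have d3 : is_derive x 1 (fun x => expR (- x)) (- expR (- x)).
  by apply: is_derive_eq; rewrite /GRing.scale/= ; ring.
rewrite /hreal; apply: is_derive_eq.
rewrite /GRing.scale/= mulr0 add0r.
have := phi_exp_swap x y r0.
set A := phi _; set B := phi _; set C := Phi _ => AB.
rewrite (_ : expR (- y) * (B / (2 * r)) = B * expR (- y) / (2 * r)); last by ring.
by rewrite -AB; ring.
Qed.

(* [- expR (- x) * limit_slope (y - x) l] is the derivative in [x] of
   [limit_integrand x y l]; see [limit_integrand_increment]. *)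
Definition limit_slope z l : R :=
  match \val l with
  | r%:E => if r == 0 then (0 <= z)%R%:R else Phi (r + z / (2 * r))
  | _ => 1
  end.
Local Notation d := limit_slope.

Lemma limit_slope_real z r : 0 < r -> d z (ext_real r) = Phi (r + z / (2 * r)).
Proof. by move=> r0; rewrite /limit_slope/= (max_r (ltW r0)) gt_eqF. Qed.

Lemma limit_slope0 z : d z (ext_real 0) = (0 <= z)%R%:R.
Proof. by rewrite /limit_slope/= max_r// eqxx. Qed.

Lemma limit_slope_oo z : d z ext_oo = 1.
Proof. by []. Qed.

Lemma limit_slope_ge0 z l : 0 <= d z l.
Proof.
case: (ext_cases3 l) => [->|->|[r r0 ->]].
- by rewrite limit_slope_oo.
- by rewrite limit_slope0.
- by rewrite limit_slope_real// Phi_ge0.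
Qed.

Lemma limit_slope_le1 z l : d z l <= 1.
Proof.
case: (ext_cases3 l) => [->|->|[r r0 ->]].
- by rewrite limit_slope_oo.
- by rewrite limit_slope0 lern1 leq_b1.
- by rewrite limit_slope_real// Phi_le1.
Qed.

Lemma limit_slope_homo l : {homo d^~ l : z z' / z <= z'}.
Proof.
move=> z z' zz'; case: (ext_cases3 l) => [->|->|[r r0 ->]].
- by rewrite !limit_slope_oo.
- rewrite !limit_slope0; case: (leP 0 z) => // z0.
  by rewrite (le_trans z0 zz').
- rewrite !limit_slope_real//; apply: Phi_homo.
  by rewrite lerD2l ler_wpM2r// invr_ge0 mulr_ge0// ltW.
Qed.

(** As a function of $e^{-x}$ the integrand is convex with slope [limit_slope (y - x)], so an
    increment lies between the slopes at the two ends. Inequalities of this form survive the kink at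
    0 and can be integrated against any measure. *)
Lemma limit_integrand_increment s t y l : s <= t ->
  (expR (- s) - expR (- t)) * d (y - t) l <= h s y l - h t y l <=
  (expR (- s) - expR (- t)) * d (y - s) l.
Proof.
move=> st; case: (ext_cases3 l) => [->|->|[r r0 ->]].
- rewrite !limit_integrand_oo !limit_slope_oo; apply/andP; split; lra.
- rewrite !limit_integrand0 !limit_slope0 !subr_ge0.
  have est : expR (- t) <= expR (- s) by rewrite ler_expR lerN2.
  have [ty|yt] := leP t y.
    have sy := le_trans st ty.
    by rewrite (min_l sy) sy !mulr1 lexx.
  have [sy|ys] := leP s y; last by rewrite subrr !mulr0 lexx.
  have : expR (- t) <= expR (- y) by rewrite ler_expR lerN2 ltW.
  have : expR (- y) <= expR (- s) by rewrite ler_expR lerN2.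
  by move=> ? ?; rewrite mulr0 mulr1; apply/andP; split; lra.
rewrite !limit_integrand_real// !limit_slope_real//.
rewrite -/(hreal r s y) -/(hreal r t y).
(* Subtracting [D * expR (- x)], with [D] the slope at one end, leaves a function whose derivative
   has constant sign on [[s, t]] by monotonicity of [Phi]. *)
have mvt D : exists2 c, c \in `[s, t]%R &
    hreal r t y - D * expR (- t) - (hreal r s y - D * expR (- s)) =
    expR (- c) * (D - Phi (r + (y - c) / (2 * r))) * (t - s).
  have dF (c : R) : is_derive c 1 (fun x => hreal r x y - D * expR (- x))
      (expR (- c) * (D - Phi (r + (y - c) / (2 * r)))).
    have d1 := is_derive_hreal c y r0.
    apply: is_derive_eq; rewrite /GRing.scale/=; ring.
  have cF : {within `[s, t], continuous (fun x => hreal r x y - D * expR (- x))}.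
    apply: continuous_subspaceT => c.
    by apply: differentiable_continuous; apply/derivable1_diffP; have [] := dF c.
  by have [c cst ->] := MVT_segment st (fun c _ => dF c) cF; exists c.
have i2r : 0 <= (2 * r)^-1 by rewrite invr_ge0 mulr_ge0// ltW.
apply/andP; split.
  have [c] := mvt (Phi (r + (y - t) / (2 * r))).
  rewrite in_itv/= => /andP[sc ct] H.
  have : Phi (r + (y - t) / (2 * r)) <= Phi (r + (y - c) / (2 * r)).
    by apply: Phi_homo; rewrite lerD2l ler_wpM2r// lerD2l lerN2.
  rewrite -subr_le0 => /(mulr_ge0_le0 (expR_ge0 (- c)))/mulr_le0_ge0 => /(_ (t - s)).
  by rewrite subr_ge0 => /(_ st); rewrite -H; lra.
have [c] := mvt (Phi (r + (y - s) / (2 * r))).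
rewrite in_itv/= => /andP[sc ct] H.
have : Phi (r + (y - c) / (2 * r)) <= Phi (r + (y - s) / (2 * r)).
  by apply: Phi_homo; rewrite lerD2l ler_wpM2r// lerD2l lerN2.
rewrite -subr_ge0 => /(mulr_ge0 (expR_ge0 (- c)))/mulr_ge0 => /(_ (t - s)).
by rewrite subr_ge0 => /(_ st); rewrite -H; lra.
Qed.

Let expN_cvg0 : expR (- s) @[s --> +oo] --> (0:R).
Proof.
have := @cvgr_expR R; exact.
Qed.

Let hreal_cvg_y r x : 0 < r -> hreal r x s @[s --> +oo] --> expR (- x).
Proof.
move=> r0; rewrite -[X in _ --> X]addr0; apply: cvgD.
  rewrite -[X in _ --> X]mul1r; apply: cvgMl.
  apply: (@cvg_comp _ _ _ (fun s => r + (s - x) / (2 * r)) Phi _ (pinfty_nbhs R)) Phi_cvg_y.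
  apply/cvgryPge => A; near=> s.
  rewrite -lerBlDl ler_pdivlMr ?mulr_gt0// lerBrDl.
  by near: s; apply: nbhs_pinfty_ge; rewrite num_real.
apply: (@squeeze_cvgr _ _ _ _ (fun=> 0) (fun s => expR (- s))) => //; last first.
- exact: cvg_cst.
- near=> s; rewrite mulr_ge0 ?Phi_ge0 ?expR_ge0//= ler_piMl ?expR_ge0// Phi_le1//.
Unshelve. all: by end_near. Qed.

(** The limiting form of the Gaussian tail: [expR (- s)] is the limiting density of the normalized
    second coordinate, and [limit_slope (x - s)] the limiting conditional probability that the first
    one stays below [x]. *)
Lemma limit_integrand_integral x y l :
  (\int[mu]_(s in `[y, +oo[) (expR (- s) * d (x - s) l)%:E =
   (h x y l - expR (- x))%:E)%E.
Proof.
have dexp s : is_derive s 1 (fun s => - expR (- s)) (expR (- s)).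
  by apply: is_derive_eq; rewrite /GRing.scale/=; ring.
have cexp : continuous (fun s : R => expR (- s)).
  move=> s; apply: continuous_comp; last exact: continuous_expR.
  exact: opp_continuous.
have int_exp z : (\int[mu]_(s in `[z, +oo[) (expR (- s))%:E = (expR (- z))%:E)%E.
  rewrite (@ge0_continuous_FTC2y _ _ (fun s => - expR (- s)) _ 0).
  - by rewrite -EFinB sub0r opprK.
  - by move=> s _; rewrite expR_ge0.
  - exact: continuous_subspaceT.
  - by rewrite -oppr0; apply: cvgN; exact: expN_cvg0.
  - by move=> s _; have [] := dexp s.
  - by apply: cvg_at_right_filter; apply: cvgN; exact: cexp.
  - by move=> s _; rewrite derive1E; have [] := dexp s.
case: (ext_cases3 l) => [->|->|[r r0 ->]].
- under eq_integral do rewrite limit_slope_oo mulr1.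
  by rewrite int_exp limit_integrand_oo addrAC subrr add0r.
- rewrite limit_integrand0.
  have [xy|yx] := ltP x y.
    rewrite subrr; apply: integral0_eq => s/=.
    rewrite in_itv/= andbT => ys; rewrite limit_slope0 subr_ge0 leNgt.
    by rewrite (lt_le_trans xy ys) mulr0.
  rewrite (_ : `[y, +oo[%classic = `[y, x]%classic `|` `]x, +oo[%classic :> set R); last first.
    by rewrite -itv_bndbnd_setU// bnd_simp.
  have mf : measurable_fun setT (fun s => (expR (- s) * d (x - s) (ext_real 0))%:E).
    apply/measurable_EFinP/measurable_funM; first exact: continuous_measurable_fun.
    rewrite (_ : (fun s => _) = \1_(`]-oo, x]%classic)); first exact: measurable_indic.
    apply/funext => s; rewrite limit_slope0 subr_ge0 indicE; congr (_%:R).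
    by rewrite mem_setE in_itv.
  have f0 s : (0 <= (expR (- s) * d (x - s) (ext_real 0))%:E)%E.
    by rewrite lee_fin mulr_ge0 ?expR_ge0 ?limit_slope_ge0.
  rewrite ge0_integral_setU//=; last first.
  - apply/disj_setPS => s/= [].
    by rewrite !in_itv/= andbT => /andP[_ sx] xs; rewrite ltNge sx in xs.
  - exact: measurable_funTS.
  rewrite [X in (_ + X)%E]integral0_eq ?adde0; last first.
    move=> s/=; rewrite in_itv/= andbT => xs; rewrite limit_slope0 subr_ge0.
    by rewrite leNgt xs mulr0.
  set A := (X in X = _).
  suff AE : (A + (expR (- x))%:E = (expR (- y))%:E)%E by rewrite -(@addeK _ (expR (- x))%:E A)// AE.
  rewrite -[in LHS]int_exp -[RHS]int_exp {}/A.
  rewrite (_ : `[y, +oo[%classic = `[y, x]%classic `|` `]x, +oo[%classic :> set R); last first.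
    by rewrite -itv_bndbnd_setU// bnd_simp.
  have mexp D : measurable_fun D (fun s => (expR (- s))%:E).
    by apply/measurable_EFinP/measurable_funTS; exact: continuous_measurable_fun.
  rewrite ge0_integral_setU//=; last 2 first.
  - exact: mexp.
  - apply/disj_setPS => s/= [].
    by rewrite !in_itv/= andbT => /andP[_ sx] xs; rewrite ltNge sx in xs.
  congr (_ + _)%E; last by rewrite integral_itv_obnd_cbnd//; exact: mexp.
  apply: eq_integral => s; rewrite inE/= in_itv/= => /andP[_ sx].
  by rewrite limit_slope0 subr_ge0 sx mulr1.
under eq_integral do rewrite limit_slope_real//.
rewrite limit_integrand_real// -/(hreal r x y).
have dF s : is_derive s 1 (fun s => - hreal r x s) (expR (- s) * Phi (r + (x - s) / (2 * r))).
  rewrite (_ : (fun s => _) = (fun s => - hreal r s x)); last first.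
    by apply/funext => s'; rewrite /hreal addrC.
  have H := is_derive_hreal s x r0.
  apply: is_derive_eq; rewrite /GRing.scale/=; ring.
rewrite (@ge0_continuous_FTC2y _ _ (fun s => - hreal r x s) _ (- expR (- x))).
- by rewrite -EFinB; congr EFin; ring.
- by move=> s _; rewrite mulr_ge0 ?expR_ge0 ?Phi_ge0.
- apply: continuous_subspaceT => s; apply: cvgM; first exact: cexp.
  apply: (@continuous_comp _ _ _ (fun s => r + (x - s) / (2 * r))); last exact: continuous_Phi.
  apply: cvgD; first exact: cvg_cst.
  by apply: cvgMl; apply: cvgB; [exact: cvg_cst|exact: cvg_id].
- by apply: cvgN; exact: hreal_cvg_y.
- by move=> s _; have [] := dF s.
- apply: cvg_at_right_filter.
  suff : {for y, continuous (fun s => - hreal r x s)} by [].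
  by apply: differentiable_continuous; apply/derivable1_diffP; have [] := dF y.
- by move=> s _; rewrite derive1E; have [] := dF s.
Qed.

Lemma limit_integrand_ge x y l : expR (- x) <= h x y l.
Proof.
rewrite -subr_ge0 -lee_fin -limit_integrand_integral; apply: integral_ge0 => s _.
by rewrite lee_fin mulr_ge0 ?expR_ge0 ?limit_slope_ge0.
Qed.

Lemma limit_integrand_ge0 x y l : 0 <= h x y l.
Proof. exact: le_trans (expR_ge0 _) (limit_integrand_ge x y l). Qed.

Lemma limit_integrand_le x y l : h x y l <= expR (- x) + expR (- y).
Proof.
case: (ext_cases3 l) => [->|->|[r r0 ->]].
- by rewrite limit_integrand_oo.
- by rewrite limit_integrand0; case: (leP x y) => _; rewrite ?lerDl ?lerDr expR_ge0.
- by rewrite limit_integrand_real// lerD// ler_piMl ?expR_ge0 ?Phi_le1.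
Qed.

Lemma limit_integrand_lip s t y l :
  `|h s y l - h t y l| <= `|expR (- s) - expR (- t)|.
Proof.
wlog st : s t / s <= t => [H|].
  case: (leP s t) => [|/ltW] st; first exact: H.
  by rewrite distrC [leRHS]distrC; exact: H.
have /andP[h1 h2] := limit_integrand_increment y l st.
have e : 0 <= expR (- s) - expR (- t) by rewrite subr_ge0 ler_expR lerN2.
rewrite !ger0_norm//.
  by rewrite (le_trans h2)// ler_piMr// limit_slope_le1.
by rewrite (le_trans _ h1)// mulr_ge0// limit_slope_ge0.
Qed.

Lemma Phi_cvg_Ny : Phi x @[x --> -oo] --> (0:R).
Proof. exact: (cvg_Nyc_Ny (probR (normal_prob (0:R) 1))). Qed.

Lemma PhiN x : Phi (- x) = 1 - Phi x.
Proof.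
pose F x := Phi x + Phi (- x).
have dF t : is_derive t 1 F 0.
  have dN : is_derive t 1 (fun t => Phi (- t)) (- phi (- t)).
    have g : is_derive t 1 (fun t : R => - t) (-1) by apply: is_derive_eq.
    have := @is_derive1_comp _ Phi (fun t => - t) _ _ _ (is_derive_Phi _) g.
    by move=> H; apply: is_derive_eq; rewrite mulrN1.
  have dP := is_derive_Phi t.
  by apply: is_derive_eq; rewrite phiN subrr.
have Fcst t : F t = F x by exact: is_derive_0_is_cst.
have : F t @[t --> +oo] --> (1 + 0 : R).
  apply: cvgD; first exact: Phi_cvg_y.
  apply: (@cvg_comp _ _ _ (fun t : R => - t) Phi _ (ninfty_nbhs R)) Phi_cvg_Ny.
  by apply/cvgNry; rewrite opprK; exact: cvg_id.
rewrite addr0 (_ : (fun t => _) = fun=> F x); last by apply/funext => t; exact: Fcst.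
move=> /(cvg_unique _ (cvg_cst _)) => /(_ (@Rhausdorff R)) FE.
by rewrite /F in FE; lra.
Qed.

Let continuous_arg c r : 0 < r -> {for r, continuous (fun r => Phi (r + c / (2 * r)))}.
Proof.
move=> r0; apply: (@continuous_comp _ _ _ (fun r => r + c / (2 * r))); last exact: continuous_Phi.
apply: cvgD; first exact: cvg_id.
apply: cvgMr; apply: cvgV; first by rewrite mulf_neq0// gt_eqF.
by apply: cvgMr; exact: cvg_id.
Qed.

Let cvg_arg_y c : Phi (r + c / (2 * r)) @[r --> +oo] --> (1:R).
Proof.
apply: (@cvg_comp _ _ _ (fun r => r + c / (2 * r)) Phi _ (pinfty_nbhs R)) Phi_cvg_y.
apply/cvgryPge => A; near=> r.
have r1 : 1 <= r by near: r; apply: nbhs_pinfty_ge; rewrite num_real.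
have : - `|c| <= c / (2 * r).
  rewrite ler_pdivlMr ?mulr_gt0// ?(lt_le_trans _ r1)//.
  by have := ler_norm (- c); rewrite normrN; have := normr_ge0 c; nra.
have : A + `|c| <= r by near: r; apply: nbhs_pinfty_ge; rewrite num_real.
lra.
Unshelve. all: by end_near. Qed.

Let cvg_arg_0y c : 0 < c -> Phi (r + c / (2 * r)) @[r --> 0^'+] --> (1:R).
Proof.
move=> c0; apply: (@cvg_comp _ _ _ (fun r => r + c / (2 * r)) Phi _ (pinfty_nbhs R)) Phi_cvg_y.
apply/cvgryPge => A; near=> r.
have r0 : 0 < r by near: r; exact: nbhs_right_gt.
have A1 : 0 < `|A| + 1 by rewrite ltr_wpDl.
apply: (@le_trans _ _ (c / (2 * r))); last by rewrite lerDr ltW.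
rewrite ler_pdivlMr ?mulr_gt0//.
have : r <= c / (2 * (`|A| + 1)).
  by near: r; apply: nbhs_right_le; rewrite divr_gt0// mulr_gt0.
rewrite ler_pdivlMr ?mulr_gt0//.
have := ler_norm A; nra.
Unshelve. all: by end_near. Qed.

Let cvg_arg_0Ny c : c < 0 -> Phi (r + c / (2 * r)) @[r --> 0^'+] --> (0:R).
Proof.
move=> c0; apply: (@cvg_comp _ _ _ (fun r => r + c / (2 * r)) Phi _ (ninfty_nbhs R)) Phi_cvg_Ny.
apply/cvgrNyPle => A; near=> r.
have r0 : 0 < r by near: r; exact: nbhs_right_gt.
have r1 : r <= 1 by near: r; exact: nbhs_right_le.
have A1 : 0 < `|A| + 1 by rewrite ltr_wpDl.
suff : c / (2 * r) <= A - 1 by lra.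
rewrite ler_pdivrMr ?mulr_gt0//.
have : r <= - c / (2 * (`|A| + 1)).
  by near: r; apply: nbhs_right_le; rewrite divr_gt0 ?oppr_gt0// mulr_gt0.
rewrite ler_pdivlMr ?mulr_gt0//.
have := ler_norm (- A); rewrite normrN; nra.
Unshelve. all: by end_near. Qed.

Let cvg_arg_00 : Phi (r + 0 / (2 * r)) @[r --> 0^'+] --> (2^-1:R).
Proof.
have -> : (fun r => Phi (r + 0 / (2 * r))) = Phi.
  by apply/funext => r; rewrite mul0r addr0.
have <- : Phi 0 = 2^-1 by have := PhiN 0; rewrite oppr0; lra.
by apply: cvg_at_right_filter; exact: continuous_Phi.
Qed.

Lemma continuous_limit_integrand x y : continuous (h x y).
Proof.
have near0 (F : set_system R) : Filter F -> (\forall r \near F, 0 < r) -> forall a,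
    hreal r x y @[r --> F] --> (a : R) -> h x y (ext_real r) @[r --> F] --> a.
  move=> FF F0 a; apply: cvg_trans; apply: near_eq_cvg.
  by near=> r; rewrite /hreal limit_integrand_real//; near: r.
apply: ext_continuous => [r r0||].
- rewrite /= /prop_for /continuous_at /= limit_integrand_real//; apply: near0.
    exact: lt_nbhsr.
  by apply: cvgD; apply: cvgMl; exact: continuous_arg.
- rewrite limit_integrand0; apply: near0; first exact: nbhs_right_gt.
  wlog xy : x y / x <= y => [H|].
    have /orP[xy|xy] := le_total x y; first exact: (H x y xy).
    rewrite (_ : (fun r => _) = fun r => hreal r y x); last first.
      by apply/funext => r; rewrite /hreal addrC.
    by rewrite minC; exact: (H y x xy).
  rewrite min_l//; move: xy; rewrite le_eqVlt => /predU1P[<-|xy].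
    (* On the diagonal each [Phi] factor tends to 1/2 instead of 0 or 1, and the sum is still
       [expR (- x)]. *)
    rewrite /hreal subrr [X in _ --> X](_ : _ = 2^-1 * expR (- x) + 2^-1 * expR (- x)); last by field.
    by apply: cvgD; apply: cvgMl; exact: cvg_arg_00.
  rewrite [X in _ --> X](_ : _ = 1 * expR (- x) + 0 * expR (- y)); last by ring.
  by apply: cvgD; apply: cvgMl; [apply: cvg_arg_0y|apply: cvg_arg_0Ny]; rewrite ?subr_gt0 ?subr_lt0.
- rewrite limit_integrand_oo; apply: near0; first exact: nbhs_pinfty_gt.
  rewrite -[X in _ --> X + _]mul1r -[X in _ --> _ + X]mul1r.
  by apply: cvgD; apply: cvgMl; exact: cvg_arg_y.
Unshelve. all: by end_near. Qed.

Lemma bounded_limit_integrand x y : @bounded_continuous R E (h x y).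
Proof.
split; first exact: continuous_limit_integrand.
exists (expR (- x) + expR (- y)); split; first by rewrite num_real.
move=> M hM l _ /=; rewrite ger0_norm ?limit_integrand_ge0//.
exact: le_trans (limit_integrand_le _ _ _) (ltW hM).
Qed.

Lemma bmeas_limit_integrand x y : bmeas (h x y).
Proof. exact: bmeas_ext (bounded_limit_integrand x y). Qed.

Lemma measurable_limit_slope : measurable_fun setT (fun p : R * E => d p.1 p.2).
Proof.
(* Everything is expressed through the measurable [expN p.2]: the radius is [- ln (expN p.2)], and
   the inverse of its double is the exponential of minus a logarithm. *)
pose g (p : R * E) := if expN p.2 == 0 then 1 else if expN p.2 == 1 then (0 <= p.1)%R%:R
  else Phi (- ln (expN p.2) + p.1 * expR (- ln (2 * - ln (expN p.2)))).
rewrite (_ : (fun p => _) = g); last first.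
  apply/funext => -[z l]; rewrite /g/=; case: (ext_cases3 l) => [->|->|[r r0 ->]].
  - by rewrite limit_slope_oo expN_oo eqxx.
  - by rewrite limit_slope0 expN_real// oppr0 expR0 oner_eq0 eqxx.
  - rewrite limit_slope_real// (expN_real (ltW r0)) (gt_eqF (expR_gt0 _)).
    rewrite lt_eqF ?expR_lt1 ?oppr_lt0// expRK opprK expRN lnK//.
    by rewrite posrE mulr_gt0.
have mE : measurable_fun setT (fun p : R * E => expN p.2).
  by apply: measurableT_comp; [exact: measurable_expN|exact: measurable_snd].
have mln : measurable_fun setT (fun p : R * E => - ln (expN p.2)).
  apply: measurableT_comp; first exact: oppr_measurable.
  by apply: measurableT_comp; first exact: measurable_ln.
rewrite /g; apply: measurable_fun_ifT.
  by apply: measurable_fun_eqr; [exact: mE|exact: measurable_cst].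
  exact: measurable_cst.
apply: measurable_fun_ifT.
  by apply: measurable_fun_eqr; [exact: mE|exact: measurable_cst].
  rewrite (_ : (fun p => _) = (\1_(`[0, +oo[%classic) : R -> R) \o fst).
    apply: measurableT_comp; [exact: measurable_indic|exact: measurable_fst].
  apply/funext => p; rewrite /= indicE; congr (_%:R).
  by rewrite mem_setE in_itv/= andbT.
apply: measurableT_comp; first by apply: continuous_measurable_fun; exact: continuous_Phi.
apply: measurable_funD; first exact: mln.
apply: measurable_funM; first exact: measurable_fst.
apply: measurableT_comp; first exact: measurable_expR.
apply: measurableT_comp; first exact: oppr_measurable.
apply: measurableT_comp; first exact: measurable_ln.
by apply: measurable_funM => //; exact: measurable_cst.
Qed.

Lemma bmeas_limit_slope z : bmeas (d z).
Proof.
split; last by exists 1 => l; rewrite ger0_norm ?limit_slope_ge0 ?limit_slope_le1.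
rewrite (_ : d z = (fun p : R * E => d p.1 p.2) \o (pair z))//.
by apply: measurableT_comp; [exact: measurable_limit_slope|exact: measurable_pair1].
Qed.
End limit_integrand_theory.

(** * Bivariate Gaussian tails *)

Lemma probability_fin_num d (T : measurableType d) (R : realType) (P : probability T R) A :
  measurable A -> P A \is a fin_num.
Proof. by move=> mA; rewrite fin_num_measure. Qed.

Section probability_decomposition.
Context d (T : measurableType d) (R : realType) (P : probability T R).
Variables A B : set T.
Hypotheses (mA : measurable A) (mB : measurable B).
Let p C := fine (P C).

Let pDI C D : measurable C -> measurable D -> p C = p (C `\` D) + p (C `&` D).
Proof.
move=> mC mD; rewrite /p -fineD ?fin_num_measure//; last 2 first.
- exact: measurableD.
- exact: measurableI.
by congr fine; exact: measureDI.
Qed.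

Let pT : p setT = 1.
Proof. by rewrite /p probability_setT. Qed.

Lemma fine_probability_setC : p (~` A) = 1 - p A.
Proof. by have := pDI measurableT mA; rewrite pT setTI setTD => ->; ring. Qed.

Lemma probability_setIC : 1 - p (A `&` B) = (1 - p A) + p (A `\` B).
Proof. by rewrite (pDI mA mB); ring. Qed.

Lemma probability_setDE : p (A `\` B) = (1 - p B) - p (~` A `\` B).
Proof.
have := pDI (measurableC mB) mA.
have := pDI measurableT mB; rewrite pT setTI setTD.
by rewrite (setDE A) (setDE (~` A)) (setDE (~` B)) !(setIC (~` B)) => -> ->; ring.
Qed.

End probability_decomposition.

Section normalized_tail.
Context {R : realType}.
Local Notation mu := (@lebesgue_measure R).
Local Notation N01 := (probR (normal_prob (0:R) 1)).
Local Notation Phi := (@std_normal_cdf R).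
Local Notation phi := (normal_pdf (0:R) 1).
Implicit Types (a d : R -> R) (s x y : R).

(* The density of [beta * (Z - beta)] at [s], times [n], for a standard normal [Z]
   and [beta = n * phi beta]; it tends to [expR (- s)] as [beta] grows. *)
Definition tail_density (beta s : R) : R := expR (- s - s ^+ 2 / (2 * beta ^+ 2)).
Local Notation gam := tail_density.

Lemma tail_density_le (beta s : R) : 0 <= gam beta s <= expR (- s).
Proof.
by rewrite expR_ge0 ler_expR gerBl divr_ge0 ?sqr_ge0// mulr_ge0// sqr_ge0.
Qed.

Lemma measurable_tail_density (beta : R) : measurable_fun setT (gam beta).
Proof.
apply: measurableT_comp; first exact: measurable_expR.
apply: measurable_funB; first exact: oppr_measurable.
by apply: measurable_funM => //; apply: measurable_funX.
Qed.

(** The equation for [beta] makes [n / beta] the inverse of $\varphi(\beta)$, so only the ratio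
    $\varphi(\beta + s/\beta)/\varphi(\beta)$ is left. *)
Lemma normal_pdf_tail (beta s : R) n : 0 < beta -> beta = n%:R * phi beta ->
  n%:R * normal_pdf (- beta ^+ 2) beta s = gam beta s.
Proof.
move=> b0 bE; rewrite normal_pdf_affine// mulrA.
apply: (canLR (mulfK _)); first by rewrite gt_eqF.
rewrite [RHS]mulrC {3}bE !std_pdfE -!mulrA /tail_density -expRD; congr (_ * (_ * expR _)).
by field; rewrite gt_eqF.
Qed.

Lemma Rintegral_normalized_N01 (beta : R) n (g : R -> R) : 0 < beta -> beta = n%:R * phi beta ->
  bmeas g ->
  n%:R * \int[N01]_w g (beta * (w - beta)) = \int[mu]_s (g s * gam beta s).
Proof.
move=> b0 bE bg.
have m1 : measurable_fun setT (fun w : R => - beta ^+ 2 + beta * w).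
  by apply: measurable_funD => //; apply: measurable_funM.
rewrite (_ : (fun w => _) = (fun w => g (- beta ^+ 2 + beta * w))); last first.
  by apply/funext => w; congr g; ring.
have law A : measurable A -> N01 ((fun w : R => - beta ^+ 2 + beta * w) @^-1` A) =
    probR (normal_prob (- beta ^+ 2) beta) (idfun @^-1` A).
  by move=> mA; exact: N01_affine_gt0.
have -> := same_law_Rintegral m1 (measurable_id (D := setT)) law bg.
rewrite Rintegral_normal_prob// -RintegralZl//; last first.
  apply: (integrableMr measurableT) (integrable_normal_pdf _ _); first by case: bg.
  case: bg => _ [M gM]; exists M; split; first by rewrite num_real.
  by move=> M' MM' t _ /=; rewrite (le_trans (gM t))// ltW.
by apply: eq_Rintegral => s _; rewrite -(normal_pdf_tail s b0 bE); ring.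
Qed.

Lemma integral_expN_half y :
  (\int[mu]_(s in `[y, +oo[) (expR (- (s / 2)))%:E = (2 * expR (- (y / 2)))%:E)%E.
Proof.
have dF s : is_derive s 1 (fun s => - (2 * expR (- (s / 2)))) (expR (- (s / 2))).
  by apply: is_derive_eq; rewrite /GRing.scale/=; field.
have cF (k : R) : continuous (fun s : R => k * expR (- (s / 2))).
  move=> s; apply: cvgMr; apply: continuous_comp; last exact: continuous_expR.
  by apply: cvgN; apply: cvgMl; exact: cvg_id.
rewrite (@ge0_continuous_FTC2y _ _ (fun s => - (2 * expR (- (s / 2)))) _ 0).
- by rewrite -EFinB sub0r opprK.
- by move=> s _; rewrite expR_ge0.
- by apply: continuous_subspaceT => s; have := cF 1 s; under eq_fun do rewrite mul1r.
- rewrite -oppr0; apply: cvgN; rewrite -[X in _ --> X](mulr0 2); apply: cvgMr.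
  apply: (@cvg_comp _ _ _ (fun s : R => s / 2) (fun s => expR (- s)) _ (pinfty_nbhs R)) (@cvgr_expR R).
  by apply/cvgryPge => A; near=> s; rewrite ler_pdivlMr//; near: s;
    apply: nbhs_pinfty_ge; rewrite num_real.
- by move=> s _; have [] := dF s.
- by apply: cvg_at_right_filter; apply: cvgN; exact: cF.
- by move=> s _; rewrite derive1E; have [] := dF s.
Unshelve. all: by end_near. Qed.

Let poly_le_exp y s : y <= s ->
  (1 + `|s| + s ^+ 2) * expR (- s) <= 10 * expR `|y| * expR (- (s / 2)).
Proof.
move=> ys.
(* Here 10 = 2 + 8: twice the bound $1 + |s|/2 \le e^{|s|/2}$ plus eight times $1 + s^2/8 \le
   e^{|s|/2}$. *)
have h : 1 + `|s| + s ^+ 2 <= 10 * expR (`|s| / 2).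
  have := @expR_ge1Dxn R (`|s| / 2) 1 (divr_ge0 (normr_ge0 s) (ler0n _ 2)).
  have := @expR_ge1Dx R (`|s| / 2).
  by rewrite exprMn real_normK ?num_real// (_ : 2`! = 2%N)// ; lra.
apply: (le_trans (ler_wpM2r (expR_ge0 _) h)).
rewrite -!mulrA ler_pM2l// -!expRD ler_expR.
suff : `|s| <= s + 2 * `|y| by lra.
have := ler_norm (- y); rewrite normrN => h1.
case: (ger0P s) => s0; last lra.
by have := normr_ge0 y; lra.
Qed.

(** The errors from [a - d] and from the density are both of order $(1 + |s| + s^2)e^{-s}/\beta^2$;
    half of the exponent absorbs the polynomial. In the constant, 20 is the 10 of [poly_le_exp]
    times the 2 from integrating $e^{-s/2}$. *)
Lemma tail_density_compare (C beta y : R) a d : 0 < beta -> 0 <= C ->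
  measurable_fun setT a -> measurable_fun setT d ->
  (forall s, 0 <= a s <= 1) -> (forall s, 0 <= d s <= 1) ->
  (forall s, `|a s - d s| <= C * (1 + `|s|) / beta ^+ 2) ->
  `|\int[mu]_(s in `[y, +oo[) (a s * gam beta s) -
    \int[mu]_(s in `[y, +oo[) (expR (- s) * d s)| <=
  (C + 1) * (20 * expR (`|y| - y / 2)) / beta ^+ 2.
Proof.
move=> b0 C0 ma md a01 d01 ad.
have b20 : 0 < beta ^+ 2 by rewrite exprn_gt0.
have mD : measurable (`[y, +oo[%classic : set (measurableTypeR R)) by exact: measurable_itv.
have ihalf : mu.-integrable `[y, +oo[ (EFin \o (fun s => expR (- (s / 2)))).
  apply/integrableP; split.
    apply/measurable_EFinP/measurable_funTS; apply: measurableT_comp; first exact: measurable_expR.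
    apply: measurableT_comp; first exact: oppr_measurable.
    exact: mulrr_measurable.
  under eq_integral => s _ do rewrite /= ger0_norm ?expR_ge0//.
  by rewrite integral_expN_half ltry.
have iK k : mu.-integrable `[y, +oo[ (EFin \o (fun s => k * expR (- (s / 2)))).
  have := integrableZl mD k ihalf; exact.
have mexp : measurable_fun setT (fun s : R => expR (- s)).
  by apply: measurableT_comp; [exact: measurable_expR|exact: oppr_measurable].
have mgam := measurable_tail_density beta.
have dom (f : R -> R) k : measurable_fun setT f -> (forall s, y <= s -> `|f s| <= k * expR (- (s / 2))) ->
    mu.-integrable `[y, +oo[ (EFin \o f).
  move=> mf fk; apply: (le_integrable mD) (iK k); first exact/measurable_EFinP/measurable_funTS.
  move=> s; rewrite /= in_itv/= andbT => ys; rewrite lee_fin (le_trans (fk _ ys))//.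
  exact: ler_norm.
have eb s : y <= s -> expR (- s) <= 10 * expR `|y| * expR (- (s / 2)).
  move=> ys; apply: le_trans (poly_le_exp ys); rewrite ler_peMl ?expR_ge0//.
  by have := normr_ge0 s; have := sqr_ge0 s; lra.
have iag : mu.-integrable `[y, +oo[ (EFin \o (fun s => a s * gam beta s)).
  apply: (dom _ (10 * expR `|y|)); first exact: measurable_funM.
  move=> s ys; have /andP[a0 a1] := a01 s; have /andP[g0 g1] := tail_density_le beta s.
  rewrite ger0_norm ?mulr_ge0//; apply: le_trans (eb _ ys).
  by apply: le_trans g1; rewrite ler_piMl.
have ied : mu.-integrable `[y, +oo[ (EFin \o (fun s => expR (- s) * d s)).
  apply: (dom _ (10 * expR `|y|)); first exact: measurable_funM.
  move=> s ys; have /andP[d0 d1] := d01 s.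
  rewrite ger0_norm ?mulr_ge0 ?expR_ge0//; apply: le_trans (eb _ ys).
  by rewrite ler_piMr ?expR_ge0.
rewrite -RintegralB//; apply: (le_trans (le_normr_Rintegral _ _)) => //.
  exact: (integrableB mD iag ied).
pose k := (C + 1) * (10 * expR `|y|) / beta ^+ 2.
rewrite [X in _ <= X](_ : _ = \int[mu]_(s in `[y, +oo[) (k * expR (- (s / 2)))); last first.
  rewrite RintegralZl// [in RHS]/Rintegral integral_expN_half/= /k expRD.
  by field; rewrite gt_eqF.
apply: le_Rintegral => //.
- by have := integrable_norm (integrableB mD iag ied).
- move=> s/=; rewrite in_itv/= andbT => ys.
  have /andP[a0 a1] := a01 s; have /andP[d0 d1] := d01 s.
  have /andP[g0 g1] := tail_density_le beta s.
  rewrite (_ : _ - _ = (a s - d s) * expR (- s) - a s * (expR (- s) - gam beta s)); last by ring.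
  apply: (le_trans (ler_normB _ _)).
  rewrite !normrM (ger0_norm a0) (ger0_norm (expR_ge0 _)) (@ger0_norm _ (expR _ - _)) ?subr_ge0//.
  have h1 : expR (- s) - gam beta s <= expR (- s) * (s ^+ 2 / (2 * beta ^+ 2)).
    rewrite /tail_density expRD -{1}(mulr1 (expR (- s))) -mulrBr ler_wpM2l ?expR_ge0//.
    by have := expR_ge1Dx (- (s ^+ 2 / (2 * beta ^+ 2))); lra.
  have h2 : a s * (expR (- s) - gam beta s) <= expR (- s) * (s ^+ 2 / (2 * beta ^+ 2)).
    by apply: le_trans h1; rewrite ler_piMl// subr_ge0.
  apply: (le_trans (lerD (ler_wpM2r (expR_ge0 _) (ad s)) h2)).
  have := poly_le_exp ys; rewrite -(ler_pM2r (_ : 0 < (C + 1) / beta ^+ 2)); last first.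
    by rewrite divr_gt0// ltr_wpDl.
  move=> /le_trans; rewrite (_ : k * _ = 10 * expR `|y| * expR (- (s / 2)) * ((C + 1) / beta ^+ 2)); last first.
    by rewrite /k; ring.
  move=> /(_ _ (lexx _)); apply: le_trans; rewrite [X in X <= _](_ : _ = (C * (1 + `|s|) + s ^+ 2 / 2) * expR (- s) / beta ^+ 2); last first.
    by field; rewrite gt_eqF.
  rewrite [X in _ <= X](_ : _ = (C + 1) * (1 + `|s| + s ^+ 2) * expR (- s) / beta ^+ 2); last by ring.
  rewrite ler_pM2r ?invr_gt0// ler_wpM2r ?expR_ge0//.
  have := normr_ge0 s; have := sqr_ge0 s; nra.
Qed.

Let P2 : set (R * R) -> \bar R := (N01 \x N01)%E.

Definition gauss_cdf (rho u1 u2 : R) : R :=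
  fine (P2 (gauss_pair rho @^-1` (`]-oo, u1]%classic `*` `]-oo, u2]%classic))).

Let A1 (rho u1 : R) := [set z | (gauss_pair rho z).1 <= u1].
Let B1 (u2 : R) : set (R * R) := [set z | z.1 <= u2].

Let mA1 rho u1 : measurable (A1 rho u1).
Proof.
rewrite (_ : A1 _ _ = (gauss_pair rho) @^-1` (`]-oo, u1]%classic `*` setT)).
  by apply: measurable_preimage; [exact: measurable_gauss_pair|exact: measurableX].
by apply/seteqP; split => z/=; rewrite in_itv//= => -[].
Qed.

Let mB1 u2 : measurable (B1 u2).
Proof.
rewrite (_ : B1 _ = (`]-oo, u2]%classic `*` setT)).
  by exact: measurableX.
by apply/seteqP; split => z/=; rewrite in_itv//= => -[].
Qed.

Let P2A1 rho u1 : -1 <= rho <= 1 -> fine (P2 (A1 rho u1)) = Phi u1.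
Proof.
move=> rho1; have := @gauss_pair_linear_law R rho 1 0 `]-oo, u1]%classic rho1 (measurable_itv _).
rewrite (_ : [set z | _] = A1 rho u1); last first.
  by apply/seteqP; split => z/=; rewrite mul1r mul0r addr0 in_itv.
rewrite /P2 => ->; rewrite expr1n expr0n/= mulr0 mul0r !addr0 sqrtr1.
by rewrite /normal_law oner_eq0.
Qed.

Let P2B1 u2 : fine (P2 (B1 u2)) = Phi u2.
Proof.
rewrite (_ : B1 u2 = (`]-oo, u2]%classic `*` setT)); last first.
  by apply/seteqP; split => z/=; rewrite in_itv//= => -[].
have := product_measure1E N01 N01 (measurable_itv `]-oo, u2]) measurableT.
rewrite /P2 => ->; rewrite [X in (_ * X)%E](_ : _ = 1%E); last exact: probability_setT.
by rewrite mule1.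
Qed.

(** The complement of a quadrant splits into a one-dimensional tail and this event, in which only
    the second coordinate exceeds. It is evaluated by conditioning when $\lambda$ is bounded, and
    through the event that both exceed when $\lambda$ is large. *)
Let joint_tail (rho u1 u2 : R) := fine (P2 (A1 rho u1 `\` B1 u2)).

Let gauss_cdf_tail rho u1 u2 : -1 <= rho <= 1 ->
  1 - gauss_cdf rho u1 u2 = (1 - Phi u1) + joint_tail rho u1 u2.
Proof.
move=> rho1; rewrite -(P2A1 u1 rho1).
have <- : fine (P2 (A1 rho u1 `&` B1 u2)) = gauss_cdf rho u1 u2.
  by congr (fine (P2 _)).
exact: (probability_setIC (N01 \x N01)%E (mA1 rho u1) (mB1 u2)).
Qed.

Let joint_tailE rho u1 u2 :
  joint_tail rho u1 u2 = (1 - Phi u2) - fine (P2 (~` A1 rho u1 `\` B1 u2)).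
Proof.
rewrite -(P2B1 u2).
exact: (probability_setDE (N01 \x N01)%E (mA1 rho u1) (mB1 u2)).
Qed.

Let cond (rho u1 w : R) := fine (N01 [set z | rho * w + Num.sqrt (1 - rho ^+ 2) * z <= u1]).

Let mcond (rho u1 w : R) : measurable [set z : R | rho * w + Num.sqrt (1 - rho ^+ 2) * z <= u1].
Proof.
rewrite (_ : [set z : R | _] = (fun z => rho * w + Num.sqrt (1 - rho ^+ 2) * z) @^-1` `]-oo, u1]%classic).
  by apply: measurable_preimage => //; apply: measurable_funD => //; exact: mulrl_measurable.
by apply/seteqP; split => z/=; rewrite in_itv.
Qed.

Let cond01 rho u1 w : 0 <= cond rho u1 w <= 1.
Proof.
have mA := mcond rho u1 w.
rewrite /cond fine_ge0//= -[leRHS]/(fine 1%E) fine_le//.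
  exact: fin_num_measure.
exact: probability_le1.
Qed.

Let measurable_cond rho u1 : measurable_fun setT (cond rho u1).
Proof.
have m : measurable_fun setT (N01 \o xsection (A1 rho u1)).
  exact: (measurable_fun_xsection N01 (mA1 rho u1)).
have := measurableT_comp (fine_measurable measurableT) m.
congr (measurable_fun _ _); apply/funext => w /=; congr (fine (N01 _)).
by apply/seteqP; split => z/=; rewrite /xsection/= inE.
Qed.

Let joint_tail_integral rho u1 u2 :
  joint_tail rho u1 u2 = \int[N01]_w (\1_`]u2, +oo[ w * cond rho u1 w).
Proof.
rewrite /joint_tail /P2 /product_measure1/= /Rintegral; congr fine.
apply: eq_integral => w _; rewrite [LHS](_ : _ = N01 (xsection (A1 rho u1 `\` B1 u2) w))//.
rewrite indicE mem_setE in_itv/= andbT; have [wu|wu] := ltP u2 w; last first.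
  rewrite mul0r (_ : xsection _ _ = set0) ?measure0//.
  by apply/seteqP; split => z//=; rewrite /xsection/= inE/= => -[_]; exact.
rewrite mul1r /cond fineK; last by apply: fin_num_measure; exact: mcond.
congr (N01 _); apply/seteqP; split => z/=; rewrite /xsection/= inE/=.
  by case.
by move=> h; split => //; rewrite /B1/=; apply/negP; rewrite -ltNge.
Qed.

Let joint_tail_scaled rho x y (beta : R) n : 0 < beta -> beta = n%:R * phi beta ->
  n%:R * joint_tail rho (beta + x / beta) (beta + y / beta) =
  \int[mu]_(s in `[y, +oo[) (cond rho (beta + x / beta) (beta + s / beta) * gam beta s).
Proof.
move=> b0 bE; rewrite joint_tail_integral.
pose g s := \1_(`]y, +oo[%classic) s * cond rho (beta + x / beta) (beta + s / beta) : R.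
have mc : measurable_fun setT (fun s => cond rho (beta + x / beta) (beta + s / beta)).
  apply: measurableT_comp; first exact: measurable_cond.
  by apply: measurable_funD => //; exact: mulrr_measurable.
have bg : bmeas g.
  apply: bmeasM; first exact: bmeas_indic.
  split => //; exists 1 => s.
  by have /andP[c0 c1] := cond01 rho (beta + x / beta) (beta + s / beta); rewrite ger0_norm.
have := Rintegral_normalized_N01 b0 bE bg.
rewrite (_ : (fun w => g _) = (fun w => \1_`](beta + y / beta), +oo[ w * cond rho (beta + x / beta) w)).
  move=> ->; rewrite [RHS]/Rintegral -integral_itv_obnd_cbnd; last first.
    apply/measurable_EFinP/measurable_funTS; apply: measurable_funM => //.
    exact: measurable_tail_density.
  rewrite -[RHS]/(Rintegral _ _ _) [RHS]Rintegral_mkcond; apply: eq_Rintegral => s _.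
  rewrite /g patchE indicE; case: ifPn => _; rewrite ?mul1r ?mul0r//.
apply/funext => w; rewrite /g (_ : beta + beta * (w - beta) / beta = w); last first.
  by field; rewrite gt_eqF.
congr (_ * _); rewrite !indicE !mem_setE !in_itv/= !andbT; congr (_%:R).
by rewrite -ltrBrDl ltr_pdivrMr// mulrC.
Qed.

Let Phi_tail u : 1 - Phi u = fine (N01 (`]u, +oo[%classic)).
Proof.
have := fine_probability_setC N01 (measurable_itv `]-oo, u]).
by rewrite setCitvl => ->.
Qed.

Let tail_Phi_scaled x (beta : R) n : 0 < beta -> beta = n%:R * phi beta ->
  n%:R * (1 - Phi (beta + x / beta)) = \int[mu]_(s in `[x, +oo[) (1 * gam beta s).
Proof.
move=> b0 bE; have -> : 1 - Phi (beta + x / beta) =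
    \int[N01]_w (\1_(`]x, +oo[%classic) (beta * (w - beta))).
  rewrite Phi_tail -(Rintegral_prob_indic N01 (measurable_itv `]beta + x / beta, +oo[)).
  apply: eq_Rintegral => w _; rewrite !indicE !mem_setE !in_itv/= !andbT.
  by congr (_%:R); rewrite -ltrBrDl ltr_pdivrMr// mulrC.
rewrite (Rintegral_normalized_N01 b0 bE)//; last exact: bmeas_indic.
rewrite [RHS]/Rintegral -integral_itv_obnd_cbnd; last first.
  apply/measurable_EFinP/measurable_funTS; apply: measurable_funM => //.
  exact: measurable_tail_density.
rewrite -[RHS]/(Rintegral _ _ _) [RHS]Rintegral_mkcond; apply: eq_Rintegral => s _.
by rewrite patchE indicE; case: ifPn => _; rewrite ?mul1r ?mul0r.
Qed.

Let integral_expN x : (\int[mu]_(s in `[x, +oo[) (expR (- s))%:E = (expR (- x))%:E)%E.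
Proof.
have := limit_integrand_integral x x (@ext_oo R).
under eq_integral do rewrite limit_slope_oo mulr1.
by rewrite limit_integrand_oo addrK.
Qed.

Lemma tail_Phi_compare x (beta : R) n : 0 < beta -> beta = n%:R * phi beta ->
  `|n%:R * (1 - Phi (beta + x / beta)) - expR (- x)| <= 20 * expR (`|x| - x / 2) / beta ^+ 2.
Proof.
move=> b0 bE; rewrite (tail_Phi_scaled _ b0 bE).
have one01 s : 0 <= (1:R) <= 1 by rewrite ler01 lexx.
have := @tail_density_compare 0 beta x (fun=> 1) (fun=> 1) b0 (lexx 0)
  (measurable_cst _) (measurable_cst _) one01 one01 _.
rewrite add0r mul1r (_ : \int[mu]_(s in `[x, +oo[) (expR (- s) * 1) = expR (- x)); last first.
  rewrite /Rintegral; under eq_integral do rewrite mulr1.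
  by rewrite integral_expN.
by apply => s; rewrite subrr normr0 !mul0r.
Qed.

Lemma tail_Phi_le x (beta : R) n : 0 < beta -> beta = n%:R * phi beta ->
  n%:R * (1 - Phi (beta + x / beta)) <= expR (- x).
Proof.
move=> b0 bE; rewrite (tail_Phi_scaled _ b0 bE) -lee_fin -integral_expN /Rintegral.
have mg : measurable_fun `[x, +oo[ (fun s => (1 * gam beta s)%:E).
  apply/measurable_EFinP/measurable_funTS; apply: measurable_funM => //.
  exact: measurable_tail_density.
have le : (\int[mu]_(s in `[x, +oo[) (1 * gam beta s)%:E <= \int[mu]_(s in `[x, +oo[) (expR (- s))%:E)%E.
  apply: ge0_le_integral => //.
  - by move=> s _; rewrite lee_fin mul1r; have /andP[] := tail_density_le beta s.
  - apply/measurable_EFinP/measurable_funTS; apply: measurableT_comp; first exact: measurable_expR.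
    exact: oppr_measurable.
  - by move=> s _; rewrite lee_fin mul1r; have /andP[] := tail_density_le beta s.
rewrite fineK// ge0_fin_numE.
  by apply: le_lt_trans le _; rewrite integral_expN ltry.
by apply: integral_ge0 => s _; rewrite lee_fin mul1r; have /andP[] := tail_density_le beta s.
Qed.

Let lambda_ofE (beta rho : R) :
  lambda_of beta rho = ext_real (Num.sqrt (beta ^+ 2 * (1 - rho) / 2)).
Proof. by apply: val_inj => /=; rewrite max_r// sqrtr_ge0. Qed.

(** With $t = (1-\rho)/2 = \lambda^2/\beta^2$ one has $1-\rho^2 = 4t(1-t)$, so the conditional
    probability is exactly $\Phi$ of the limiting argument, shifted by $\lambda s/\beta^2$ and
    scaled by $(1-t)^{-1/2}$. [Phi_lip] handles the shift and [Phi_scale] the scaling;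
    [2 * L ^+ 2 <= beta ^+ 2] keeps $t \le 1/2$. *)
Let cond_compare (L rho x s beta : R) : -1 <= rho <= 1 -> 0 < beta ->
  Num.sqrt (beta ^+ 2 * (1 - rho) / 2) <= L -> 2 * L ^+ 2 <= beta ^+ 2 ->
  `|cond rho (beta + x / beta) (beta + s / beta) - limit_slope (x - s) (lambda_of beta rho)| <=
  (2 * L ^+ 2 + L) * (1 + `|s|) / beta ^+ 2.
Proof.
move=> /andP[rho0]; rewrite lambda_ofE; set lam := Num.sqrt _ => rho1 b0 lamL Lb.
have b20 : 0 < beta ^+ 2 by rewrite exprn_gt0.
have lam0 : 0 <= lam by exact: sqrtr_ge0.
have L0 : 0 <= L by exact: le_trans lamL.
(* For [rho = 1] the conditional law is a Dirac mass, and the conditional probability is exactly the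
   value of [limit_slope] at 0, also in the case of equality. *)
move: rho1; rewrite le_eqVlt => /predU1P[rho1|rho1].
  rewrite (_ : lam = 0); last by rewrite /lam rho1 subrr mulr0 mul0r sqrtr0.
  rewrite limit_slope0 (_ : cond _ _ _ = (0 <= x - s)%R%:R); last first.
    rewrite /cond rho1 expr1n subrr sqrtr0 subr_ge0; case: leP => sx.
      rewrite (_ : [set z | _] = setT) ?probability_setT//.
      by apply/seteqP; split => z//= _; rewrite mul0r addr0 mul1r lerD2l ler_pM2r ?invr_gt0.
    rewrite (_ : [set z | _] = set0) ?measure0//.
    apply/seteqP; split => z//=; rewrite mul0r addr0 mul1r lerD2l ler_pM2r ?invr_gt0//.
    by rewrite leNgt sx.
  rewrite subrr normr0; apply: divr_ge0; last exact: ltW.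
  by have := sqr_ge0 L; have := normr_ge0 s; nra.
have lamgt0 : 0 < lam by rewrite sqrtr_gt0 divr_gt0// mulr_gt0// subr_gt0.
have lam2 : lam ^+ 2 = beta ^+ 2 * (1 - rho) / 2.
  by rewrite sqr_sqrtr//; apply: divr_ge0 => //; apply: mulr_ge0; rewrite ?subr_ge0; exact: ltW.
have lam2L : lam ^+ 2 <= L ^+ 2 by rewrite lerXn2r ?nnegrE.
pose t := (1 - rho) / 2.
have tE : t = lam ^+ 2 / beta ^+ 2 by rewrite lam2 /t; field; rewrite gt_eqF.
have t0 : 0 < t by rewrite /t divr_gt0// subr_gt0.
have t12 : t <= 1 / 2 by rewrite tE ler_pdivrMr//; lra.
pose q := Num.sqrt (1 - t).
have q2 : q ^+ 2 = 1 - t by rewrite sqr_sqrtr//; lra.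
have q0 : 0 < q by rewrite sqrtr_gt0; lra.
have sE : Num.sqrt (1 - rho ^+ 2) = 2 * lam / beta * q.
  rewrite -[RHS]ger0_norm; last by rewrite !mulr_ge0// ?invr_ge0 ltW.
  rewrite -sqrtr_sqr; congr Num.sqrt.
  by rewrite !exprMn q2 lam2 /t exprVn; field; rewrite gt_eqF.
have rhoE : rho = 1 - 2 * t by rewrite /t; lra.
pose A0 := lam + (x - s) / (2 * lam).
have condE : cond rho (beta + x / beta) (beta + s / beta) =
    Phi (q^-1 * (A0 + lam * s / beta ^+ 2)).
  rewrite /cond -[RHS]/(fine (N01 (`]-oo, _]%classic))); congr (fine (N01 _)).
  have sg0 : 0 < 2 * lam / beta * q by rewrite !mulr_gt0 ?invr_gt0.
  rewrite (_ : q^-1 * _ = (beta + x / beta - rho * (beta + s / beta)) / (2 * lam / beta * q)).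
    by apply/seteqP; split => z/=; rewrite in_itv/= sE ler_pdivlMr// lerBrDl [z * _]mulrC.
  by rewrite rhoE tE /A0; field; rewrite !gt_eqF.
rewrite condE limit_slope_real// -/A0.
have qi1 : 1 <= q^-1 by rewrite invf_ge1//; nra.
have qi2 : q^-1 <= 1 + 2 * t.
  rewrite -[q^-1]mul1r ler_pdivrMr//; have : 1 - t <= q by nra.
  nra.
have h1 := Phi_scale (A0 + lam * s / beta ^+ 2) qi1.
have h2 := Phi_lip A0 (A0 + lam * s / beta ^+ 2).
apply: (le_trans (ler_distD (Phi (A0 + lam * s / beta ^+ 2)) _ _)).
apply: (le_trans (lerD h1 h2)).
rewrite (_ : A0 + _ - A0 = lam * s / beta ^+ 2); last by ring.
rewrite !normrM normfV (ger0_norm lam0) (ger0_norm (ltW b20)).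
apply: (@le_trans _ _ ((2 * lam ^+ 2 + lam * `|s|) / beta ^+ 2)).
  rewrite mulrDl lerD2r; apply: (@le_trans _ _ (2 * t)); first lra.
  by rewrite tE mulrA.
rewrite ler_pM2r ?invr_gt0//; have := normr_ge0 s; have := sqr_ge0 L; nra.
Qed.

(** If both coordinates exceed, so does their sum, which is normal with standard deviation
    $2\sqrt{1-t} \le 2 - t$ for $t = (1-\rho)/2$. The gain $t\beta^2 \ge L^2$ is what shifts the
    one-dimensional tail from $(x+y)/2$ to [x']. *)
Let both_tail (L rho x y beta : R) n : -1 <= rho <= 1 -> 0 < beta -> beta = n%:R * phi beta ->
  0 <= L -> L <= Num.sqrt (beta ^+ 2 * (1 - rho) / 2) -> 0 <= (x + y) / 2 + L ^+ 2 / 2 ->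
  n%:R * fine (P2 (~` A1 rho (beta + x / beta) `\` B1 (beta + y / beta))) <=
  expR (- ((x + y) / 2 + L ^+ 2 / 2)).
Proof.
move=> rho1 b0 bE L0 Llam; set x' := (x + y) / 2 + L ^+ 2 / 2 => x'0.
apply: le_trans (tail_Phi_le x' b0 bE); rewrite ler_wpM2l//.
pose S := 2 * beta + (x + y) / beta.
pose tau := Num.sqrt (1 ^+ 2 + 1 ^+ 2 + 2 * 1 * 1 * rho).
have tau0 : 0 <= tau := sqrtr_ge0 _.
have b20 : 0 < beta ^+ 2 by rewrite exprn_gt0.
have /andP[rho0 rho1'] := rho1.
pose t := (1 - rho) / 2.
have tau2 : tau <= 2 * (1 - t / 2).
  rewrite -[leRHS]ger0_norm; last by rewrite /t; lra.
  rewrite -sqrtr_sqr ler_sqrt ?sqr_ge0//; rewrite /t; nra.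
have L2 : L ^+ 2 <= beta ^+ 2 * t.
  rewrite /t mulrA -(@sqr_sqrtr _ (beta ^+ 2 * (1 - rho) / 2)); last first.
    by apply: divr_ge0 => //; apply: mulr_ge0; [exact: ltW|rewrite subr_ge0].
  by rewrite lerXn2r ?nnegrE ?sqrtr_ge0.
have tauS : tau * (beta + x' / beta) <= S.
  have v0 : 0 <= beta + x' / beta by rewrite addr_ge0 ?divr_ge0// ltW.
  apply: (le_trans (ler_wpM2r v0 tau2)).
  rewrite -(ler_pM2r b0) /S.
  rewrite [leLHS](_ : _ = 2 * (1 - t / 2) * (beta ^+ 2 + x')); last by field; rewrite gt_eqF.
  rewrite [leRHS](_ : _ = 2 * beta ^+ 2 + (x + y)); last by field; rewrite gt_eqF.
  rewrite /x' in x'0 *; rewrite /t in L2 *; nra.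
have H := @gauss_pair_linear_law R rho 1 1 `]S, +oo[%classic rho1 (measurable_itv _).
have mS : measurable [set z : R * R | (`]S, +oo[%classic : set R) (1 * (gauss_pair rho z).1 + 1 * (gauss_pair rho z).2)].
  apply: (@measurable_preimage _ _ _ _ (fun z => 1 * (gauss_pair rho z).1 + 1 * (gauss_pair rho z).2)) => //.
  have mg := measurable_gauss_pair rho.
  by apply: measurable_funD; apply: measurable_funM => //;
    [apply: measurableT_comp measurable_fst mg|apply: measurableT_comp measurable_snd mg].
have E1 : 1 - Phi (beta + x' / beta) = fine (N01 (`]beta + x' / beta, +oo[%classic)).
  exact: Phi_tail.
rewrite E1; apply: fine_le.
- apply: (probability_fin_num (N01 \x N01)%E); apply: measurableD; first exact: measurableC.
  exact: mB1.
- exact: fin_num_measure.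
apply: (@le_trans _ _ (P2 [set z : R * R | (`]S, +oo[%classic : set R) (1 * (gauss_pair rho z).1 + 1 * (gauss_pair rho z).2)])).
  apply: (le_measure (N01 \x N01)%E).
  - by rewrite inE; apply: measurableD; [exact: measurableC|exact: mB1].
  - by rewrite inE.
  - move=> z [/= h1 h2]; rewrite in_itv/= andbT !mul1r /S.
    move: h1 h2; rewrite /A1/B1/= => /negP; rewrite -ltNge => h1 /negP; rewrite -ltNge => h2.
    have := ltrD h1 h2; rewrite (_ : beta + _ + _ = 2 * beta + (x + y) / beta)//; ring.
rewrite /P2 H -/tau -(N01_affine 0 tau0)//.
apply: le_measure; rewrite ?inE//.
  apply: measurable_preimage => //; apply: measurable_funD => //; exact: mulrl_measurable.
move=> z /=; rewrite !in_itv/= !andbT add0r => Sz.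
rewrite ltNge; apply/negP => zv; move: Sz; rewrite ltNge => /negP; apply.
by apply: le_trans tauS; rewrite ler_wpM2l.
Qed.

Lemma cvg_ext_real_oo : ext_real r @[r --> +oo] --> (ext_oo : ext_nneg R).
Proof.
apply/cvg_ballP => e e0.
have /cvgrPdist_lt/(_ _ e0) := @cvgr_expR R.
move=> he; near=> r; rewrite ext_ballE expN_oo expN_real; first by near: r.
by near: r; apply: nbhs_pinfty_ge; rewrite num_real.
Unshelve. all: by end_near. Qed.

(** The bound is uniform in [rho] because of a split at $\lambda = L$: below, the conditional
    estimate has an error of order $\beta^{-2}$ depending only on [L]; above, joint exceedances are
    negligible and the integrand is already close to its value at infinity. *)
Theorem gauss_cdf_asymptotic x y (e : R) : 0 < e -> exists2 M : R, 0 < M &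
  forall beta rho n, M <= beta -> beta = n%:R * phi beta -> -1 <= rho <= 1 ->
  `|n%:R * (1 - gauss_cdf rho (beta + x / beta) (beta + y / beta)) -
    limit_integrand x y (lambda_of beta rho)| <= e.
Proof.
move=> e0.
have e4 : 0 < e / 4 by rewrite divr_gt0.
have [L [L1 cL eL hL]] : exists L, [/\ 1 <= L, 0 <= (x + y) / 2 + L ^+ 2 / 2,
    expR (- ((x + y) / 2 + L ^+ 2 / 2)) <= e / 4 &
    forall r, L <= r -> `|limit_integrand x y (ext_real r) - (expR (- x) + expR (- y))| <= e / 4].
  have cv : limit_integrand x y (ext_real r) @[r --> +oo] --> expR (- x) + expR (- y).
    apply: (cvg_comp _ _ cvg_ext_real_oo).
    exact: (@continuous_limit_integrand R x y ext_oo).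
  have /cvgrPdist_le/(_ _ e4)[L0 [_ hL0]] := cv.
  (* [L0] is the threshold beyond which the integrand is near its limit; the other terms let
     [L ^+ 2 / 2] absorb [(x + y) / 2] and the logarithm of [e / 4]. *)
  pose L := 1 + `|L0| + `|x| + `|y| + 2 * `|ln (e / 4)|.
  have nln := normr_ge0 (ln (e / 4)).
  have L1 : 1 <= L by rewrite /L -!addrA lerDl !addr_ge0// mulr_ge0.
  have LL : (x + y) / 2 + L ^+ 2 / 2 >= `|ln (e / 4)|.
    have := ler_norm (- x); have := ler_norm (- y); rewrite !normrN => hy hx.
    have L2 : L <= L ^+ 2 by rewrite expr2; nra.
    have : 2 * `|ln (e / 4)| + `|x| + `|y| <= L by rewrite /L; have := normr_ge0 L0; lra.
    lra.
  exists L; split.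
  - exact: L1.
  - exact: le_trans LL.
  - rewrite -[leRHS]lnK// ler_expR lerNl; apply: le_trans LL.
    by have := ler_norm (- ln (e / 4)); rewrite normrN.
  - move=> r Lr; rewrite distrC; apply: hL0; apply: lt_le_trans Lr.
    rewrite /L; have := ler_norm L0; have := normr_ge0 x; have := normr_ge0 y.
    lra.
pose K := 20 * expR (`|x| - x / 2) + 20 * expR (`|y| - y / 2) +
  (2 * L ^+ 2 + L + 1) * (20 * expR (`|y| - y / 2)).
(* The three terms give [1 <= beta], [2 * L ^+ 2 <= beta ^+ 2] and errors at most [e / 4], using
   [beta <= beta ^+ 2]. *)
pose M := 1 + 2 * L ^+ 2 + 4 * K / e.
have K1 : 0 <= 20 * expR (`|x| - x / 2) by rewrite mulr_ge0 ?expR_ge0.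
have K2 : 0 <= 20 * expR (`|y| - y / 2) by rewrite mulr_ge0 ?expR_ge0.
have L20 := sqr_ge0 L.
have LL : 0 <= 2 * L ^+ 2 + L by lra.
have K3 : 0 <= (2 * L ^+ 2 + L + 1) * (20 * expR (`|y| - y / 2)).
  by apply: mulr_ge0 => //; lra.
have K0 : 0 <= K by rewrite /K; lra.
have KM : 0 <= 4 * K / e by rewrite divr_ge0 ?mulr_ge0// ltW.
exists M; first by rewrite /M; lra.
move=> beta rho n Mb bE rho1.
have b1 : 1 <= beta by rewrite (le_trans _ Mb)// /M; lra.
have b0 : 0 < beta by lra.
have bb2 : beta <= beta ^+ 2 by rewrite expr2; nra.
have b20 : 0 < beta ^+ 2 by rewrite exprn_gt0.
have small k : k <= K -> k / beta ^+ 2 <= e / 4.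
  move=> kK; rewrite ler_pdivrMr//; apply: (le_trans kK).
  have : 4 * K / e <= beta ^+ 2 by rewrite (le_trans _ bb2)// (le_trans _ Mb)// /M; lra.
  by rewrite ler_pdivrMr//; lra.
have P1 := le_trans (tail_Phi_compare x b0 bE) (small _ _).
have {}P1 := P1 (ltac:(rewrite /K; lra)).
have P2' := le_trans (tail_Phi_compare y b0 bE) (small _ _).
have {}P2' := P2' (ltac:(rewrite /K; lra)).
rewrite (gauss_cdf_tail _ _ rho1) mulrDr.
have /orP[lL|Ll] := le_total (Num.sqrt (beta ^+ 2 * (1 - rho) / 2)) L.
- have bL : 2 * L ^+ 2 <= beta ^+ 2 by rewrite (le_trans _ bb2)// (le_trans _ Mb)// /M; lra.
  have c01 s := cond01 rho (beta + x / beta) (beta + s / beta).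
  have d01 s : 0 <= limit_slope (x - s) (lambda_of beta rho) <= 1.
    by rewrite limit_slope_ge0 limit_slope_le1.
  have mc : measurable_fun setT (fun s => cond rho (beta + x / beta) (beta + s / beta)).
    apply: measurableT_comp; first exact: measurable_cond.
    by apply: measurable_funD => //; exact: mulrr_measurable.
  have md : measurable_fun setT (fun s => limit_slope (x - s) (lambda_of beta rho)).
    rewrite (_ : (fun s => _) = (fun p => limit_slope p.1 p.2) \o (fun s => (x - s, lambda_of beta rho)))//.
    apply: measurableT_comp; first exact: measurable_limit_slope.
    by apply: measurable_fun_pair => //; exact: measurable_funB.
  have := @tail_density_compare (2 * L ^+ 2 + L) beta y _ _ b0 LL mc md c01 d01
    (fun s => cond_compare x s rho1 b0 lL bL).
  rewrite -(joint_tail_scaled _ _ _ b0 bE).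
  rewrite [X in `|_ - X|](_ : _ = limit_integrand x y (lambda_of beta rho) - expR (- x)); last first.
    by rewrite /Rintegral limit_integrand_integral.
  move=> /le_trans/(_ (small _ _)) => /(_ (ltac:(rewrite /K; lra))) P3.
  rewrite (_ : _ - _ = (n%:R * (1 - Phi (beta + x / beta)) - expR (- x)) +
    (n%:R * joint_tail rho (beta + x / beta) (beta + y / beta) -
     (limit_integrand x y (lambda_of beta rho) - expR (- x)))); last by ring.
  by apply: (le_trans (ler_normD _ _)); lra.
- rewrite joint_tailE (mulrBr _ (1 - Phi _)).
  have := both_tail rho1 b0 bE (le_trans ler01 L1) Ll cL.
  have := hL _ Ll; rewrite -lambda_ofE.
  set bt := n%:R * fine _ => hh hbt.
  have bt0 : 0 <= bt by rewrite mulr_ge0// fine_ge0.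
  rewrite (_ : _ - limit_integrand _ _ _ = (n%:R * (1 - Phi (beta + x / beta)) - expR (- x)) +
    (n%:R * (1 - Phi (beta + y / beta)) - expR (- y)) -
    (limit_integrand x y (lambda_of beta rho) - (expR (- x) + expR (- y))) - bt); last by ring.
  apply: (le_trans (ler_normB _ _)); rewrite (ger0_norm bt0).
  apply: (le_trans (lerD (ler_normB _ _) hbt)).
  by have := ler_normD (n%:R * (1 - Phi (beta + x / beta)) - expR (- x))
    (n%:R * (1 - Phi (beta + y / beta)) - expR (- y)); lra.
Qed.
End normalized_tail.

(** * Growth of the normalizing sequence *)

Section normalizing_sequence.
Context {R : realType}.
Local Notation phi := (normal_pdf (0:R) 1).
Variable b : nat -> R.
Hypothesis hb : forall n, (0 < n)%N -> b n = n%:R * phi (b n).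

Lemma normalizing_gt0 n : (0 < n)%N -> 0 < b n.
Proof. by move=> n0; rewrite hb// mulr_gt0 ?ltr0n// phi_gt0. Qed.

Lemma normalizing_ln n : (0 < n)%N ->
  ln (b n) + b n ^+ 2 / 2 = ln n%:R + ln (normal_peak 1).
Proof.
move=> n0; have b0 := normalizing_gt0 n0; rewrite {1}(hb n0).
have p0 : 0 < normal_peak (1 : R) by exact: normal_peak_gt0.
rewrite std_pdfE !lnM ?posrE ?mulr_gt0 ?ltr0n ?expR_gt0// expRK; lra.
Qed.

Lemma normalizing_cvg : b n.+1 @[n --> \oo] --> +oo.
Proof.
apply/cvgryPge => A; near=> n; rewrite leNgt; apply/negP => bA.
have b0 := normalizing_gt0 (ltn0Sn n).
have A0 : 0 < A by exact: lt_trans bA.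
have : n.+1%:R * phi A <= A.
  apply: le_trans (ltW bA); rewrite [leRHS](hb (ltn0Sn n)) ler_wpM2l//.
  rewrite !std_pdfE ler_wpM2l ?normal_peak_ge0// ler_expR lerN2 ler_pM2r//.
  by rewrite lerXn2r ?nnegrE ?(ltW b0) ?(ltW A0) ?(ltW bA).
rewrite -ler_pdivlMr ?phi_gt0// leNgt => /negP; apply.
apply: (@lt_trans _ _ n%:R); last by rewrite ltr_nat.
by near: n; exact: nbhs_infty_gtr.
Unshelve. all: by end_near. Qed.

Lemma normalizing_homo m n : (0 < m)%N -> (m <= n)%N -> b m <= b n.
Proof.
move=> m0 mn; have n0 := leq_trans m0 mn.
have bm := normalizing_gt0 m0; have bn := normalizing_gt0 n0.
rewrite leNgt; apply/negP => nm.
have := normalizing_ln m0; have := normalizing_ln n0.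
have : ln (b n) <= ln (b m) by rewrite ler_ln ?posrE// ltW.
have : ln (m%:R : R) <= ln n%:R by rewrite ler_ln ?posrE ?ltr0n// ler_nat.
nra.
Qed.

(** By [normalizing_ln] and monotonicity, $(b_n^2 - b_m^2)/2 \le \ln n - \ln m$, and the left side
    is at least $(b_n - b_m) b_m$. Hence the ratio tends to 1 as long as $n/m$ stays bounded. *)
Lemma normalizing_ratio m n : (0 < m)%N -> (m <= n)%N ->
  b n / b m - 1 <= (ln n%:R - ln m%:R) / b m ^+ 2.
Proof.
move=> m0 mn; have n0 := leq_trans m0 mn.
have bm := normalizing_gt0 m0; have bn := normalizing_gt0 n0.
have bmn := normalizing_homo m0 mn.
rewrite ler_pdivlMr ?exprn_gt0// (_ : (_ - 1) * _ = (b n - b m) * b m); last first.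
  by field; rewrite gt_eqF.
have := normalizing_ln m0; have := normalizing_ln n0.
have : ln (b m) <= ln (b n) by rewrite ler_ln ?posrE.
nra.
Qed.

End normalizing_sequence.

(** * The distribution function of the maximum *)

Section product_estimates.
Context {R : realType}.

Lemma prod_dist_le (a c : nat -> R) N : (forall i, 0 <= a i <= 1) ->
  (forall i, 0 <= c i <= 1) ->
  `|\prod_(i < N) a i - \prod_(i < N) c i| <= \sum_(i < N) `|a i - c i|.
Proof.
move=> a01 c01; elim: N => [|N ih]; first by rewrite !big_ord0 subrr normr0.
rewrite !big_ord_recr/=.
have A01 : 0 <= \prod_(i < N) a i <= 1.
  by apply/andP; split; [apply: prodr_ge0 => i _|apply: prodr_ile1 => i _]; have /andP[] := a01 i; auto.
have /andP[A0 A1] := A01; have /andP[c0 c1] := c01 N.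
rewrite (_ : _ - _ = (\prod_(i < N) a i) * (a N - c N) +
  (\prod_(i < N) a i - \prod_(i < N) c i) * c N); last by ring.
apply: (le_trans (ler_normD _ _)); rewrite !normrM (ger0_norm A0) (ger0_norm c0).
rewrite [leRHS]addrC; apply: lerD; first by rewrite ler_piMl.
by apply: le_trans ih; rewrite ler_piMr.
Qed.

Lemma expRN_quad (p : R) : 0 <= p -> `|1 - p - expR (- p)| <= p ^+ 2.
Proof.
move=> p0; have h1 := expR_ge1Dx (- p); have h2 := expR_ge1Dx p.
have e0 := expR_gt0 (- p).
have : expR (- p) * expR p = 1 by rewrite -expRD addNr expR0.
rewrite distrC ger0_norm; last lra.
move=> E; have : expR (- p) * (1 + p) <= 1 by rewrite -[leRHS]E ler_pM2l.
have := sqr_ge0 p; nra.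
Qed.

Lemma expRN_lip (p q : R) : 0 <= p -> 0 <= q -> `|expR (- p) - expR (- q)| <= `|p - q|.
Proof.
wlog pq : p q / p <= q => [H p0 q0|p0 q0].
  have /orP[pq|pq] := le_total p q; first exact: H.
  by rewrite distrC [leRHS]distrC; exact: H.
rewrite distrC [leRHS]distrC [leRHS]ger0_norm ?subr_ge0// distrC ger0_norm; last first.
  by rewrite subr_ge0 ler_expR lerN2.
have := expR_ge1Dx (p - q).
have : expR (- q) = expR (- p) * expR (p - q) by rewrite -expRD; congr expR; ring.
have : expR (- p) <= 1 by rewrite expR_le1 oppr_le0.
have := expR_gt0 (- p); move=> ? ? -> ?.
rewrite -[leLHS](_ : expR (- p) * (1 - expR (p - q)) = _); last by ring.
have : expR (p - q) <= 1 by rewrite expR_le1 subr_le0.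
nra.
Qed.

End product_estimates.

(** Integrals against multiples and sums of measures are computed for nonnegative functions; adding
    a bound [M] of the function reduces to that case. *)
Lemma Rintegral_empirical {R : realType} (beta : R) rho n (f : ext_nneg R -> R) : bmeas f ->
  \int[empirical beta rho n]_l f l = n.+1%:R^-1 * \sum_(i < n.+1) f (lambda_of beta (rho i)).
Proof.
have ge0 g : bmeas g -> (forall l, 0 <= g l) ->
    \int[empirical beta rho n]_l g l = n.+1%:R^-1 * \sum_(i < n.+1) g (lambda_of beta (rho i)).
  move=> [mg _] g0; rewrite /Rintegral.
  have mg' : measurable_fun setT (EFin \o g) by exact/measurable_EFinP.
  have -> : (\int[empirical beta rho n]_l (g l)%:E =
      (n.+1%:R^-1)%:E * \sum_(i < n.+1) (g (lambda_of beta (rho i)))%:E)%E.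
    rewrite ge0_integral_mscale//=; last by move=> l _; rewrite lee_fin.
    rewrite ge0_integral_measure_sum//=; last by move=> l _; rewrite lee_fin.
    congr (_ * _)%E; apply: eq_bigr => i _.
    by rewrite integral_dirac//= diracT mul1e.
  by rewrite sumEFin.
move=> bf; have [_ [M fM]] := bf.
have bfM : bmeas (fun l => f l + M) by apply: bmeasD => //; exact: bmeas_cst.
have := ge0 _ bfM _; rewrite bmeas_RintegralD//; last exact: bmeas_cst.
rewrite Rintegral_prob_cst big_split/= sumr_const card_ord mulrDr -[M *+ _]mulr_natl mulKf ?pnatr_eq0//.
move=> H; apply: (addIr M); apply: H => l.
by have := fM l; rewrite ler_norml => /andP[]; lra.
Qed.

Section maximum_cdf.
Context d (T : measurableType d) (R : realType) (P : probability T R).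
Variables (b : nat -> R) (X : nat -> {RV P >-> (R * R)%type}) (rho : nat -> R).
Hypothesis hb : forall n, (0 < n)%N -> b n = n%:R * normal_pdf 0 1 (b n).
Hypothesis indX : independent P X.
Hypothesis gaussX : forall i, std_gaussian_vector P (rho i) (X i).

Lemma max_upto_le (u : nat -> R) n (t : R) :
  (max_upto u n <= t) <-> forall i, (i < n.+1)%N -> u i <= t.
Proof.
split=> [/bigmax_leP[_ H] i ni|H]; first exact: (H (Ordinal ni)).
by apply/bigmax_leP; split=> [|i _]; exact: H.
Qed.

Lemma correlation_bounds i : -1 <= rho i <= 1.
Proof.
by have [] := std_gaussian_linear_law (measurable_funPT (X i)) (gaussX i).
Qed.

Lemma normalized_max_cdf (beta x y : R) n : 0 < beta ->
  distribution P (normalized_max beta X n) (`]-oo, x] `*` `]-oo, y]) =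
  (\prod_(i < n.+1) gauss_cdf (rho i) (beta + x / beta) (beta + y / beta))%:E.
Proof.
move=> b0; pose J : {fset nat} := [fset i in iota 0 n.+1]%fset.
pose A : set (R * R) := `]-oo, beta + x / beta] `*` `]-oo, beta + y / beta].
have mA : measurable A by exact: measurableX.
have Jp : perm_eq J (iota 0 n.+1).
  by apply: uniq_perm; rewrite ?fset_uniq ?iota_uniq// => i; rewrite !inE.
have memJ i : (i \in J) = (i < n.+1)%N by rewrite (perm_mem Jp) mem_iota add0n.
have -> : distribution P (normalized_max beta X n) (`]-oo, x] `*` `]-oo, y]) =
    P (\bigcap_(i in [set` J]) (X i @^-1` A)).
  rewrite /distribution /pushforward/=; congr (P _); apply/seteqP; split => t/=.
    rewrite !in_itv/= => -[/max_upto_le H1 /max_upto_le H2] i/=; rewrite memJ => ni.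
    move: (H1 _ ni) (H2 _ ni); rewrite /A/= !in_itv/= -!lerBlDl !ler_pdivlMr// !(mulrC beta).
    by [].
  move=> H; rewrite !in_itv/=; split; apply/max_upto_le => i ni; have := H i;
    rewrite /= memJ => /(_ ni); rewrite /A/= !in_itv/= -!lerBlDl !ler_pdivlMr// !(mulrC beta).
    by case.
  by case.
rewrite (indX J (fun=> mA)) (perm_big _ Jp).
rewrite -[iota 0 n.+1]/(index_iota 0 n.+1) big_mkord -prodEFin.
apply: eq_bigr => i _.
rewrite (std_gaussian_quadrant _ _ (measurable_funPT (X i)) (gaussX i)) /gauss_cdf fineK//.
apply: (probability_fin_num (_ \x _)%E).
exact: measurable_preimage (measurable_gauss_pair _) _.
Qed.

(** Poisson approximation: each factor [q i] is replaced by [expR (- (1 - q i))]. As [N * (1 - q i)]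
    is bounded, this costs $O(N^{-2})$ per factor, and the exponent obtained is within [e'] of the
    empirical mean. *)
Theorem maximum_cdf_asymptotic (x y : R) :
  fine (distribution P (normalized_max (b n.+1) X n) (`]-oo, x] `*` `]-oo, y])) -
  expR (- \int[empirical (b n.+1) rho n]_l limit_integrand x y l) @[n --> \oo] --> (0:R).
Proof.
apply/cvgrPdist_le => e e0.
pose e' := Num.min 1 (e / 2).
have e'0 : 0 < e' by rewrite lt_min ltr01 divr_gt0.
have e'1 : e' <= 1 by rewrite ge_min lexx.
have e'e : e' <= e / 2 by rewrite ge_min lexx orbT.
have [M M0 HM] := gauss_cdf_asymptotic x y e'0.
(* [C] bounds every [N * (1 - q i)]: the integrand is at most the sum of the two exponentials, and
   [e'] is at most 1. *)
pose C := expR (- x) + expR (- y) + 1.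
near=> n; rewrite sub0r normrN.
have b0 := normalizing_gt0 hb (ltn0Sn n).
have Mb : M <= b n.+1 by near: n; exact: (cvgryPge _).1 (normalizing_cvg hb) M.
rewrite normalized_max_cdf//= Rintegral_empirical; last exact: bmeas_limit_integrand.
pose q i := gauss_cdf (rho i) (b n.+1 + x / b n.+1) (b n.+1 + y / b n.+1).
pose h i := limit_integrand x y (lambda_of (b n.+1) (rho i)).
pose N : R := n.+1%:R.
have N0 : 0 < N by rewrite ltr0n.
have nq i : `|N * (1 - q i) - h i| <= e'.
  by apply: HM => //; [exact: hb|exact: correlation_bounds].
have q01 i : 0 <= q i <= 1.
  have mA : measurable (gauss_pair (rho i) @^-1` (`]-oo, b n.+1 + x / b n.+1] `*` `]-oo, b n.+1 + y / b n.+1])).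
    by apply: measurable_preimage; [exact: measurable_gauss_pair|exact: measurableX].
  rewrite /q /gauss_cdf fine_ge0//= -[leRHS]/(fine 1%E) fine_le//.
    exact: (probability_fin_num (_ \x _)%E).
  exact: (probability_le1 (_ \x _)%E).
have hC i : h i <= expR (- x) + expR (- y) by exact: limit_integrand_le.
have h0 i : 0 <= h i by exact: limit_integrand_ge0.
have pC i : N * (1 - q i) <= C.
  by have := nq i; rewrite ler_norml => /andP[_]; have := hC i; rewrite /C; lra.
have C0 : 0 <= C by rewrite /C !addr_ge0 ?expR_ge0.
have p0 i : 0 <= 1 - q i by have /andP[] := q01 i; lra.
have sumE : \prod_(i < n.+1) expR (- (1 - q i)) = expR (- \sum_(i < n.+1) (1 - q i)).
  by rewrite -sumrN expR_sum.
rewrite -[X in `|_ - expR X|](_ : - (N^-1 * \sum_(i < n.+1) h i) = _)//.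
apply: (le_trans (ler_distD (\prod_(i < n.+1) expR (- (1 - q i))) _ _)).
have -> : e = e / 2 + e / 2 by lra.
apply: lerD.
- apply: (le_trans (@prod_dist_le _ q (fun i => expR (- (1 - q i))) _ q01 _)).
    by move=> i; rewrite expR_ge0 expR_le1 oppr_le0 p0.
  apply: (@le_trans _ _ (\sum_(i < n.+1) (C / N) ^+ 2)).
    apply: ler_sum => i _; rewrite (_ : q i = 1 - (1 - q i)); last by ring.
    rewrite (_ : expR (- (1 - (1 - (1 - q i)))) = expR (- (1 - q i))); last by congr expR; ring.
    apply: (le_trans (expRN_quad (p0 i))).
    by rewrite lerXn2r ?nnegrE ?divr_ge0 ?p0 ?(ltW N0)// ler_pdivlMr// mulrC.
  rewrite sumr_const card_ord -[_ *+ n.+1]mulr_natl -/N.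
  rewrite (_ : N * _ = C ^+ 2 / N); last by field; rewrite gt_eqF.
  rewrite ler_pdivrMr// mulrC -ler_pdivrMr ?divr_gt0//.
  apply: (@le_trans _ _ n%:R); last by rewrite ler_nat.
  by near: n; exact: nbhs_infty_ger.
- rewrite sumE; apply: le_trans e'e; apply: (le_trans (expRN_lip _ _)).
  + by apply: sumr_ge0 => i _.
  + by rewrite mulr_ge0 ?invr_ge0 ?(ltW N0)// sumr_ge0.
  rewrite (_ : _ - _ = N^-1 * \sum_(i < n.+1) (N * (1 - q i) - h i)); last first.
    by rewrite [in RHS]sumrB mulrBr -mulr_sumr mulrA mulVf ?mul1r// gt_eqF.
  rewrite normrM (ger0_norm (_ : 0 <= N^-1)) ?invr_ge0 ?(ltW N0)//.
  rewrite mulrC ler_pdivrMr//; apply: (le_trans (ler_norm_sum _ _ _)).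
  apply: (@le_trans _ _ (\sum_(i < n.+1) e')); first by apply: ler_sum => i _; exact: nq.
  by rewrite sumr_const card_ord -mulr_natr.
Unshelve. all: by end_near. Qed.

End maximum_cdf.

(** * Weak convergence on the plane *)

Section step_functions.
Context {R : realType}.
Implicit Types (a c : nat -> R) (t : R).

Definition itv_step (s s' t : R) : R := (t <= s')%R%:R - (t <= s)%R%:R.

Lemma itv_step01 s s' t : s <= s' -> itv_step s s' t = (s < t <= s')%R%:R.
Proof.
move=> ss'; rewrite /itv_step; have [ts|st] := leP t s; last by rewrite subr0.
by rewrite (le_trans ts ss') subrr.
Qed.

Lemma step_sum_out a c m t : {homo a : i j / (i <= j)%N >-> i <= j} ->
  (t <= a 0%N) || (a m < t) -> \sum_(i < m) c i * itv_step (a i) (a i.+1) t = 0.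
Proof.
move=> ha tout; apply: big1 => i _; rewrite itv_step01 ?ha//.
case/orP: tout => tout.
  have ta : t <= a i by apply: le_trans tout _; exact: ha.
  by rewrite [a i < t]ltNge ta mulr0.
have ta : a i.+1 < t by apply: le_lt_trans tout; exact: ha.
by rewrite [t <= _]leNgt ta andbF mulr0.
Qed.

Lemma step_sum_in a m t : {homo a : i j / (i <= j)%N >-> i <= j} ->
  a 0%N < t <= a m -> exists i : nat, [/\ (i < m)%N, a i < t <= a i.+1 &
    forall c, \sum_(i < m) c i * itv_step (a i) (a i.+1) t = c i].
Proof.
move=> ha; elim: m => [|m ih] /andP[a0t tam]; first by move: tam; rewrite leNgt a0t.
have [tm|mt] := leP t (a m).
  have [|i [im ait sum]] := ih; first by rewrite a0t tm.
  exists i; split => //; first exact: ltnW.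
  move=> c; rewrite big_ord_recr/= sum itv_step01 ?ha//.
  by rewrite ltNge tm mulr0 addr0.
exists m; split => //; first by rewrite mt tam.
move=> c; rewrite big_ord_recr/= step_sum_out ?mt ?orbT// add0r.
by rewrite itv_step01 ?ha// mt tam mulr1.
Qed.

End step_functions.

Section weak_closure.
Context d (T : measurableType d) (R : realType).
Variables (mu_ : nat -> probability T R) (mu : probability T R).
Implicit Types (f g : T -> R).

Definition cvg_integral f := bmeas f /\ \int[mu_ n]_t f t @[n --> \oo] --> \int[mu]_t f t.

Lemma cvg_integral_cst (r : R) : cvg_integral (fun=> r).
Proof.
split; first exact: bmeas_cst.
rewrite Rintegral_prob_cst (_ : (fun n => _) = fun=> r); first exact: cvg_cst.
by apply/funext => n; rewrite Rintegral_prob_cst.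
Qed.

Lemma cvg_integralD f g : cvg_integral f -> cvg_integral g ->
  cvg_integral (fun t => f t + g t).
Proof.
move=> [bf cf] [bg cg]; split; first exact: bmeasD.
rewrite bmeas_RintegralD// (_ : (fun n => _) =
  fun n => \int[mu_ n]_t f t + \int[mu_ n]_t g t); first exact: cvgD.
by apply/funext => n; rewrite bmeas_RintegralD.
Qed.

Lemma cvg_integralZ (r : R) f : cvg_integral f -> cvg_integral (fun t => r * f t).
Proof.
move=> [bf cf]; split; first exact: bmeasZ.
rewrite bmeas_RintegralZ// (_ : (fun n => _) = fun n => r * \int[mu_ n]_t f t).
  by apply: cvgMr.
by apply/funext => n; rewrite bmeas_RintegralZ.
Qed.

Lemma cvg_integralB f g : cvg_integral f -> cvg_integral g ->
  cvg_integral (fun t => f t - g t).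
Proof.
move=> cf cg; rewrite (_ : (fun t => _) = (fun t => f t + (-1) * g t)).
  by apply: cvg_integralD => //; exact: cvg_integralZ.
by apply/funext => t; rewrite mulN1r.
Qed.

Lemma cvg_integral_sum I (r : seq I) (F : I -> T -> R) :
  (forall i, cvg_integral (F i)) -> cvg_integral (fun t => \sum_(i <- r) F i t).
Proof.
move=> cF; elim: r => [|i r ih].
  by under eq_fun do rewrite big_nil; exact: cvg_integral_cst.
by under eq_fun do rewrite big_cons; exact: cvg_integralD.
Qed.

(** The error bound [h] belongs to the class itself: its integral is assumed small under the limit
    only, and convergence transfers this to [mu_ n]. Tightness thus needs no separate argument. *)
Lemma cvg_integral_approx f : bmeas f ->
  (forall e : R, 0 < e -> exists g h, [/\ cvg_integral g, cvg_integral h,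
    forall t, `|f t - g t| <= h t & \int[mu]_t h t <= e]) ->
  cvg_integral f.
Proof.
move=> bf H; split => //; apply/cvgrPdist_le => e e0.
have e4 : 0 < e / 4 by rewrite divr_gt0.
have [g [h [[bg cg] [bh ch] fgh he]]] := H _ e4.
have /cvgrPdist_le/(_ _ e4) Hg := cg.
have /cvgrPdist_le/(_ _ e4) Hh := ch.
near=> n.
have hg : `|\int[mu]_t g t - \int[mu_ n]_t g t| <= e / 4 by near: n.
have hh : `|\int[mu]_t h t - \int[mu_ n]_t h t| <= e / 4 by near: n.
have h1 := bmeas_Rintegral_dist_le mu bf bg bh fgh.
have h2 := bmeas_Rintegral_dist_le (mu_ n) bf bg bh fgh.
move: hg hh h1 h2; rewrite !ler_norml.
move=> /andP[? ?] /andP[? ?] /andP[? ?] /andP[? ?]; apply/andP; split; lra.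
Unshelve. all: by end_near. Qed.

End weak_closure.

Section plane.
Context {R : realType}.
Implicit Types (f : R * R -> R) (mu : probability (R * R)%type R).

(** The product sigma-algebra contains the open sets because every open set is a countable union of
    boxes with rational centres and radii [k.+1%:R^-1]. *)
Lemma open_measurable_plane (U : set (R * R)) : open U -> measurable U.
Proof.
move=> oU.
pose box (p : rat * rat * nat) : set (R * R) :=
  `](ratr p.1.1 - p.2.+1%:R^-1), (ratr p.1.1 + p.2.+1%:R^-1)[%classic `*`
  `](ratr p.1.2 - p.2.+1%:R^-1), (ratr p.1.2 + p.2.+1%:R^-1)[%classic.
pose F p := if `[< box p `<=` U >] then box p else set0.
rewrite (_ : U = \bigcup_p F p).
  apply: countable_bigcupT_measurable; first exact: countableP.
  by move=> p; rewrite /F; case: asboolP => _ //; apply: measurableX; exact: measurable_itv.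
apply/seteqP; split => [z Uz|z [p _]]; last first.
  by rewrite /F; case: asboolP => // pU; exact: pU.
have /nbhs_ballP[e /= e0 eU] := open_nbhs_nbhs (conj oU Uz).
have e2 : 0 < e / 2 by rewrite divr_gt0.
near \oo => k.
have k0 : 0 < k.+1%:R^-1 :> R by [].
have ke : k.+1%:R^-1 < e / 2.
  by near: k; exact: (near_infty_natSinv_lt (PosNum e2)).
have zk (t : R) : t - k.+1%:R^-1 < t + k.+1%:R^-1 by rewrite ltrD2l gtrN.
have [q1 q1z] := rat_in_itvoo (zk z.1).
have [q2 q2z] := rat_in_itvoo (zk z.2).
exists (q1, q2, k) => //; rewrite /F asboolT/=.
  rewrite /box/= !in_itv/=; move: q1z q2z; rewrite !in_itv/=.
  move: k.+1%:R^-1 => dl /andP[? ?] /andP[? ?].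
  by split; apply/andP; split; lra.
move=> w; rewrite /box/= !in_itv/= => bw; apply: eU.
move: bw q1z q2z ke; rewrite !in_itv/=; move: k.+1%:R^-1 => dl.
move=> [/andP[? ?] /andP[? ?]] /andP[? ?] /andP[? ?] ?.
by split; rewrite /ball/= ltr_norml; apply/andP; split; lra.
Unshelve. all: by end_near. Qed.

Lemma continuous_measurable_plane f : continuous f -> measurable_fun setT f.
Proof.
move=> cf; apply: (measurability _ (RGenOInfty.measurableE R)) => _ [_ [x ->] <-].
rewrite setTI; apply: open_measurable_plane.
by apply: open_comp => //; exact: open_gt.
Qed.

Lemma bmeas_plane f : @bounded_continuous R (R * R)%type f -> bmeas f.
Proof.
move=> [cf [M [_ fM]]]; split; first exact: continuous_measurable_plane.
by exists (M + 1) => l; apply: fM => //; rewrite ltrDl.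
Qed.

Definition quadrant (x y : R) : set (R * R) := `]-oo, x] `*` `]-oo, y].

Lemma measurable_quadrant x y : measurable (quadrant x y).
Proof. by apply: measurableX. Qed.

Lemma indic_quadrant x y (z : R * R) :
  \1_(quadrant x y) z = (z.1 <= x)%R%:R * (z.2 <= y)%R%:R :> R.
Proof.
rewrite indicE -natrM mulnb; congr (_%:R : R); congr (nat_of_bool _).
apply/idP/idP; rewrite inE /quadrant/= !in_itv/= => H; first by case: H => -> ->.
by case/andP: H.
Qed.

(** The second hypothesis, a one-sided asymptotic equicontinuity of the distribution functions,
    stands in for the usual condition that the boundary of the quadrant be null for [mu], of which
    nothing is known where this is applied. *)
Lemma weak_cvg_quadrant (mu_ : nat -> probability (R * R)%type R) mu (x y : R) :
  weak_cvg (@bounded_continuous R (R * R)%type) mu_ mu ->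
  (forall e : R, 0 < e -> exists2 D : R, 0 < D & \forall n \near \oo,
    fine (mu_ n (quadrant (x + D) (y + D))) - fine (mu_ n (quadrant x y)) <= e) ->
  fine (mu_ n (quadrant x y)) @[n --> \oo] --> fine (mu (quadrant x y)).
Proof.
move=> wcv gap; apply/cvgrPdist_le => e e0.
have e4 : 0 < e / 4 by rewrite divr_gt0.
have [D D0 HD] := gap _ e4.
pose g (k : nat) (z : R * R) := ramp k%:R x z.1 * ramp k%:R y z.2.
have cg k : continuous (g k).
  move=> z; apply: cvgM.
    by apply: (@cvg_comp _ _ _ fst); [exact: cvg_fst|exact: ramp_continuous].
  by apply: (@cvg_comp _ _ _ snd); [exact: cvg_snd|exact: ramp_continuous].
have g0 k z : 0 <= g k z by rewrite mulr_ge0 ?ramp_ge0.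
have g1 k z : g k z <= 1 by rewrite mulr_ile1 ?ramp_ge0 ?ramp_le1.
have bg k : @bounded_continuous R (R * R)%type (g k).
  split; first exact: cg.
  exists 1; split; first by rewrite num_real.
  by move=> M M1 z _ /=; rewrite ger0_norm// (le_trans (g1 k z))// ltW.
have gcv : \int[mu]_z g k z @[k --> \oo] --> \int[mu]_z \1_(quadrant x y) z.
  apply: (@bounded_cvg_Rintegral _ _ _ _ _ _ 1) => [k|k z|z].
  - by have [] := bmeas_plane (bg k).
  - by rewrite ger0_norm.
  - have -> : \1_(quadrant x y) z = \1_`]-oo, x] z.1 * \1_`]-oo, y] z.2 :> R.
      by rewrite indic_quadrant !indicE !mem_setE !in_itv.
    by apply: cvgM; exact: ramp_cvg.
rewrite Rintegral_prob_indic in gcv; last exact: measurable_quadrant.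
have /cvgrPdist_le/(_ _ e4) gcv' := gcv.
(* With slope at least [D^-1] the product of ramps lies between the indicators of the quadrants at
   [(x, y)] and at [(x + D, y + D)]. *)
have [k [kD hk]] : exists k : nat, D^-1 <= k%:R /\
    `|fine (mu (quadrant x y)) - \int[mu]_z g k z| <= e / 4.
  near \oo => k; exists k; split; last by near: k.
  by near: k; exact: nbhs_infty_ger.
have kD1 : 1 <= k%:R * D by rewrite -ler_pdivrMr// mul1r.
have bq a c : bmeas (\1_(quadrant a c) : R * R -> R) by apply: bmeas_indic; exact: measurable_quadrant.
have lo z : \1_(quadrant x y) z <= g k z.
  rewrite indic_quadrant; case: (leP z.1) => zx; case: (leP z.2) => zy; rewrite ?mulr0 ?mul0r//.
  by rewrite /g !ramp_eq1// mulr1.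
have up z : g k z <= \1_(quadrant (x + D) (y + D)) z.
  rewrite indic_quadrant; case: (leP z.1) => zx; case: (leP z.2) => zy; rewrite ?mulr0 ?mul0r ?mulr1//.
  - rewrite /g [X in _ * X]ramp_eq0 ?mulr0// (le_trans kD1)// ler_wpM2l// lerBrDl ltW//.
  - rewrite /g ramp_eq0 ?mul0r// (le_trans kD1)// ler_wpM2l// lerBrDl ltW//.
  - rewrite /g ramp_eq0 ?mul0r// (le_trans kD1)// ler_wpM2l// lerBrDl ltW//.
have /cvgrPdist_le/(_ _ e4) H := wcv _ (bg k).
near=> n.
have hn : `|\int[mu]_z g k z - \int[mu_ n]_z g k z| <= e / 4 by near: n.
have hD : fine (mu_ n (quadrant (x + D) (y + D))) - fine (mu_ n (quadrant x y)) <= e / 4 by near: n.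
have := le_bmeas_Rintegral (mu_ n) (bq _ _) (bmeas_plane (bg k)) lo.
have := le_bmeas_Rintegral (mu_ n) (bmeas_plane (bg k)) (bq _ _) up.
rewrite !Rintegral_prob_indic; [|exact: measurable_quadrant..].
move: hk hn; rewrite !ler_norml => /andP[? ?] /andP[? ?] ? ?.
by apply/andP; split; lra.
Unshelve. all: by end_near. Qed.

Lemma quadrant_weak_cvg (mu_ : nat -> probability (R * R)%type R) mu :
  (forall x y, fine (mu_ n (quadrant x y)) @[n --> \oo] --> fine (mu (quadrant x y))) ->
  weak_cvg (@bounded_continuous R (R * R)%type) mu_ mu.
Proof.
move=> qcv f bcf; have bf := bmeas_plane bcf; have [cf _] := bcf.
suff : cvg_integral mu_ mu f by case.
have Vq x y : cvg_integral mu_ mu (fun z : R * R => (z.1 <= x)%R%:R * (z.2 <= y)%R%:R).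
  rewrite (_ : (fun z => _) = \1_(quadrant x y)); last by apply/funext => z; rewrite indic_quadrant.
  split; first by apply: bmeas_indic; exact: measurable_quadrant.
  rewrite Rintegral_prob_indic; last exact: measurable_quadrant.
  rewrite (_ : (fun n => _) = fun n => fine (mu_ n (quadrant x y))); first exact: qcv.
  by apply/funext => n; rewrite Rintegral_prob_indic//; exact: measurable_quadrant.
pose cell s s' t t' (z : R * R) := itv_step s s' z.1 * itv_step t t' z.2.
have Vcell s s' t t' : cvg_integral mu_ mu (cell s s' t t').
  rewrite (_ : cell _ _ _ _ = fun z => ((z.1 <= s')%R%:R * (z.2 <= t')%R%:R -
    (z.1 <= s')%R%:R * (z.2 <= t)%R%:R) - ((z.1 <= s)%R%:R * (z.2 <= t')%R%:R -
    (z.1 <= s)%R%:R * (z.2 <= t)%R%:R)); last first.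
    by apply/funext => z; rewrite /cell /itv_step; ring.
  by apply: cvg_integralB; apply: cvg_integralB; exact: Vq.
apply: cvg_integral_approx => // e e0.
have [_ [B fB]] := bf.
have B0 : 0 <= B by exact: le_trans (fB point).
pose chi (k : R) := cell (- k) k (- k) k.
have chi01 k z : 0 <= k -> chi k z = ((- k < z.1 <= k) && (- k < z.2 <= k))%R%:R.
  by move=> k0; rewrite /chi /cell !itv_step01 ?ge0_cp// -natrM mulnb.
have [k [k0 hk]] : exists k : R, 0 < k /\ 1 - \int[mu]_z chi k z <= e / 2 / (B + 1).
  have cv : \int[mu]_z chi n%:R z @[n --> \oo] --> \int[mu]_z 1.
    apply: (@bounded_cvg_Rintegral _ _ _ _ _ _ 1) => [n|n z|z].
    - by have [[]] := Vcell (- n%:R) n%:R (- n%:R) n%:R.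
    - by rewrite chi01//; case: (_ && _); rewrite ?normr1 ?normr0.
    - apply: cvg_near_cst; near=> n; rewrite chi01//.
      have nz1 : `|z.1| < n%:R by near: n; exact: nbhs_infty_gtr.
      have nz2 : `|z.2| < n%:R by near: n; exact: nbhs_infty_gtr.
      move: nz1 nz2; rewrite !ltr_norml => /andP[-> /ltW ->] /andP[-> /ltW ->].
      by [].
  rewrite Rintegral_prob_cst in cv.
  have e' : 0 < e / 2 / (B + 1) by rewrite !divr_gt0// ltr_wpDl.
  have /cvgrPdist_le/(_ _ e') cv' := cv.
  near \oo => n; exists n%:R; split; first by near: n; exact: nbhs_infty_gtr.
  have : `|1 - \int[mu]_z chi n%:R z| <= e / 2 / (B + 1) by near: n.
  exact: le_trans (ler_norm _).
have e2 : 0 < e / 2 by rewrite divr_gt0.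
pose K : set (R * R) := `[- k, k]%classic `*` `[- k, k]%classic.
have cK : compact K by apply: compact_setX; exact: segment_compact.
have [r r0 fr] := compact_unif_dist cK cf e2.
pose m := (Num.truncn (2 * k / r)).+1.
have m0 : 0 < m%:R :> R by [].
have mr : 2 * k / m%:R < r.
  by rewrite ltr_pdivrMr// [r * _]mulrC -ltr_pdivrMr// /m; exact: truncnS_gt.
pose a (i : nat) := - k + i%:R * (2 * k / m%:R).
have ha : {homo a : i j / (i <= j)%N >-> i <= j}.
  by move=> i j ij; rewrite lerD2l ler_wpM2r ?ler_nat// divr_ge0// mulr_ge0// ltW.
have a0E : a 0%N = - k by rewrite /a mul0r addr0.
have amE : a m = k by rewrite /a; field; rewrite gt_eqF.
have aSE i : a i.+1 = a i + 2 * k / m%:R by rewrite /a -natr1; ring.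
pose g z := \sum_(i < m) \sum_(j < m) f (a i, a j) * cell (a i) (a i.+1) (a j) (a j.+1) z.
(* Inside the square the mesh is below the modulus [r], so the error is at most [e / 2]; outside,
   [g] vanishes and [f] is bounded by [B]. The factor [B + 1] keeps the divisor in the choice of [k]
   positive. *)
exists g, (fun z => e / 2 + (B + 1) * (1 - chi k z)); split.
- by do 2 (apply: cvg_integral_sum => ?); exact: cvg_integralZ.
- apply: cvg_integralD; first exact: cvg_integral_cst.
  apply: cvg_integralZ; apply: cvg_integralB; first exact: cvg_integral_cst.
  exact: Vcell.
- move=> z.
  have gE : g z = \sum_(i < m) (\sum_(j < m) f (a i, a j) * itv_step (a j) (a j.+1) z.2) *
      itv_step (a i) (a i.+1) z.1.
    apply: eq_bigr => i _; rewrite mulr_suml; apply: eq_bigr => j _.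
    by rewrite /cell; ring.
  rewrite (chi01 k z (ltW k0)).
  have [z1|z1] := boolP (- k < z.1 <= k); last first.
    rewrite gE (@step_sum_out _ a (fun i => \sum_(j < m) f (a i, a j) * itv_step (a j) (a j.+1) z.2) m)//.
      by rewrite subr0 subr0 mulr1; have := fB z; lra.
    by rewrite a0E amE; move: z1; rewrite negb_and -leNgt -ltNge.
  have [z2|z2] := boolP (- k < z.2 <= k); last first.
    rewrite gE big1; first by rewrite subr0 subr0 mulr1; have := fB z; lra.
    move=> i _; rewrite (@step_sum_out _ a (fun j => f (a i, a j)) m) ?mul0r//.
    by rewrite a0E amE; move: z2; rewrite negb_and -leNgt -ltNge.
  rewrite subrr mulr0 addr0.
  have [|i [im iz sumi]] := @step_sum_in _ a m z.1 ha; first by rewrite a0E amE.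
  have [|j [jm jz sumj]] := @step_sum_in _ a m z.2 ha; first by rewrite a0E amE.
  rewrite gE (sumi (fun i => \sum_(j < m) f (a i, a j) * itv_step (a j) (a j.+1) z.2)).
  rewrite (sumj (fun j => f (a i, a j))); apply: ltW; apply: fr.
    by move: z1 z2; rewrite /K/= !in_itv/= => /andP[/ltW-> ->] /andP[/ltW-> ->].
  move: iz jz; rewrite !aSE => /andP[? ?] /andP[? ?].
  by split; rewrite /ball/= ger0_norm; lra.
- have bchi : bmeas (chi k) by have [] := Vcell (- k) k (- k) k.
  have b1 : bmeas (fun z => 1 - chi k z) by apply: bmeasB => //; exact: bmeas_cst.
  rewrite bmeas_RintegralD; [|exact: bmeas_cst|exact: bmeasZ].
  rewrite (bmeas_RintegralZ _ _ b1) (bmeas_RintegralB mu (bmeas_cst _ 1) bchi).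
  rewrite !Rintegral_prob_cst.
  have B1 : 0 < B + 1 by rewrite ltr_wpDl.
  move: hk; rewrite ler_pdivlMr// mulrC; lra.
Unshelve. all: by end_near. Qed.

End plane.

(** * Distribution functions and quantiles *)

Section distribution_functions.
Context {R : realType}.
Implicit Types (K : R -> R) (u x y e : R).

Definition is_cdf K : Prop := [/\ {homo K : x y / x <= y}, forall y, 0 <= K y <= 1,
  forall y e, 0 < e -> exists2 r : R, 0 < r & K (y + r) <= K y + e,
  forall e, 0 < e -> exists y, K y <= e &
  forall e, 0 < e -> exists y, 1 - e <= K y].

Lemma is_cdf_probability K : is_cdf K ->
  exists P : probability R R, forall x, P `]-oo, x]%classic = (K x)%:E.
Proof.
move=> [homoK K01 rcK loK hiK].
have rc : right_continuous K.
  move=> y; apply/cvgrPdist_le => e e0; have [r r0 Kr] := rcK y e e0.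
  near=> t; have yt : y <= t by near: t; exact: nbhs_right_ge.
  have tr : t <= y + r by near: t; apply: nbhs_right_le; rewrite ltrDl.
  rewrite distrC ger0_norm ?subr_ge0 ?homoK// lerBlDl.
  by apply: le_trans Kr; exact: homoK.
have lo : K @ -oo --> (0 : R).
  apply/cvgrPdist_le => e e0; have [y Ky] := loK _ e0; near=> t.
  rewrite sub0r normrN ger0_norm; last by have /andP[] := K01 t.
  apply: le_trans Ky; apply: homoK; near: t; apply: nbhs_ninfty_le; rewrite num_real//.
have hi : K @ +oo --> (1 : R).
  apply/cvgrPdist_le => e e0; have [y Ky] := hiK _ e0; near=> t.
  rewrite ger0_norm; last by have /andP[] := K01 t; lra.
  suff : K y <= K t by lra.
  by apply: homoK; near: t; apply: nbhs_pinfty_ge; rewrite num_real.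
pose m1 := isCumulative.Build R _ _ K homoK rc.
pose m2 := isCumulativeBounded.Build R 0 1 K lo hi.
pose f : cumulativeBounded (0:R) (1:R) := HB.pack K m1 m2.
exists (probR (lebesgue_stieltjes_measure f)) => x.
exact: (cdf_lebesgue_stieltjes_id f x).
Unshelve. all: by end_near. Qed.

Lemma probability_is_cdf (P : probability R R) : is_cdf (fun x => fine (P `]-oo, x]%classic)).
Proof.
have cvgy := cvg_Nyc_y P; have cvgNy := cvg_Nyc_Ny P.
have homoP : {homo (fun x => fine (P `]-oo, x]%classic)) : x y / x <= y}.
  move=> x y xy; apply: fine_le; rewrite ?probability_fin_num//.
  apply: le_measure; rewrite ?inE//; apply: subset_itvl; rewrite bnd_simp//.
split => //.
- by move=> y; rewrite fine_ge0//= -[leRHS]/(fine 1%E) fine_le ?probability_fin_num// probability_le1.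
- move=> y e e0.
  have cv : fine (P `]-oo, (y + n.+1%:R^-1)]%classic) @[n --> \oo] --> fine (P `]-oo, y]%classic).
    have H (A : set R) : measurable A -> fine (P A) = \int[P]_x \1_A x.
      by move=> mA; rewrite Rintegral_prob_indic.
    rewrite H// (_ : (fun n => _) = fun n => \int[P]_x \1_(`]-oo, (y + n.+1%:R^-1)]%classic) x); last first.
      by apply/funext => n; rewrite H.
    apply: (@bounded_cvg_Rintegral _ _ _ _ _ _ 1) => [n|n x|x].
    - exact: measurable_indic.
    - by rewrite indicE; case: (_ \in _); rewrite ?normr1 ?normr0.
    - apply: cvg_near_cst; rewrite !indicE !mem_setE !in_itv/=.
      have [xy|yx] := leP x y.
        by apply: nearW => n; rewrite indicE mem_setE in_itv/= (le_trans xy)// lerDl.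
      have xy0 : 0 < x - y by rewrite subr_gt0.
      near=> n; rewrite indicE mem_setE in_itv/=.
      have := near_infty_natSinv_lt (PosNum xy0).
      suff : n.+1%:R^-1 < x - y by move=> h; rewrite leNgt -ltrBrDl h.
      by near: n; exact: (near_infty_natSinv_lt (PosNum xy0)).
  have /cvgrPdist_le/(_ _ e0) cv' := cv.
  near \oo => n; exists n.+1%:R^-1 => //.
  have : `|fine (P `]-oo, y]%classic) - fine (P `]-oo, (y + n.+1%:R^-1)]%classic)| <= e by near: n.
  by rewrite distrC => /(le_trans (ler_norm _)); rewrite lerBlDl.
- move=> e e0; have /cvgrPdist_le/(_ _ e0) cv := cvgNy; near (ninfty_nbhs R) => y.
  exists y; have : `|0 - fine (P `]-oo, y]%classic)| <= e by near: y.
  by rewrite sub0r normrN; exact: le_trans (ler_norm _).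
- move=> e e0; have /cvgrPdist_le/(_ _ e0) cv := cvgy; near (pinfty_nbhs R) => y.
  exists y; have : `|1 - fine (P `]-oo, y]%classic)| <= e by near: y.
  by move=> /(le_trans (ler_norm _)); rewrite lerBlDr -lerBlDl.
Unshelve. all: by end_near. Qed.

(** Outside []0, 1[] the set defining the quantile can be empty or unbounded below. The default 1/2
    makes [quantile_le] hold for every [u], and only on a null set of the uniform law. *)
Definition unit_clamp u := if 0 < u < 1 then u else 2^-1.

Definition quantile K u := inf [set y | unit_clamp u <= K y].

Lemma unit_clamp01 u : 0 < unit_clamp u < 1.
Proof. by rewrite /unit_clamp; case: ifPn => // _; apply/andP; split; lra. Qed.

(** Right continuity makes the infimum attained; this Galois equivalence is the only property of
    quantiles used later. *)
Lemma quantile_le K u y : is_cdf K -> (quantile K u <= y) = (unit_clamp u <= K y).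
Proof.
move=> [homoK K01 rcK loK hiK]; have := unit_clamp01 u.
rewrite /quantile; move: (unit_clamp u) => {}u /andP[u0 u1].
set S := [set y | u <= K y].
have S0 : S !=set0.
  have [y0] := hiK (1 - u) ltac:(lra).
  by rewrite opprB addrCA subrr addr0 => H; exists y0.
have lbS t : K t < u -> lbound S t.
  move=> tu s /= us; rewrite leNgt; apply/negP => /ltW/homoK st.
  by have := le_lt_trans (le_trans us st) tu; rewrite ltxx.
have hS : has_inf S.
  split=> //; have [y0 Ky0] := loK (u / 2) ltac:(lra); exists y0; apply: lbS.
  by apply: le_lt_trans Ky0 _; lra.
apply/idP/idP => [Sy|uy]; last by apply: ge_inf => //; case: hS.
rewrite leNgt; apply/negP => Ku.
have [r r0 Kr] := rcK y ((u - K y) / 2) ltac:(lra).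
have : y + r <= inf S.
  by apply: lb_le_inf => //; apply: lbS; lra.
lra.
Qed.

Lemma exists_uniform : exists U : probability R R,
  (forall t, 0 <= t <= 1 -> U `]-oo, t]%classic = t%:E) /\ U `]0, 1[%classic = 1%E.
Proof.
pose K t := Num.max 0 (Num.min 1 t) : R.
have K_id t : 0 <= t <= 1 -> K t = t.
  by move=> /andP[t0 t1]; rewrite /K min_r// max_r.
have cK : is_cdf K.
  split.
  - move=> x y xy; rewrite /K ge_max !le_max !le_min lexx !ge_min xy ler01 lexx ?orbT//= ?orbT.
  - by move=> y; rewrite /K le_max lexx ge_max ler01 ge_min lexx.
  - move=> y e e0; exists e => //; rewrite /K.
    have m0 (z : R) : z <= Num.max 0 z by rewrite le_max lexx orbT.
    have m1 (z : R) : 0 <= Num.max 0 z by rewrite le_max lexx.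
    rewrite ge_max; apply/andP; split; first by rewrite addr_ge0// ltW.
    apply: (@le_trans _ _ (Num.min 1 y + e)); last by rewrite lerD2r.
    have [y1|y1] := leP 1 y; first by rewrite ge_min lerDl (ltW e0).
    by rewrite ge_min lexx orbT.
  - by move=> e e0; exists 0; rewrite K_id ?lexx ?ler01// ltW.
  - by move=> e e0; exists 1; rewrite K_id ?lexx ?ler01//; lra.
have [U UE] := is_cdf_probability cK.
exists U; split; first by move=> t t01; rewrite UE K_id.
have mI : measurable (`]0, 1[%classic : set R) by exact: measurable_itv.
suff N0 : U (~` (`]0, 1[%classic : set R)) = 0%E.
  have H := fine_probability_setC U mI.
  rewrite -(fineK (probability_fin_num U mI)); congr (_%:E).
  by move: H; rewrite N0/=; lra.
apply/eqP; rewrite eq_le measure_ge0 andbT; apply/lee_addgt0Pr => e e0; rewrite add0e.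
pose e' := Num.min e 1.
have e'0 : 0 < e' by rewrite lt_min e0 ltr01.
have e'1 : 0 <= 1 - e' <= 1 by rewrite /e' subr_ge0 ge_min lexx orbT/= gerBl ltW.
apply: (@le_trans _ _ (U (`]-oo, 0]%classic `|` ~` `]-oo, 1 - e']%classic))).
  apply: le_measure; rewrite ?inE//.
  - by apply: measurableC; exact: measurable_itv.
  - by apply: measurableU; [exact: measurable_itv|apply: measurableC; exact: measurable_itv].
  move=> t/=; rewrite !in_itv/= => /negP; rewrite negb_and -!leNgt => /orP[t0|t1]; [by left|right].
  by apply/negP; rewrite -ltNge; lra.
pose A : set R := `]-oo, 0]%classic; pose B : set R := `]-oo, 1 - e']%classic.
have mB : measurable B by exact: measurable_itv.
have UA : U A = 0%E by rewrite UE K_id ?lexx ?ler01.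
have UB : fine (U B) = 1 - e' by rewrite UE K_id.
have UAB : (U (A `|` ~` B) <= U A + U (~` B))%E.
  by apply: measureU2; [exact: measurable_itv|exact: measurableC].
apply: (le_trans UAB); rewrite UA add0e -(fineK (probability_fin_num U (measurableC mB))).
by rewrite (fine_probability_setC U mB) UB lee_fin opprB addrCA subrr addr0 ge_min lexx.
Qed.

Lemma measurable_unit_clamp : measurable_fun setT unit_clamp.
Proof.
have m0 : measurable_fun setT (fun u : R => u) by [].
apply: measurable_fun_ifT.
- by apply: measurable_and; apply: measurable_fun_ltr => //; exact: measurable_cst.
- by [].
- exact: measurable_cst.
Qed.

(** By [quantile_le], exceeding [y] is a strict inequality between the clamped [p.2] and [K p.1 y].
    Measurability in the parameter for each fixed [y] therefore gives joint measurability. *)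
Lemma measurable_quantile d (X : measurableType d) (K : X -> R -> R) :
  (forall a, is_cdf (K a)) -> (forall y, measurable_fun setT (K^~ y)) ->
  measurable_fun setT (fun p : X * R => quantile (K p.1) p.2).
Proof.
move=> cK mK; apply: (measurability _ (RGenOInfty.measurableE R)) => _ [_ [y ->] <-].
rewrite setTI (_ : _ @^-1` _ = ~` ((fun p : X * R => unit_clamp p.2 <= K p.1 y) @^-1` [set true])).
  apply: measurableC; rewrite -[X in measurable X]setTI.
  apply: (measurable_fun_ler _ _) => //.
    by apply: measurableT_comp; [exact: measurable_unit_clamp|exact: measurable_snd].
  by apply: (measurableT_comp (f := K^~ y)) => //; exact: measurable_fst.
apply/seteqP; split => p /=; rewrite in_itv/= andbT -quantile_le//.
  by rewrite ltNge => /negP.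
by move=> /negP; rewrite -ltNge.
Qed.

Section uniform_law.
Variable U : probability R R.
Hypothesis U_cdf : forall t, 0 <= t <= 1 -> U `]-oo, t]%classic = t%:E.
Hypothesis U01 : U `]0, 1[%classic = 1%E.

Lemma uniform_set (k : R) A : measurable A -> 0 <= k <= 1 ->
  (forall u, 0 < u < 1 -> A u <-> u <= k) -> U A = k%:E.
Proof.
move=> mA k01 Ak; rewrite -(U_cdf k01).
have I B : measurable B -> U B = U (B `&` `]0, 1[%classic).
  move=> mB; rewrite (measureDI U mB (measurable_itv `]0, 1[)).
  rewrite [X in (X + _)%E](_ : _ = 0%E) ?add0e//.
  apply/eqP; rewrite eq_le measure_ge0 andbT.
  have N0 : U (~` `]0, 1[%classic) = 0%E.
    have m01 : measurable (`]0, 1[%classic : set R) by exact: measurable_itv.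
    rewrite -(fineK (probability_fin_num U (measurableC m01))).
    by rewrite fine_probability_setC// U01/= subrr.
  rewrite -N0; apply: le_measure; rewrite ?inE//.
  - by apply: measurableD => //; exact: measurable_itv.
  - by apply: measurableC; exact: measurable_itv.
rewrite I// (I `]-oo, k]%classic)//; congr (U _); apply/seteqP; split => t/=; rewrite !in_itv/= => -[tA t01].
  by split => //; exact/(Ak t t01).
by split => //; exact/(Ak t t01).
Qed.

Lemma uniform_quantile_law K : is_cdf K -> forall y,
  U ((quantile K) @^-1` `]-oo, y]%classic) = (K y)%:E.
Proof.
move=> cK y; have [homoK K01 rcK loK hiK] := cK; apply: uniform_set => //.
- apply: measurable_preimage; last exact: measurable_itv.
  have := @measurable_quantile _ R (fun=> K) (fun=> cK) (fun y => measurable_cst (K y)).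
  move=> m; have := measurableT_comp m (@measurable_pair1 _ _ R R 0).
  exact.
- by move=> u u01; rewrite /= in_itv/= quantile_le// /unit_clamp u01.
Qed.

End uniform_law.

End distribution_functions.

(** * Existence of the limit law *)

(** Convexity: a weighted sum of the tangent inequalities at [D * t], evaluated at 0 and at [t]. *)
Lemma expR_chord {R : realType} (D t : R) : 0 <= D <= 1 -> expR (D * t) <= 1 - D + D * expR t.
Proof.
move=> /andP[D0 D1].
have h1 : expR (D * t) * (1 - D * t) <= 1.
  rewrite -[leRHS](expR0 R) -[in leRHS](subrr (D * t)) expRD ler_pM2l ?expR_gt0//.
  exact: expR_ge1Dx.
have h2 : expR (D * t) * (1 + (1 - D) * t) <= expR t.
  rewrite [in leRHS](_ : t = D * t + (1 - D) * t); last by ring.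
  by rewrite expRD ler_pM2l ?expR_gt0// expR_ge1Dx.
have : (1 - D) * (expR (D * t) * (1 - D * t)) <= (1 - D) * 1 by rewrite ler_wpM2l// subr_ge0.
have : D * (expR (D * t) * (1 + (1 - D) * t)) <= D * expR t by rewrite ler_wpM2l.
set a := expR (D * t); set c := expR t => h3 h4.
by have := lerD h4 h3; rewrite (_ : _ + _ = a); [lra|ring].
Qed.

(* Summing the bound over a partition of [s, t] gives [O(mesh)], since [K] is
   monotone and [G] is Lipschitz. *)
Lemma eq_of_increments {R : realType} (f K G : R -> R) (C s t : R) : s <= t -> 0 <= C ->
  (forall x, 0 <= K x <= 1) ->
  (forall x y, s <= x -> x <= y -> `|f y - f x| <= (K x - K y) * (G y - G x)) ->
  (forall x y, x <= y -> K y <= K x) ->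
  (forall x y, s <= x -> x <= y -> G y - G x <= C * (y - x)) ->
  f t = f s.
Proof.
move=> st C0 K01 fKG Kanti GC.
have bound (N : nat) : (0 < N)%N -> `|f t - f s| * N%:R <= C * (t - s).
  move=> N0; have N0' : 0 < N%:R :> R by rewrite ltr0n.
  pose x (i : nat) := s + i%:R * ((t - s) / N%:R).
  have xS i : x i.+1 = x i + (t - s) / N%:R by rewrite /x -natr1; ring.
  have dx : 0 <= (t - s) / N%:R by rewrite divr_ge0// subr_ge0.
  have sx i : s <= x i by rewrite /x lerDl mulr_ge0.
  have H i : `|f (x i) - f (x 0%N)| <= (K (x 0%N) - K (x i)) * (C * ((t - s) / N%:R)).
    elim: i => [|i ih]; first by rewrite !subrr normr0 mul0r.
    have xx : x i <= x i.+1 by rewrite xS lerDl.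
    have h := fKG _ _ (sx i) xx.
    have g : G (x i.+1) - G (x i) <= C * ((t - s) / N%:R).
      by apply: le_trans (GC _ _ (sx i) xx) _; rewrite xS addrAC subrr add0r.
    have k : 0 <= K (x i) - K (x i.+1) by rewrite subr_ge0 Kanti.
    apply: (le_trans (ler_distD (f (x i)) _ _)).
    apply: (le_trans (lerD (le_trans h (ler_wpM2l k g)) ih)).
    by rewrite -mulrDl [X in X * _](_ : _ = K (x 0%N) - K (x i.+1)) //; ring.
  have := H N; rewrite /x mul0r addr0 (_ : s + N%:R * _ = t); last by field; rewrite gt_eqF.
  move=> h; apply: (@le_trans _ _ ((K s - K t) * (C * ((t - s) / N%:R)) * N%:R)).
    by rewrite ler_pM2r.
  rewrite (_ : _ * N%:R = (K s - K t) * (C * (t - s))); last by field; rewrite gt_eqF.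
  rewrite ler_piMl ?mulr_ge0 ?subr_ge0//.
  by have := K01 s; have := K01 t; lra.
apply/eqP; rewrite -subr_eq0 -normr_le0 leNgt; apply/negP => a0.
pose N := (Num.truncn (C * (t - s) / `|f t - f s|)).+1.
have := bound N isT; rewrite leNgt => /negP; apply.
by rewrite [X in _ < X]mulrC -ltr_pdivrMr//; exact: truncnS_gt.
Qed.

Section limit_law_construction.
Context {R : realType}.
Variables (V : R -> R -> R) (D : R -> R).
Implicit Types (s t x y z e : R).
Hypothesis V_increment : forall s t y, s <= t ->
  (expR (- s) - expR (- t)) * D (y - t) <= V s y - V t y <= (expR (- s) - expR (- t)) * D (y - s).
Hypothesis VC : forall x y, V x y = V y x.
Hypothesis V_ge : forall x y, expR (- x) <= V x y.
Hypothesis V_le : forall x y, V x y <= expR (- x) + expR (- y).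
Hypothesis D01 : forall z, 0 <= D z <= 1.
Hypothesis D_homo : {homo D : x y / x <= y}.
Hypothesis D_rc : forall z e, 0 < e -> exists2 r : R, 0 < r & D (z + r) <= D z + e.
Hypothesis D_hi : forall e, 0 < e -> exists z, 1 - e <= D z.

(* [K x] is the conditional distribution function of the second coordinate given
   that the first one, of Gumbel law [G], equals [x]: formally,
   [K x y * G' x] is the derivative in [x] of [expR (- V x y)]. *)
Let W x y := V x y - expR (- x).
Let K x y := expR (- W x y) * D (y - x).
Let G x := expR (- expR (- x)).

Let W0 x y : 0 <= W x y.
Proof. by rewrite subr_ge0. Qed.

Let V_anti_r x y y' : y <= y' -> V x y' <= V x y.
Proof.
move=> yy'; rewrite !(VC x) -subr_ge0.
have /andP[+ _] := V_increment x yy'; apply: le_trans.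
by rewrite mulr_ge0 ?subr_ge0 ?ler_expR ?lerN2//; have /andP[] := D01 (x - y').
Qed.

Let V_lip_r x y r : 0 <= r -> V x y - V x (y + r) <= expR (- y) * r.
Proof.
move=> r0; rewrite !(VC x).
have yr : y <= y + r by rewrite lerDl.
have /andP[_] := V_increment x yr; move=> /le_trans; apply.
have /andP[d0 d1] := D01 (x - y).
have e0 : 0 <= expR (- y) - expR (- (y + r)) by rewrite subr_ge0 ler_expR lerN2.
apply: (@le_trans _ _ (expR (- y) - expR (- (y + r)))); first by rewrite ler_piMr.
rewrite opprD expRD -{1}(mulr1 (expR (- y))) -mulrBr ler_wpM2l ?expR_ge0//.
by have := expR_ge1Dx (- r); lra.
Qed.

Let K01 x y : 0 <= K x y <= 1.
Proof.
have /andP[d0 d1] := D01 (y - x).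
rewrite /K mulr_ge0 ?expR_ge0//= mulr_ile1 ?expR_ge0// expR_le1 oppr_le0.
exact: W0.
Qed.

Let is_cdf_K x : is_cdf (K x).
Proof.
split.
- move=> y y' yy'; rewrite /K; apply: ler_pM; rewrite ?expR_ge0//.
  + by have /andP[] := D01 (y - x).
  + by rewrite ler_expR lerN2 lerD2r V_anti_r.
  + by apply: D_homo; rewrite lerD2r.
- exact: K01.
- move=> y e e0; have e2 : 0 < e / 2 by rewrite divr_gt0.
  have [r1 r10 Dr1] := D_rc (y - x) e2.
  pose r := Num.min r1 (e / 2 * expR y).
  have r0 : 0 < r by rewrite lt_min r10 mulr_gt0// expR_gt0.
  exists r => //.
  have Dr : D (y + r - x) <= D (y - x) + e / 2.
    apply: le_trans Dr1; apply: D_homo; rewrite addrAC lerD2l.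
    by rewrite ge_min lexx.
  have Wr : W x y - W x (y + r) <= e / 2.
    rewrite /W opprB addrA subrK; apply: (le_trans (V_lip_r _ _ (ltW r0))).
    apply: (@le_trans _ _ (expR (- y) * (e / 2 * expR y))).
      by rewrite ler_wpM2l ?expR_ge0// ge_min lexx orbT.
    by rewrite mulrCA -expRD addNr expR0 mulr1.
  have eW : expR (- W x (y + r)) <= expR (- W x y) + e / 2.
    have := expRN_lip (W0 x (y + r)) (W0 x y) => /(le_trans (ler_norm _)).
    rewrite lerBlDl => /le_trans; apply; rewrite lerD2l.
    apply: le_trans Wr; rewrite distrC ger0_norm//.
    by rewrite subr_ge0 lerD2r V_anti_r// lerDl ltW.
  have /andP[d0 d1] := D01 (y - x); have /andP[d0' d1'] := D01 (y + r - x).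
  have w1 : expR (- W x y) <= 1 by rewrite expR_le1 oppr_le0 W0.
  have w0 := expR_ge0 (- W x y).
  rewrite /K; apply: (le_trans (ler_wpM2r d0' eW)).
  nra.
- move=> e e0.
  (* By symmetry and [V_ge], [W x y] is at least [expR (- y) - expR (- x)], which for this [y]
     equals the absolute value of [ln e]. *)
  pose y := - ln (expR (- x) + `|ln e|); exists y.
  have sp : 0 < expR (- x) + `|ln e| by rewrite ltr_pwDl ?expR_gt0.
  have /andP[d0 d1] := D01 (y - x).
  rewrite /K; apply: (@le_trans _ _ (expR (- W x y))); first by rewrite ler_piMr ?expR_ge0.
  rewrite -[leRHS]lnK// ler_expR lerNl.
  have : expR (- y) <= V x y by rewrite VC; exact: V_ge.
  rewrite {1}/y opprK lnK// /W; have := ler_norm (- ln e); rewrite normrN; lra.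
- move=> e e0; have e2 : 0 < e / 2 by rewrite divr_gt0.
  have [z Dz] := D_hi e2; pose y := Num.max (z + x) (- ln (e / 2)).
  exists y; have Dy : 1 - e / 2 <= D (y - x).
    by apply: le_trans Dz _; apply: D_homo; rewrite lerBrDr le_max lexx.
  have Wy : W x y <= e / 2.
    rewrite /W lerBlDl; apply: (le_trans (V_le x y)); rewrite lerD2l.
    by rewrite -[leRHS]lnK// ler_expR lerNl le_max lexx orbT.
  have h := expR_ge1Dx (- W x y); have /andP[d0 d1] := D01 (y - x).
  have w1 : expR (- W x y) <= 1 by rewrite expR_le1 oppr_le0 W0.
  rewrite /K; have w0 := expR_ge0 (- W x y).
  have := W0 x y; nra.
Qed.

Let K_anti y x x' : x <= x' -> K x' y <= K x y.
Proof.
move=> xx'; rewrite /K; apply: ler_pM; rewrite ?expR_ge0//.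
- by have /andP[] := D01 (y - x').
- rewrite ler_expR lerN2.
  have /andP[_] := V_increment y xx'; have /andP[d0 d1] := D01 (y - x).
  have e0 : 0 <= expR (- x) - expR (- x') by rewrite subr_ge0 ler_expR lerN2.
  by rewrite /W; nra.
- by apply: D_homo; rewrite lerD2l lerN2.
Qed.

Let measurable_K y : measurable_fun setT (K^~ y).
Proof. apply: nonincreasing_measurable; first exact: measurableT.
by move=> x x'; exact: K_anti. Qed.

Let G_lip x y : x <= y -> G y - G x <= expR (- x) * (y - x).
Proof.
move=> xy; apply: (le_trans (ler_norm _)).
apply: (le_trans (expRN_lip (expR_ge0 _) (expR_ge0 _))).
rewrite distrC ger0_norm ?subr_ge0 ?ler_expR ?lerN2//.
have -> : expR (- y) = expR (- x) * expR (x - y) by rewrite -expRD; congr expR; ring.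
rewrite -{1}(mulr1 (expR (- x))) -mulrBr ler_wpM2l ?expR_ge0//.
by have := expR_ge1Dx (x - y); lra.
Qed.

Let is_cdf_G : is_cdf G.
Proof.
split.
- by move=> x y xy; rewrite /G ler_expR lerN2 ler_expR lerN2.
- by move=> y; rewrite /G expR_ge0 expR_le1 oppr_le0 expR_ge0.
- move=> y e e0; exists (e * expR y); first by rewrite mulr_gt0 ?expR_gt0.
  have yy : y <= y + e * expR y by rewrite lerDl mulr_ge0 ?expR_ge0 ?(ltW e0).
  rewrite -lerBlDl; apply: (le_trans (G_lip yy)).
  by rewrite addrAC subrr add0r mulrCA -expRD addNr expR0 mulr1.
- move=> e e0; exists (- ln (1 + `|ln e|)); rewrite /G opprK lnK ?posrE ?ltr_pwDl//.
  rewrite -[leRHS]lnK// ler_expR lerNl.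
  by have := ler_norm (- ln e); rewrite normrN; lra.
- move=> e e0; exists (- ln e); rewrite /G opprK lnK//.
  exact: expR_ge1Dx.
Qed.

(** With [tau = expR (- s) - expR (- t)] one has [G t = G s * expR tau], while [V_increment] bounds
    the change of [V] by multiples of [tau]. The chord inequality turns the resulting exponentials
    into affine functions of $e^{\pm\tau}$, hence into increments of [G]. *)
Let H_increment y s t : s <= t ->
  K t y * (G t - G s) <= expR (- V t y) - expR (- V s y) <= K s y * (G t - G s).
Proof.
move=> st; have /andP[h1 h2] := V_increment y st.
set tau := expR (- s) - expR (- t) in h1 h2.
have VE x : expR (- V x y) = expR (- W x y) * G x.
  by rewrite /G -expRD; congr expR; rewrite /W; ring.
have Gt : G t = G s * expR tau by rewrite /G -expRD; congr expR; rewrite /tau; ring.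
have Gs : G s = G t * expR (- tau) by rewrite /G -expRD; congr expR; rewrite /tau; ring.
apply/andP; split.
  have : expR (- V s y) <= expR (- V t y) * (1 - D (y - t) + D (y - t) * expR (- tau)).
    apply: (@le_trans _ _ (expR (- V t y) * expR (D (y - t) * - tau))).
      by rewrite -expRD ler_expR; lra.
    by rewrite ler_pM2l ?expR_gt0// expR_chord.
  have : expR (- W t y) * D (y - t) * G s = expR (- W t y) * D (y - t) * (G t * expR (- tau)).
    by rewrite -Gs.
  rewrite !VE /K; lra.
have : expR (- V t y) <= expR (- V s y) * (1 - D (y - s) + D (y - s) * expR tau).
  apply: (@le_trans _ _ (expR (- V s y) * expR (D (y - s) * tau))).
    by rewrite -expRD ler_expR; lra.
  by rewrite ler_pM2l ?expR_gt0// expR_chord.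
have : expR (- W s y) * D (y - s) * G t = expR (- W s y) * D (y - s) * (G s * expR tau).
  by rewrite -Gt.
rewrite !VE /K; lra.
Qed.

(** As functions of the first variable, [expR (- V c y)] and the probability of the quadrant both
    have increments squeezed between end values of [K] times the increment of [G]. By
    [eq_of_increments] they differ by a constant, which is 0 because both lie between 0 and [G c],
    and [G] vanishes at minus infinity. *)
Theorem limit_law_construction : exists mu : probability (R * R)%type R,
  forall x y, mu (quadrant x y) = (expR (- V x y))%:E.
Proof.
have [PG PGE] := is_cdf_probability is_cdf_G.
have [U [U_cdf U01]] := @exists_uniform R.
pose F (p : R * R) := (p.1, quantile (K p.1) p.2).
have mF : measurable_fun setT F.
  by apply: measurable_fun_pair; [exact: measurable_fst|exact: (measurable_quantile is_cdf_K measurable_K)].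
pose F' : {mfun (R * R)%type >-> (R * R)%type} := mfun_Sub (mem_set mF).
exists (distribution (PG \x U)%E F') => a y.
have [bK bI] : bmeas (K^~ y) /\ forall a, bmeas (fun x => (x <= a)%R%:R * K x y).
  have bK : bmeas (K^~ y).
    split; first exact: measurable_K.
    exists 1 => x; have /andP[k0 k1] := K01 x y.
    by rewrite ger0_norm.
  split => // c; apply: bmeasM => //.
  rewrite (_ : (fun x => _) = \1_`]-oo, c]); first exact: bmeas_indic.
  by apply/funext => x; rewrite indicE mem_setE in_itv.
have muE c : distribution (PG \x U)%E F' (quadrant c y) = (\int[PG]_x ((x <= c)%R%:R * K x y))%:E.
  rewrite /distribution /pushforward/= /product_measure1 /Rintegral fineK; last first.
    by apply: integrable_fin_num => //; exact: bmeas_integrable.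
  apply: eq_integral => x _.
  rewrite [LHS](_ : _ = U (xsection (F @^-1` quadrant c y) x))//.
  have [xc|cx] := leP x c; last first.
    rewrite mul0r (_ : xsection _ _ = set0) ?measure0//.
    apply/seteqP; split => u//; rewrite /xsection/= inE/= /quadrant/= !in_itv/= => -[+ _].
    by rewrite leNgt cx.
  rewrite mul1r -(uniform_quantile_law U_cdf U01 (is_cdf_K x)); congr (U _).
  apply/seteqP; split => u; rewrite /xsection/= inE/= /quadrant/= !in_itv/=; first by case.
  by split.
apply: (etrans (muE a)); congr (_%:E).
pose I c := \int[PG]_x ((x <= c)%R%:R * K x y).
rewrite -/(I a).
have I_increment s t : s <= t -> K t y * (G t - G s) <= I t - I s <= K s y * (G t - G s).
  move=> st.
  have GE c : G c = \int[PG]_x (x <= c)%R%:R.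
    rewrite (_ : (fun x => _) = \1_`]-oo, c]).
      by rewrite Rintegral_prob_indic// PGE.
    by apply/funext => x; rewrite indicE mem_setE in_itv.
  have b1 c : bmeas (fun x : R => (x <= c)%R%:R : R).
    rewrite (_ : (fun x => _) = \1_`]-oo, c]); first exact: bmeas_indic.
    by apply/funext => x; rewrite indicE mem_setE in_itv.
  have bst := bmeasB (b1 t) (b1 s).
  have bIB := bmeasB (bI t) (bI s).
  have IE : \int[PG]_x ((x <= t)%R%:R * K x y - (x <= s)%R%:R * K x y) = I t - I s.
    exact: (bmeas_RintegralB PG (bI t) (bI s)).
  have KE k : \int[PG]_x (k * ((x <= t)%R%:R - (x <= s)%R%:R)) = k * (G t - G s).
    by rewrite (bmeas_RintegralZ PG k bst) (bmeas_RintegralB PG (b1 t) (b1 s)) -!GE.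
  rewrite -IE -!KE; apply/andP; split.
  - apply: (le_bmeas_Rintegral PG (bmeasZ _ bst) bIB) => x.
    rewrite -mulrBl mulrC -[_ - _]/(itv_step s t x) itv_step01//.
    have [/andP[sx xt]|_] := boolP (s < x <= t); last by rewrite !mul0r.
    by rewrite !mul1r K_anti.
  - apply: (le_bmeas_Rintegral PG bIB (bmeasZ _ bst)) => x.
    rewrite -mulrBl [leRHS]mulrC -[_ - _]/(itv_step s t x) itv_step01//.
    have [/andP[sx xt]|_] := boolP (s < x <= t); last by rewrite !mul0r.
    by rewrite !mul1r K_anti// ltW.
pose f c := expR (- V c y) - I c.
have fcst s t : s <= t -> f t = f s.
  move=> st; apply: (@eq_of_increments _ f (K^~ y) G (expR (- s))) => //.
  - move=> x x' _ xx'; have /andP[? ?] := I_increment _ _ xx'.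
    have /andP[? ?] := H_increment y xx'.
    rewrite /f ler_norml mulrBl; apply/andP; split; lra.
  - by move=> x x'; exact: K_anti.
  - move=> x x' sx xx'; apply: (le_trans (G_lip xx')).
    by rewrite ler_wpM2r ?subr_ge0// ler_expR lerN2.
have fG s : `|f s| <= G s.
  have h0 : 0 <= expR (- V s y) <= G s by rewrite expR_ge0 /G ler_expR lerN2 V_ge.
  have i0 : 0 <= I s <= G s.
    have GsE : \int[PG]_x (\1_`]-oo, s] x : R) = G s by rewrite Rintegral_prob_indic// PGE.
    have bs : bmeas (\1_`]-oo, s] : R -> R) by exact: bmeas_indic.
    have h1 := le_bmeas_Rintegral PG (bmeas_cst _ (0 : R)) (bI s).
    have h2 := le_bmeas_Rintegral PG (bI s) bs.
    rewrite GsE in h2; rewrite Rintegral_prob_cst in h1; apply/andP; split.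
      by apply: h1 => x; have /andP[k0 _] := K01 x y; rewrite mulr_ge0.
    apply: h2 => x; have /andP[k0 k1] := K01 x y.
    by rewrite indicE mem_setE in_itv/=; case: (x <= s); rewrite ?mul1r ?mul0r.
  move: h0 i0 => /andP[? ?] /andP[? ?].
  by rewrite /f ler_norml; apply/andP; split; lra.
apply/esym/eqP; rewrite -subr_eq0 -/(f a) -normr_le0 leNgt; apply/negP => fa0.
have [_ _ _ loG _] := is_cdf_G.
have [s0 Gs0] := loG (`|f a| / 2) ltac:(lra).
pose s := Num.min s0 a.
have sa : s <= a by rewrite ge_min lexx orbT.
have := fG s; rewrite -(fcst _ _ sa).
have [homoG _ _ _ _] := is_cdf_G.
have : G s <= G s0 by apply: homoG; rewrite ge_min lexx.
lra.
Qed.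

End limit_law_construction.

Section Rintegral_comparison.
Context d (T : measurableType d) (R : realType) (P : probability T R).
Implicit Types (f g k : T -> R).

Lemma Rintegral_scale_le_sub f g k (c : R) : bmeas f -> bmeas g -> bmeas k ->
  (forall x, c * f x <= g x - k x) -> c * \int[P]_x f x <= \int[P]_x g x - \int[P]_x k x.
Proof.
move=> bf bg bk H; rewrite -(bmeas_RintegralB P bg bk) -(bmeas_RintegralZ P c bf).
by apply: le_bmeas_Rintegral => //; [exact: bmeasZ|exact: bmeasB].
Qed.

Lemma Rintegral_sub_le_scale f g k (c : R) : bmeas f -> bmeas g -> bmeas k ->
  (forall x, g x - k x <= c * f x) -> \int[P]_x g x - \int[P]_x k x <= c * \int[P]_x f x.
Proof.
move=> bf bg bk H; rewrite -(bmeas_RintegralB P bg bk) -(bmeas_RintegralZ P c bf).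
by apply: le_bmeas_Rintegral => //; [exact: bmeasB|exact: bmeasZ].
Qed.

End Rintegral_comparison.

Section limit_law.
Context {R : realType}.
Variable nu : probability (ext_nneg R) R.
Local Notation h := (@limit_integrand R).
Local Notation d := (@limit_slope R).
Implicit Types (s t x y z e : R).

Let V x y := \int[nu]_l h x y l.
Let D z := \int[nu]_l d z l.

Let bh x y : bmeas (h x y). Proof. exact: bmeas_limit_integrand. Qed.
Let bd z : bmeas (d z). Proof. exact: bmeas_limit_slope. Qed.

Let V_increment s t y : s <= t ->
  (expR (- s) - expR (- t)) * D (y - t) <= V s y - V t y <= (expR (- s) - expR (- t)) * D (y - s).
Proof.
move=> st; apply/andP; split.
- apply: (Rintegral_scale_le_sub nu (bd _) (bh _ _) (bh _ _)) => l.
  by have /andP[] := limit_integrand_increment y l st.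
- apply: (Rintegral_sub_le_scale nu (bd _) (bh _ _) (bh _ _)) => l.
  by have /andP[] := limit_integrand_increment y l st.
Qed.

Let VC x y : V x y = V y x.
Proof. by apply: eq_Rintegral => l _; rewrite limit_integrandC. Qed.

Let V_ge x y : expR (- x) <= V x y.
Proof.
rewrite -[leLHS](Rintegral_prob_cst nu); apply: le_bmeas_Rintegral => //; first exact: bmeas_cst.
by move=> l; exact: limit_integrand_ge.
Qed.

Let V_le x y : V x y <= expR (- x) + expR (- y).
Proof.
rewrite -[leRHS](Rintegral_prob_cst nu); apply: le_bmeas_Rintegral => //; first exact: bmeas_cst.
by move=> l; exact: limit_integrand_le.
Qed.

Let D01 z : 0 <= D z <= 1.
Proof.
have b0 : bmeas (fun _ : ext_nneg R => 0 : R) by exact: bmeas_cst.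
have b1 : bmeas (fun _ : ext_nneg R => 1 : R) by exact: bmeas_cst.
have := le_bmeas_Rintegral nu b0 (bd z) (limit_slope_ge0 z).
have := le_bmeas_Rintegral nu (bd z) b1 (limit_slope_le1 z).
by rewrite !Rintegral_prob_cst => -> ->.
Qed.

Let D_homo : {homo D : x y / x <= y}.
Proof.
move=> x y xy; apply: (le_bmeas_Rintegral nu (bd x) (bd y)) => l.
exact: limit_slope_homo.
Qed.

Let D_rc z e : 0 < e -> exists2 r : R, 0 < r & D (z + r) <= D z + e.
Proof.
move=> e0.
have cv : D (z + n.+1%:R^-1) @[n --> \oo] --> D z.
  apply: (@bounded_cvg_Rintegral _ _ _ _ _ _ 1) => [n|n l|l].
  - by have [] := bd (z + n.+1%:R^-1).
  - by rewrite ger0_norm ?limit_slope_ge0 ?limit_slope_le1.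
  have cn : z + n.+1%:R^-1 @[n --> \oo] --> z.
    rewrite -[X in _ --> X]addr0; apply: cvgD; first exact: cvg_cst.
    exact: cvg_harmonic.
  case: (ext_cases3 l) => [->|->|[r r0 ->]].
  - by rewrite limit_slope_oo; exact: cvg_cst.
  (* At radius 0 the slope is a step; its value 1 at [z = 0] makes it right continuous. *)
  - have [z0|z0] := leP 0 z.
      apply: cvg_near_cst; apply: nearW => n; rewrite !limit_slope0 z0 (le_trans z0)//.
      by rewrite lerDl.
    apply: cvg_near_cst; near=> n; rewrite !limit_slope0 !leNgt z0.
    suff -> : z + n.+1%:R^-1 < 0 by [].
    near: n; exact: (cvgr_lt _ cn _ z0).
  - rewrite limit_slope_real//; under eq_fun do rewrite limit_slope_real//.
    have ca : r + (z + n.+1%:R^-1) / (2 * r) @[n --> \oo] --> r + z / (2 * r).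
      by apply: cvgD; [exact: cvg_cst|apply: cvgMl].
    exact: (cvg_comp _ _ ca (@continuous_Phi R _)).
have /cvgrPdist_le/(_ _ e0) cv' := cv.
near \oo => n; exists n.+1%:R^-1 => //.
have : `|D z - D (z + n.+1%:R^-1)| <= e by near: n.
by rewrite distrC => /(le_trans (ler_norm _)); rewrite lerBlDl.
Unshelve. all: by end_near. Qed.

Let D_hi e : 0 < e -> exists z, 1 - e <= D z.
Proof.
move=> e0.
have cv : D n%:R @[n --> \oo] --> \int[nu]_l 1.
  apply: (@bounded_cvg_Rintegral _ _ _ _ _ _ 1) => [n|n l|l].
  - by have [] := bd n%:R.
  - by rewrite ger0_norm ?limit_slope_ge0 ?limit_slope_le1.
  case: (ext_cases3 l) => [->|->|[r r0 ->]].
  - exact: cvg_cst.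
  - by apply: cvg_near_cst; apply: nearW => n; rewrite limit_slope0 ler0n.
  - under eq_fun do rewrite limit_slope_real//.
    apply: (@cvg_comp _ _ _ (fun n => r + n%:R / (2 * r)) (@std_normal_cdf R) _ (pinfty_nbhs R)) Phi_cvg_y.
    apply/cvgryPge => A; near=> n.
    rewrite -lerBlDl ler_pdivlMr ?mulr_gt0//.
    by near: n; exact: nbhs_infty_ger.
rewrite Rintegral_prob_cst in cv.
have /cvgrPdist_le/(_ _ e0) cv' := cv.
near \oo => n; exists n%:R.
have : `|1 - D n%:R| <= e by near: n.
by move=> /(le_trans (ler_norm _)); lra.
Unshelve. all: by end_near. Qed.

Theorem limit_law_exists : exists mu : probability (R * R)%type R, has_joint_cdf mu (limit_cdf nu).
Proof. exact: (limit_law_construction V_increment VC V_ge V_le D01 D_homo D_rc D_hi). Qed.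

End limit_law.

(** * Convergence of the maxima *)

Section maximum_weak_limits.
Context d (T : measurableType d) (R : realType) (P : probability T R).
Variables (b : nat -> R) (X : nat -> {RV P >-> (R * R)%type}) (rho : nat -> R).
Hypothesis hb : forall n, (0 < n)%N -> b n = n%:R * normal_pdf 0 1 (b n).
Hypothesis indX : independent P X.
Hypothesis gaussX : forall i, std_gaussian_vector P (rho i) (X i).
Let law n := distribution P (normalized_max (b n.+1) X n).
Let nu_ n := empirical (b n.+1) rho n.
Let F n (x y : R) := fine (law n (quadrant x y)).
Let V n (x y : R) := \int[nu_ n]_l limit_integrand x y l.

Let asymp x y : F n x y - expR (- V n x y) @[n --> \oo] --> (0:R).
Proof. exact: maximum_cdf_asymptotic hb indX gaussX x y. Qed.

Let V_ge0 n x y : 0 <= V n x y.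
Proof. by apply: Rintegral_ge0 => l _; exact: limit_integrand_ge0. Qed.

Let V_le n x y : V n x y <= expR (- x) + expR (- y).
Proof.
rewrite -[leRHS](Rintegral_prob_cst (nu_ n)); apply: le_bmeas_Rintegral.
- exact: bmeas_limit_integrand.
- exact: bmeas_cst.
- by move=> l; exact: limit_integrand_le.
Qed.

Let V_lip n x y x' y' :
  `|V n x y - V n x' y'| <= `|expR (- x) - expR (- x')| + `|expR (- y) - expR (- y')|.
Proof.
rewrite -[leRHS](Rintegral_prob_cst (nu_ n)).
apply: bmeas_Rintegral_dist_le.
- exact: bmeas_limit_integrand.
- exact: bmeas_limit_integrand.
- exact: bmeas_cst.
move=> l; apply: (le_trans (ler_distD (limit_integrand x' y l) _ _)).
apply: lerD; first exact: limit_integrand_lip.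
rewrite (limit_integrandC x') (limit_integrandC x' y'); exact: limit_integrand_lip.
Qed.

Let cvg_expN (x : R) : expR (- (x + D)) @[D --> (0:R)^'+] --> expR (- x).
Proof.
apply: cvg_at_right_filter; rewrite -[X in _ --> expR (- X)](addr0 x).
apply: (@continuous_comp _ _ _ (fun D => - (x + D))); last exact: continuous_expR.
by apply: cvgN; apply: cvgD; [exact: cvg_cst|exact: cvg_id].
Qed.

(** The equicontinuity required by [weak_cvg_quadrant] comes from the empirical side: [F n] is
    asymptotically [expR (- V n)], and [V n] is Lipschitz in the two exponentials with constants
    independent of [n]. *)
Lemma maximum_weak_cvg_cdf (mu : probability (R * R)%type R) (x y : R) :
  weak_cvg (@bounded_continuous R (R * R)%type) law mu ->
  F n x y @[n --> \oo] --> fine (mu (quadrant x y)).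
Proof.
move=> wcv; apply: weak_cvg_quadrant wcv _ => e e0.
have e4 : 0 < e / 4 by rewrite divr_gt0.
have /cvgrPdist_le/(_ _ e4) Ex := @cvg_expN x.
have /cvgrPdist_le/(_ _ e4) Ey := @cvg_expN y.
have [D [D0 Dx Dy]] : exists D, [/\ 0 < D, `|expR (- x) - expR (- (x + D))| <= e / 4
    & `|expR (- y) - expR (- (y + D))| <= e / 4].
  near (0:R)^'+ => D; exists D; split; [|by near: D|by near: D].
  by near: D; exact: nbhs_right_gt.
exists D => //.
have aux (f f' v v' : R) : `|v' - v| <= e / 4 + e / 4 -> `|0 - (f' - v')| <= e / 4 ->
    `|0 - (f - v)| <= e / 4 -> f' - f <= e.
  by rewrite !ler_norml => /andP[? ?] /andP[? ?] /andP[? ?]; lra.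
have /cvgrPdist_le/(_ _ e4) A1 := asymp x y.
have /cvgrPdist_le/(_ _ e4) A2 := asymp (x + D) (y + D).
apply: filterS2 A2 A1 => n + +; have : `|expR (- V n (x + D) (y + D)) - expR (- V n x y)| <= e / 4 + e / 4.
  apply: (le_trans (expRN_lip (V_ge0 n _ _) (V_ge0 n _ _))); rewrite distrC.
  by apply: (le_trans (V_lip n x y _ _)); exact: lerD.
exact: aux.
Unshelve. all: by end_near. Qed.

Lemma empirical_weak_cvg_cdf (nu : probability (ext_nneg R) R) (x y : R) :
  weak_cvg (@bounded_continuous R (ext_nneg R)) nu_ nu ->
  F n x y @[n --> \oo] --> limit_cdf nu x y.
Proof.
move=> wcv; have Vcv : V n x y @[n --> \oo] --> \int[nu]_l limit_integrand x y l.
  exact: wcv (bounded_limit_integrand x y).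
rewrite (_ : (fun n => F n x y) = fun n => (F n x y - expR (- V n x y)) + expR (- V n x y)); last first.
  by apply/funext => n; rewrite subrK.
rewrite -[limit_cdf _ _ _]add0r; apply: cvgD; first exact: asymp.
apply: (cvg_comp _ _ (cvgN Vcv)); exact: continuous_expR.
Qed.

Lemma empirical_weak_cvg_maximum (nu : probability (ext_nneg R) R)
    (mu : probability (R * R)%type R) : has_joint_cdf mu (limit_cdf nu) ->
  weak_cvg (@bounded_continuous R (ext_nneg R)) nu_ nu ->
  weak_cvg (@bounded_continuous R (R * R)%type) law mu.
Proof.
move=> muE wcv; apply: quadrant_weak_cvg => x y.
rewrite [X in _ --> X](_ : _ = limit_cdf nu x y); first exact: empirical_weak_cvg_cdf.
by rewrite /quadrant muE.
Qed.

Lemma maximum_weak_cvg_joint_cdf (nu : probability (ext_nneg R) R)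
    (mu : probability (R * R)%type R) :
  weak_cvg (@bounded_continuous R (R * R)%type) law mu ->
  weak_cvg (@bounded_continuous R (ext_nneg R)) nu_ nu ->
  has_joint_cdf mu (limit_cdf nu).
Proof.
move=> wmu wnu x y.
have h1 := maximum_weak_cvg_cdf (x := x) (y := y) wmu.
have h2 := empirical_weak_cvg_cdf (x := x) (y := y) wnu.
rewrite -(cvg_unique (@Rhausdorff R) h1 h2) fineK//; apply: probability_fin_num.
exact: measurable_quadrant.
Qed.

(** The bound [V_le], uniform in [n], keeps the limiting distribution function positive, so that
    logarithms may be taken. *)
Lemma maximum_weak_cvg_mean (mu : probability (R * R)%type R) (x y : R) :
  weak_cvg (@bounded_continuous R (R * R)%type) law mu ->
  V n x y @[n --> \oo] --> - ln (fine (mu (quadrant x y))).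
Proof.
move=> wmu; have Fcv := maximum_weak_cvg_cdf (x := x) (y := y) wmu.
have ecv : expR (- V n x y) @[n --> \oo] --> fine (mu (quadrant x y)).
  rewrite (_ : (fun n => _) = fun n => F n x y - (F n x y - expR (- V n x y))); last first.
    by apply/funext => n; ring.
  by rewrite -[X in _ --> X]subr0; apply: cvgB => //; exact: asymp.
have mu0 : 0 < fine (mu (quadrant x y)).
  apply: (@lt_le_trans _ _ (expR (- (expR (- x) + expR (- y))))); first exact: expR_gt0.
  apply: (cvgr_to_ge ecv); apply: nearW => n.
  by rewrite ler_expR lerN2 V_le.
rewrite (_ : (fun n => V n x y) = fun n => - ln (expR (- V n x y))); last first.
  by apply/funext => n; rewrite expRK opprK.
by apply: cvgN; apply: (cvg_comp _ _ ecv); exact: continuous_ln.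
Qed.

End maximum_weak_limits.

(** * The limit integrands determine the empirical measures *)

Section convergent_integrals.
Context d (T : measurableType d) (R : realType) (mu_ : nat -> probability T R).
Implicit Types (f g : T -> R).

(** In contrast to [cvg_integral], no limit measure is mentioned, since none is available yet;
    closure under uniform limits rests on completeness of the reals. *)
Definition mean_cvg f := bmeas f /\ cvgn (fun n => \int[mu_ n]_t f t).

Lemma mean_cvg_cst (r : R) : mean_cvg (fun=> r).
Proof.
split; first exact: bmeas_cst.
rewrite (_ : (fun n => _) = fun=> r); first exact: is_cvg_cst.
by apply/funext => n; rewrite Rintegral_prob_cst.
Qed.

Lemma mean_cvgD f g : mean_cvg f -> mean_cvg g -> mean_cvg (fun t => f t + g t).
Proof.
move=> [bf cf] [bg cg]; split; first exact: bmeasD.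
rewrite (_ : (fun n => _) = fun n => \int[mu_ n]_t f t + \int[mu_ n]_t g t).
  exact: (is_cvgD cf cg).
by apply/funext => n; rewrite bmeas_RintegralD.
Qed.

Lemma mean_cvgZ (r : R) f : mean_cvg f -> mean_cvg (fun t => r * f t).
Proof.
move=> [bf cf]; split; first exact: bmeasZ.
rewrite (_ : (fun n => _) = fun n => r * \int[mu_ n]_t f t).
  by apply: is_cvgMr.
by apply/funext => n; rewrite bmeas_RintegralZ.
Qed.

Lemma mean_cvgB f g : mean_cvg f -> mean_cvg g -> mean_cvg (fun t => f t - g t).
Proof.
move=> cf cg; rewrite (_ : (fun t => _) = (fun t => f t + (-1) * g t)).
  exact: (mean_cvgD cf (mean_cvgZ (-1) cg)).
by apply/funext => t; rewrite mulN1r.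
Qed.

Lemma mean_cvg_sum I (r : seq I) (F : I -> T -> R) :
  (forall i, mean_cvg (F i)) -> mean_cvg (fun t => \sum_(i <- r) F i t).
Proof.
move=> cF; elim: r => [|i r ih].
  by under eq_fun do rewrite big_nil; exact: mean_cvg_cst.
by under eq_fun do rewrite big_cons; exact: (mean_cvgD (cF i) ih).
Qed.

Lemma mean_cvg_unif f :
  (forall e : R, 0 < e -> exists2 g, mean_cvg g & forall t, `|f t - g t| <= e) -> mean_cvg f.
Proof.
move=> H; have bf : bmeas f.
  have G n : {g : T -> R | mean_cvg g /\ forall t, `|f t - g t| <= n.+1%:R^-1}.
    by apply: cid; have [|g ? ?] := H n.+1%:R^-1; [|exists g].
  pose g n := sval (G n).
  have gP n : mean_cvg (g n) /\ forall t, `|f t - g n t| <= n.+1%:R^-1 by exact: (svalP (G n)).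
  split.
    apply: (@measurable_fun_cvg _ _ _ setT g) => [n|t _].
      by have [[[mg _] _] _] := gP n.
    apply/cvgrPdist_le => e e0; near=> n.
    have [_ /(_ t) fg] := gP n; apply: (le_trans fg); apply: ltW.
    by near: n; exact: (near_infty_natSinv_lt (PosNum e0)).
  have [[[_ [M gM]] _] fg] := gP 0%N; exists (1 + M) => t.
  have := fg t; rewrite invr1 => h.
  by rewrite -(subrK (g 0%N t) (f t)) (le_trans (ler_normD _ _))// lerD.
split => //; apply/cauchy_cvgP/cauchy_exP => e e0.
have e3 : 0 < e / 3 by rewrite divr_gt0.
have [g [bg cg] fg] := H _ e3.
set a := lim ((fun n => \int[mu_ n]_t g t) @ \oo) in cg.
exists a; have /cvgrPdist_le/(_ _ e3) Hg := cg.
suff : \forall n \near \oo, ball a e (\int[mu_ n]_t f t) by [].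
apply: filterS Hg => n h1.
have := bmeas_Rintegral_dist_le (mu_ n) bf bg (bmeas_cst _ (e / 3)) fg.
rewrite Rintegral_prob_cst distrC => h2; rewrite /ball/=.
apply: (le_lt_trans (ler_distD (\int[mu_ n]_t g t) _ _)).
by apply: (le_lt_trans (lerD h1 h2)); lra.
Unshelve. all: by end_near. Qed.

End convergent_integrals.

Lemma continuous_clamp {R : realType} (a c : R) :
  continuous (fun x => Num.max a (Num.min c x)).
Proof.
have maxl u x y : `|Num.max u x - Num.max u y| <= `|x - y| :> R.
  have := ler_norm (x - y); have := ler_norm (y - x); rewrite (distrC y).
  have := normr_ge0 (x - y); move: `|x - y| => n n0 h1 h2.
  by case: (leP u x) => ?; case: (leP u y) => ?; rewrite ler_norml; apply/andP; split; lra.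
have minl u x y : `|Num.min u x - Num.min u y| <= `|x - y| :> R.
  have := ler_norm (x - y); have := ler_norm (y - x); rewrite (distrC y).
  have := normr_ge0 (x - y); move: `|x - y| => n n0 h1 h2.
  by case: (leP u x) => ?; case: (leP u y) => ?; rewrite ler_norml; apply/andP; split; lra.
apply: (@lipschitz_continuous _ _ 1) => x y; rewrite mul1r.
exact: le_trans (maxl _ _ _) (minl _ _ _).
Qed.

Lemma ext_continuousB {R : realType} (f g : ext_nneg R -> R) :
  continuous f -> continuous g -> continuous (fun l => f l - g l).
Proof.
by move=> cf cg l; apply: (@cvgB _ _ _ (nbhs l) (nbhs_filter l)); [exact: cf|exact: cg].
Qed.

Section determining_functions.
Context {R : realType}.
Local Notation E := (ext_nneg R).
Local Notation h := (@limit_integrand R).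
Local Notation d := (@limit_slope R).
Local Notation Phi := (@std_normal_cdf R).
Local Notation phi := (normal_pdf (0:R) 1).
Implicit Types (r t u x y z : R) (l : E).
Variable nu_ : nat -> probability E R.
Hypothesis mean_cvg_h : forall x y, mean_cvg nu_ (h x y).

Let arg_le z z' r : 0 < r -> z <= z' -> r + z / (2 * r) <= r + z' / (2 * r).
Proof. by move=> r0 zz'; rewrite lerD2l ler_wpM2r// invr_ge0 mulr_ge0// ltW. Qed.

(** Here 9 = 1 + 8: $a^3 \le 1 + a^4$, and $a^4$ is eight times the second-order term of
    $e^{a^2/2}$. *)
Lemma phi_cube_le x : `|x| ^+ 3 * phi x <= 9.
Proof.
have h2 : phi x <= expR (- (x ^+ 2 / 2)).
  by rewrite std_pdfE ler_piMl ?expR_ge0// normal_peak1_le1.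
apply: (@le_trans _ _ (`|x| ^+ 3 * expR (- (x ^+ 2 / 2)))); first by rewrite ler_wpM2l ?exprn_ge0.
have := @expR_ge1Dxn R (x ^+ 2 / 2) 1 (divr_ge0 (sqr_ge0 x) (ler0n _ 2)).
rewrite -[x ^+ 2]real_normK ?num_real//; set a := `|x|.
have a0 : 0 <= a := normr_ge0 x.
rewrite (_ : 2`! = 2%N)// => H; rewrite expRN ler_pdivrMr ?expR_gt0//.
have a3 : a ^+ 3 <= 1 + a ^+ 4.
  have [a1|/ltW a1] := leP a 1.
    by apply: (@le_trans _ _ 1); rewrite ?exprn_ile1// lerDl exprn_ge0.
  apply: (@le_trans _ _ (a ^+ 4)); last by rewrite lerDr.
  by rewrite [leRHS]exprS ler_peMl// exprn_ge0.
have : a ^+ 4 / 8 = (a ^+ 2 / 2) ^+ 2 / 2 by field.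
have := expR_ge1Dx (a ^+ 2 / 2); have := sqr_ge0 a; lra.
Qed.

(** The chain rule produces a factor [(2 * r)^-1], unbounded near 0. It is compensated by
    $c\varphi(c) \le 1$ at a point [c >= z / (2 * r)], which is why [z] has to be positive. *)
Let slope_diff z z' l : 0 < z -> z <= z' -> d z' l - d z l <= (z' - z) / z.
Proof.
move=> z0 zz'; have rhs0 : 0 <= (z' - z) / z by rewrite divr_ge0 ?subr_ge0// ltW.
case: (ext_cases3 l) => [->|->|[r r0 ->]].
- by rewrite !limit_slope_oo subrr.
- by rewrite !limit_slope0 (ltW z0) (le_trans (ltW z0) zz') subrr.
rewrite !limit_slope_real//; have AB := arg_le r0 zz'.
have [c] := Phi_MVT (r + z / (2 * r)) (r + z' / (2 * r)).
rewrite (min_l AB) => /andP[Ac _] ->.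
have c0 : 0 < z / (2 * r) by rewrite divr_gt0 ?mulr_gt0.
have zc : z / (2 * r) <= c by apply: le_trans Ac; rewrite lerDr ltW.
have cpos : 0 < c by exact: lt_le_trans zc.
have := norm_phi_le1 c; rewrite gtr0_norm// => h.
rewrite (_ : _ - _ = (z' - z) / z * (z / (2 * r))); last by field; rewrite !gt_eqF.
rewrite mulrCA ler_piMr//; apply: le_trans h.
by rewrite mulrC ler_wpM2r// ltW// phi_gt0.
Qed.

(* Difference quotients in [s] of [s |-> h s z l], with respect to [expR (- s)], are
   uniformly close to [d z]. *)
Let mean_cvg_d z : 0 < z -> mean_cvg nu_ (d z).
Proof.
move=> z0; apply: mean_cvg_unif => e e0.
pose dl := Num.min (z / 2) (e * z / 2).
have dl0 : 0 < dl by rewrite lt_min !divr_gt0// mulr_gt0.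
have dlz : dl <= z / 2 by rewrite ge_min lexx.
have dle : dl <= e * z / 2 by rewrite ge_min lexx orbT.
have ed : 0 < 1 - expR (- dl) by rewrite subr_gt0 expR_lt1 oppr_lt0.
exists (fun l => (1 - expR (- dl))^-1 * (h 0 z l - h dl z l)).
  apply: mean_cvgZ; exact: (mean_cvgB (mean_cvg_h _ _) (mean_cvg_h _ _)).
move=> l; have /andP[] := limit_integrand_increment z l (ltW dl0).
rewrite oppr0 expR0 addr0 => h1 h2.
have lo : d (z - dl) l <= (1 - expR (- dl))^-1 * (h 0 z l - h dl z l).
  by rewrite ler_pdivlMl.
have up : (1 - expR (- dl))^-1 * (h 0 z l - h dl z l) <= d z l.
  by rewrite ler_pdivrMl.
have zd0 : 0 < z - dl by lra.
have zd1 : z - dl <= z by lra.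
have := slope_diff l zd0 zd1; rewrite ger0_norm ?subr_ge0//.
rewrite opprB addrCA subrr addr0 => H.
have : dl / (z - dl) <= e by rewrite ler_pdivrMr//; nra.
by move: lo H; set q := (_ * _); set a := d _ _; set a' := d _ _; lra.
Qed.

(* The derivative in [z] of [d z l]. *)
Definition slope_density z l : R :=
  if \val l is r%:E then (if r == 0 then 0 else phi (r + z / (2 * r)) / (2 * r)) else 0.
Local Notation k := slope_density.

Let slope_density_real z r : 0 < r -> k z (ext_real r) = phi (r + z / (2 * r)) / (2 * r).
Proof. by move=> r0; rewrite /k/= (max_r (ltW r0)) gt_eqF. Qed.

Let slope_density0 z : k z (ext_real 0) = 0.
Proof. by rewrite /k/= max_r// eqxx. Qed.

Let phi_MVT a c : a <= c -> exists2 x, a <= x <= c & phi c - phi a = - x * phi x * (c - a).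
Proof.
move=> ac; have cF : {within `[a, c], continuous phi}.
  by apply: continuous_subspaceT => x; exact: continuous_phi.
have [x xac E] := MVT_segment ac (fun x _ => is_derive_phi x) cF.
by exists x; [rewrite in_itv/= in xac|].
Qed.

(** Difference quotients of [limit_slope] in [z] converge uniformly: the error is at most
    [x * phi x * dl * (2 * r)^-1 ^+ 2] at some [x >= z / (2 * r)], and trading [(2 * r)^-1] for
    [x / z] leaves the quantity bounded in [phi_cube_le]. *)
Let mean_cvg_k z : 0 < z -> mean_cvg nu_ (k z).
Proof.
move=> z0; apply: mean_cvg_unif => e e0.
pose dl := e * z ^+ 2 / 9.
have dl0 : 0 < dl by rewrite divr_gt0// mulr_gt0// exprn_gt0.
exists (fun l => dl^-1 * (d (z + dl) l - d z l)).
  by apply: mean_cvgZ; apply: (mean_cvgB (mean_cvg_d _) (mean_cvg_d _)) => //; rewrite addr_gt0.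
move=> l; case: (ext_cases3 l) => [->|->|[r r0 ->]].
- by rewrite !limit_slope_oo subrr mulr0 subrr normr0 ltW.
- by rewrite !limit_slope0 slope_density0 !ltW ?addr_gt0// subrr mulr0 subrr normr0.
rewrite slope_density_real// !limit_slope_real//.
have zz' : z <= z + dl by rewrite lerDl ltW.
have AB := arg_le r0 zz'.
have [c] := Phi_MVT (r + z / (2 * r)) (r + (z + dl) / (2 * r)).
rewrite (min_l AB) (max_r AB) => /andP[Ac cB] ->.
rewrite (_ : dl^-1 * _ = phi c / (2 * r)); last by field; rewrite !gt_eqF.
have [x /andP[Ax xc] E] := phi_MVT Ac.
rewrite distrC -mulrBl E.
have A0 : 0 < z / (2 * r) by rewrite divr_gt0 ?mulr_gt0.
have Ax' : z / (2 * r) <= x by apply: le_trans Ax; rewrite lerDr ltW.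
have x0 : 0 < x by exact: lt_le_trans Ax'.
have cA : c - (r + z / (2 * r)) <= dl / (2 * r).
  by rewrite lerBlDl; apply: (le_trans cB); rewrite mulrDl addrA.
have cA0 : 0 <= c - (r + z / (2 * r)) by rewrite subr_ge0.
have p0 := phi_gt0 x.
have i2r : 0 < (2 * r)^-1 by rewrite invr_gt0 mulr_gt0.
rewrite mulNr mulNr mulNr normrN ger0_norm; last by rewrite !mulr_ge0// ltW.
have := phi_cube_le x; rewrite gtr0_norm// => h9.
apply: (@le_trans _ _ (x * phi x * (dl / (2 * r)) / (2 * r))).
  by rewrite ler_pM2r// ler_pM2l// mulr_gt0.
have xz : (2 * r)^-1 <= x / z by rewrite ler_pdivlMr// mulrC.
have xz2 : (2 * r)^-1 ^+ 2 <= (x / z) ^+ 2.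
  by rewrite lerXn2r ?nnegrE// ?(ltW i2r)// divr_ge0// ltW.
rewrite (_ : _ / _ = x * phi x * dl * (2 * r)^-1 ^+ 2); last by rewrite expr2; ring.
apply: (@le_trans _ _ (x * phi x * dl * (x / z) ^+ 2)).
  by rewrite ler_pM2l// !mulr_gt0.
rewrite (_ : _ * _ ^+ 2 = x ^+ 3 * phi x * (dl / z ^+ 2)); last by field; rewrite gt_eqF.
rewrite (_ : dl / z ^+ 2 = e / 9); last by rewrite /dl; field; rewrite gt_eqF.
have : 0 < e / 9 by rewrite divr_gt0.
by move=> e9; rewrite -(ler_pM2r e9) in h9; apply: (le_trans h9); lra.
Qed.

Definition gauss_weight r : R := expR (- (r ^+ 2 / 2)) / r.
Local Notation w := gauss_weight.

(* Completing the square, [k z] is a multiple of [inv_square_kernel (z ^+ 2 / 8)]. The [inv_square_kernel j],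
   with [j > 0] an integer, are [w r] times the powers of [expR (- 1 / r ^+ 2)],
   so that the Weierstrass theorem applies to them. *)
Definition inv_square_kernel t l : R :=
  if \val l is r%:E then (if r == 0 then 0 else w r * expR (- (t / r ^+ 2))) else 0.

Let inv_square_kernel_real t r : 0 < r -> inv_square_kernel t (ext_real r) = w r * expR (- (t / r ^+ 2)).
Proof. by move=> r0; rewrite /inv_square_kernel/= (max_r (ltW r0)) gt_eqF. Qed.

Let inv_square_kernel0 t : inv_square_kernel t (ext_real 0) = 0.
Proof. by rewrite /inv_square_kernel/= max_r// eqxx. Qed.

Let mean_cvg_kernel t : 0 < t -> mean_cvg nu_ (inv_square_kernel t).
Proof.
(* The exponent of [k z] expands to [- r ^+ 2 / 2 - z / 2 - z ^+ 2 / (8 * r ^+ 2)]; this [z] makes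
   [z ^+ 2 / 8] equal to [t]. *)
move=> t0; pose z := Num.sqrt (8 * t).
have z0 : 0 < z by rewrite sqrtr_gt0 mulr_gt0.
have z2 : z ^+ 2 = 8 * t by rewrite sqr_sqrtr// mulr_ge0// ltW.
have pk : 0 < normal_peak (1 : R) by exact: normal_peak_gt0.
rewrite (_ : inv_square_kernel t = fun l => (2 * expR (z / 2) / normal_peak 1) * k z l); last first.
  apply/funext => l; case: (ext_cases3 l) => [->|->|[r r0 ->]].
  - by rewrite /inv_square_kernel/k/= mulr0.
  - by rewrite inv_square_kernel0 slope_density0 mulr0.
  rewrite inv_square_kernel_real// slope_density_real// std_pdfE.
  rewrite (_ : _ * (_ / _) = (expR (z / 2) * expR (- ((r + z / (2 * r)) ^+ 2 / 2))) / r); last first.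
    by field; rewrite !gt_eqF.
  rewrite /w mulrAC -!expRD; congr (expR _ / _).
  rewrite (_ : t = z ^+ 2 / 8); last by rewrite z2; field.
  by field; rewrite gt_eqF.
by apply: mean_cvgZ; exact: mean_cvg_k.
Qed.

Let weight_le1 r : 0 < r -> w r * expR (- (1 / r ^+ 2)) <= 1.
Proof.
move=> r0; rewrite /w -mulrA mulr_ile1 ?expR_ge0//.
- by rewrite mulr_ge0 ?expR_ge0// invr_ge0 ltW.
- by rewrite expR_le1 oppr_le0 divr_ge0// sqr_ge0.
rewrite expRN -invfM invf_le1 ?mulr_gt0 ?expR_gt0//.
have := expR_ge1Dx (1 / r ^+ 2) => H.
apply: (@le_trans _ _ (r * (1 + 1 / r ^+ 2))); last by rewrite ler_pM2l.
rewrite (_ : _ * (1 + _) = r + r^-1); last by field; rewrite gt_eqF.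
have [r1|/ltW r1] := leP 1 r; first by rewrite (le_trans r1)// lerDl invr_ge0 ltW.
by apply: (@le_trans _ _ r^-1); [rewrite invf_ge1|rewrite lerDr ltW].
Qed.

Let inv_radius u : R := (Num.sqrt (- ln u))^-1.

Let inv_radiusK r : 0 < r -> inv_radius (expR (- (1 / r ^+ 2))) = r.
Proof.
move=> r0; rewrite /inv_radius expRK opprK div1r sqrtrV ?exprn_ge0 ?(ltW r0)//.
by rewrite sqrtr_sqr gtr0_norm// invrK.
Qed.

(** Division by the weight is harmless only away from 0 and infinity, whence the support condition.
    The clamp [c] extends the quotient to a continuous function on the line; beyond [al] and [be] it
    is frozen at values where [f] vanishes. *)
Let mean_cvg_supp (f : E -> R) (al be : R) : continuous f -> 0 < al < be ->
  (forall r, 0 <= r <= al -> f (ext_real r) = 0) ->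
  (forall r, be <= r -> f (ext_real r) = 0) -> f ext_oo = 0 -> mean_cvg nu_ f.
Proof.
move=> cf /andP[al0 albe] fal fbe foo; apply: mean_cvg_unif => e e0.
have be0 : 0 < be by exact: lt_trans albe.
pose u r := expR (- (1 / r ^+ 2)).
have u_homo r s : 0 < r -> r <= s -> u r <= u s.
  move=> r0 rs; rewrite /u ler_expR lerN2 !div1r lef_pV2 ?posrE ?exprn_gt0//; last exact: lt_le_trans rs.
  by rewrite lerXn2r ?nnegrE ?(ltW r0)// (le_trans (ltW r0) rs).
have u01 r : 0 < r -> 0 < u r < 1.
  by move=> r0; rewrite expR_gt0 expR_lt1 oppr_lt0 divr_gt0// exprn_gt0.
have /andP[lo0 _] := u01 _ al0; have /andP[_ hi1] := u01 _ be0.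
have lohi : u al <= u be by apply: u_homo => //; exact: ltW.
pose c x := Num.max (u al) (Num.min (u be) x).
have cin x : u al <= c x <= u be by rewrite /c le_max lexx ge_max lohi ge_min lexx.
(* The additional factor [v] is divided out because the kernels are available for positive
   parameters only, so every power of [u r] has exponent at least 1. *)
pose G v := f (ext_real (inv_radius v)) / (w (inv_radius v) * v).
pose F x := G (c x).
have cG v : 0 < v < 1 -> {for v, continuous G}.
  move=> /andP[v0 v1].
  have nl : 0 < - ln v by rewrite oppr_gt0 ln_lt0// v0.
  have sq : 0 < Num.sqrt (- ln v) by rewrite sqrtr_gt0.
  have ci : {for v, continuous inv_radius}.
    apply: cvgV; first by rewrite gt_eqF.
    apply: (@cvg_comp _ _ _ (fun x => - ln x) Num.sqrt); last exact: sqrt_continuous.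
    by apply: cvgN; exact: continuous_ln.
  have ir0 : 0 < inv_radius v by rewrite invr_gt0.
  apply: cvgM.
    apply: (@cvg_comp _ _ _ inv_radius (f \o ext_real)); first exact: ci.
    have cfe : {for inv_radius v, continuous (f \o ext_real)}.
      by apply: continuous_comp; [exact: continuous_ext_real|exact: cf].
    exact: cfe.
  apply: cvgV; first by rewrite mulf_neq0// ?gt_eqF// /w divr_gt0 ?expR_gt0.
  apply: cvgM; last exact: cvg_id.
  apply: cvgM; last by apply: cvgV; [rewrite gt_eqF|exact: ci].
  apply: (@cvg_comp _ _ _ (fun x => - (inv_radius x ^+ 2 / 2)) expR); last exact: continuous_expR.
  by apply: cvgN; apply: cvgMl; apply: cvgM; exact: ci.
have cc : continuous c.
  exact: continuous_clamp.
have cF : continuous F.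
  move=> x; apply: (@continuous_comp _ _ _ c G); first exact: cc.
  by apply: cG; have /andP[h1 h2] := cin x; rewrite (lt_le_trans lo0 h1) (le_lt_trans h2 hi1).
have [p pF] := weierstrass01 cF e0.
exists (fun l => \sum_(j < size p) p`_j * inv_square_kernel j.+1%:R l).
  by apply: mean_cvg_sum => j; apply: mean_cvgZ; apply: mean_cvg_kernel.
move=> l; case: (ext_cases3 l) => [->|->|[r r0 ->]].
- by rewrite foo big1 ?subrr ?normr0 ?(ltW e0)// => j _; rewrite /inv_square_kernel/= mulr0.
- rewrite fal ?lexx ?(ltW al0)// big1 ?subrr ?normr0 ?(ltW e0)// => j _.
  by rewrite inv_square_kernel0 mulr0.
have /andP[ur0 ur1] := u01 _ r0.
have wr0 : 0 < w r by rewrite divr_gt0 ?expR_gt0.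
have -> : \sum_(j < size p) p`_j * inv_square_kernel j.+1%:R (ext_real r) = w r * u r * p.[u r].
  rewrite horner_coef mulr_sumr; apply: eq_bigr => j _.
  rewrite inv_square_kernel_real// (_ : expR _ = u r ^+ j.+1); first by rewrite exprS; ring.
  by rewrite /u -expRM_natl; congr expR; field; rewrite gt_eqF.
have fE : f (ext_real r) = w r * u r * F (u r).
  rewrite /F /c; have [ral|alr] := leP r al.
    have h : u r <= u al by exact: u_homo.
    rewrite fal ?ral ?(ltW r0)// (max_l (_ : Num.min _ _ <= _)); last by rewrite ge_min h orbT.
    by rewrite /G inv_radiusK// fal ?lexx ?(ltW al0)// mul0r mulr0.
  have h : u al <= u r by apply: u_homo => //; exact: ltW.
  have [ber|rbe] := leP be r.
    have h' : u be <= u r by exact: u_homo.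
    by rewrite fbe// (min_l h') (max_r lohi) /G inv_radiusK// fbe// mul0r mulr0.
  have h' : u r <= u be by apply: u_homo => //; exact: ltW.
  rewrite (min_r h') (max_r h) /G inv_radiusK//.
  by field; rewrite !gt_eqF.
have wu0 : 0 <= w r * u r by exact: ltW (mulr_gt0 wr0 ur0).
rewrite fE -mulrBr normrM (ger0_norm wu0).
have h1 : `|F (u r) - p.[u r]| <= e by apply: pF; rewrite (ltW ur0) (ltW ur1).
rewrite -[leRHS]mul1r; apply: ler_pM h1 => //.
exact: weight_le1.
Qed.

(** Soft thresholding: subtracting the clamp of [f] to [[- e, e]] moves [f] by at most [e] and makes
    it vanish near 0 and near infinity. *)
Let mean_cvg_vanish (f : E -> R) : continuous f ->
  f (ext_real 0) = 0 -> f ext_oo = 0 -> mean_cvg nu_ f.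
Proof.
move=> cf f0 foo; apply: mean_cvg_unif => e e0.
pose g x := Num.max (- e) (Num.min e x) : R.
have ge x : `|x| <= e -> g x = x.
  by rewrite ler_norml => /andP[h1 h2]; rewrite /g (min_r h2) max_r.
have gl x : `|g x| <= e.
  by rewrite /g ler_norml le_max lexx ge_max ge_min lexx /= andbT; lra.
have cg : continuous g by exact: continuous_clamp.
have cfg : continuous (fun l => f l - g (f l)).
  apply: ext_continuousB => [|l]; first exact: cf.
  by apply: (@continuous_comp _ _ _ f g); [exact: cf|exact: cg].
have [al [al0 fal]] : exists al, 0 < al /\ forall r, 0 <= r <= al -> `|f (ext_real r)| <= e.
  have c0 : {for 0, continuous (f \o ext_real)}.
    by apply: continuous_comp; [exact: continuous_ext_real|exact: cf].
  have /cvgrPdist_le/(_ _ e0)/nbhs_ballP[al /= al0 H] := c0.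
  exists (al / 2); split; first by rewrite divr_gt0.
  move=> r /andP[r0 ral]; have := H r; rewrite /= f0 sub0r normrN; apply.
  by rewrite /ball/= sub0r normrN ger0_norm//; lra.
have [M fM] : exists M, forall r, M <= r -> `|f (ext_real r)| <= e.
  have c1 : f (ext_real r) @[r --> +oo] --> f ext_oo.
    by apply: (cvg_comp _ _ (@cvg_ext_real_oo R)); exact: cf.
  have /cvgrPdist_le/(_ _ e0)[M [_ H]] := c1.
  exists (M + 1) => r Mr; have := H r; rewrite foo sub0r normrN; apply; lra.
exists (fun l => f l - g (f l)).
  apply: (@mean_cvg_supp _ al (Num.max (al + 1) M)) => //.
  - by rewrite al0 lt_max ltrDl ltr01.
  - by move=> r /fal /ge ->; rewrite subrr.
  - by move=> r; rewrite ge_max => /andP[_ /fM /ge ->]; rewrite subrr.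
  - by rewrite foo ge ?subrr// normr0 ltW.
by move=> l; rewrite opprB addrCA subrr addr0.
Qed.

Theorem mean_cvg_continuous (f : E -> R) : continuous f -> mean_cvg nu_ f.
Proof.
move=> cf; pose a := f (ext_real 0); pose c := f ext_oo.
(* [h 0 0] is 1 at 0 and 2 at infinity, so an affine function of it matches both boundary values of
   [f]. *)
rewrite (_ : f = fun l => (f l - (a + (c - a) * (h 0 0 l - 1))) + (a + (c - a) * (h 0 0 l - 1))); last first.
  by apply/funext => l; rewrite subrK.
have cH : mean_cvg nu_ (fun l => a + (c - a) * (h 0 0 l - 1)).
  apply: (mean_cvgD (mean_cvg_cst _ a)); apply: mean_cvgZ.
  exact: (mean_cvgB (mean_cvg_h 0 0) (mean_cvg_cst _ 1)).
apply: (mean_cvgD _ cH); apply: mean_cvg_vanish.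
- apply: ext_continuousB => [|l]; first exact: cf.
  have cA : continuous (fun x => a + (c - a) * (x - 1)).
    move=> x; apply: cvgD; first exact: cvg_cst.
    by apply: cvgMr; apply: cvgB; [exact: cvg_id|exact: cvg_cst].
  by apply: (@continuous_comp _ _ _ (h 0 0) (fun x => a + (c - a) * (x - 1))); [exact: continuous_limit_integrand|exact: cA].
- by rewrite limit_integrand0 minxx oppr0 expR0 -/a; ring.
- by rewrite limit_integrand_oo oppr0 expR0 -/c; ring.
Qed.

End determining_functions.

(** * Weak convergence on the extended half-line *)

(** Differences of ramps at successive nodes are nonnegative and telescope to 1 on [0, 1]. For
    [N < k] a ramp falls within one mesh, so the i-th weight lives at distance less than one mesh
    from its node. *)
Lemma ramp_grid {R : realType} (g : R -> R) (e : R) : continuous g -> 0 < e ->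
  exists N : nat, forall k : nat, (N < k)%N -> forall u, 0 <= u <= 1 ->
  `|g u - \sum_(i < N.+2) g (i%:R / N.+1%:R) *
     (ramp k%:R (i%:R / N.+1%:R) u - ramp k%:R (i%:R / N.+1%:R - N.+1%:R^-1) u)| <= e.
Proof.
move=> cg e0.
have [r r0 gr] := compact_unif_dist (segment_compact (a := 0) (b := 1)) cg e0.
near \oo => N; exists N => k Nk u /andP[u0 u1].
have Nr : N.+1%:R^-1 < r by near: N; exact: (near_infty_natSinv_lt (PosNum r0)).
set v : R := N.+1%:R^-1 in Nr *; pose a (j : nat) : R := j%:R * v - v.
have v0 : 0 < v by rewrite invr_gt0.
have aS j : a j.+1 = j%:R * v by rewrite /a -addn1 natrD; ring.
have kv : 1 <= k%:R * v by rewrite ler_pdivlMr// mul1r ler_nat.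
pose f (j : nat) := ramp k%:R (a j) u.
have f1 : \sum_(i < N.+2) (f i.+1 - f i) = 1.
  rewrite -(big_mkord xpredT (fun i => f i.+1 - f i)) telescope_sumr// /f.
  rewrite ramp_eq1//; last by rewrite aS divff// pnatr_eq0.
  rewrite ramp_eq0 ?subr0// /a mul0r sub0r opprK mulrDr.
  by apply: (le_trans kv); rewrite lerDr mulr_ge0.
have f_homo j : 0 <= f j.+1 - f j.
  by rewrite subr_ge0 ramp_homo// aS gerBl ltW.
have -> : g u - \sum_(i < N.+2) g (i%:R * v) * (ramp k%:R (i%:R * v) u - ramp k%:R (i%:R * v - v) u) =
    \sum_(i < N.+2) (g u - g (i%:R * v)) * (f i.+1 - f i).
  rewrite -[X in X - _]mulr1 -[X in _ * X - _]f1 mulr_sumr -sumrB; apply: eq_bigr => i _.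
  by rewrite /f aS mulrBl.
apply: (le_trans (ler_norm_sum _ _ _)).
rewrite -[leRHS]mulr1 -[X in _ <= e * X]f1 mulr_sumr; apply: ler_sum => i _.
rewrite normrM [X in _ * X]ger0_norm//.
have [ui|iu] := leP u (a i).
  rewrite /f !ramp_eq1 ?subrr ?mulr0//.
  by apply: (le_trans ui); rewrite aS gerBl ltW.
have [ui|ui] := leP (a i + 2 * v) u.
  suff [-> ->] : f i.+1 = 0 /\ f i = 0 by rewrite subrr !mulr0.
  have h : k%:R * v <= k%:R * (u - a i.+1).
    by rewrite ler_wpM2l// aS; move: ui; rewrite /a; lra.
  split; apply: ramp_eq0; apply: (le_trans kv) => //.
  by apply: (le_trans h); rewrite ler_wpM2l// lerD2l lerN2 aS gerBl ltW.
rewrite ler_wpM2r// ltW// gr//=; first by rewrite in_itv/= u0 u1.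
apply: lt_trans Nr; rewrite /ball/= ltr_norml; apply/andP.
by move: iu ui; rewrite /a; split; lra.
Unshelve. all: by end_near. Qed.

Section weak_convergence_halfline.
Context {R : realType}.
Local Notation E := (ext_nneg R).

Definition ramp_mean (P : probability E R) (k : nat) (t : R) : R :=
  \int[P]_l ramp k%:R t (expN l).
Local Notation J := ramp_mean.

Lemma continuous_ramp_expN (k : nat) (t : R) :
  @bounded_continuous R E (fun l => ramp k%:R t (expN l)).
Proof.
split.
  by move=> l; apply: (@continuous_comp _ _ _ (@expN R) (ramp k%:R t));
    [exact: continuous_expN|exact: ramp_continuous].
exists 1; split; first exact: num_real.
by move=> M M1 l _ /=; apply: (le_trans (norm_ramp_le1 _ _ _)); exact: ltW.
Qed.

Lemma bmeas_ramp_expN (k : nat) (t : R) : bmeas (fun l : E => ramp k%:R t (expN l)).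
Proof. exact: bmeas_ext (continuous_ramp_expN k t). Qed.

Lemma ramp_mean01 P k t : 0 <= J P k t <= 1.
Proof.
apply/andP; split.
  rewrite -(Rintegral_prob_cst P 0); apply: le_bmeas_Rintegral; [exact: bmeas_cst|exact: bmeas_ramp_expN|].
  by move=> l; exact: ramp_ge0.
rewrite -(Rintegral_prob_cst P 1); apply: le_bmeas_Rintegral; [exact: bmeas_ramp_expN|exact: bmeas_cst|].
by move=> l; exact: ramp_le1.
Qed.

Lemma ramp_mean_homo P k : {homo J P k : t t' / t <= t'}.
Proof.
move=> t t' tt'; apply: le_bmeas_Rintegral; [exact: bmeas_ramp_expN|exact: bmeas_ramp_expN|].
by move=> l; exact: ramp_homo.
Qed.

Lemma ramp_mean_anti P t : {homo (J P)^~ t : k k' / (k <= k')%N >-> k' <= k}.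
Proof.
move=> k k' kk'; apply: le_bmeas_Rintegral; [exact: bmeas_ramp_expN|exact: bmeas_ramp_expN|].
move=> l; have [lt|tl] := leP (expN l) t; first by rewrite !ramp_eq1.
rewrite /ramp ge_max; apply/andP; split; first by rewrite le_max lexx.
rewrite le_max; apply/orP; right; rewrite le_min !ge_min lexx/=; apply/orP; right.
rewrite lerD2l ler_wnM2r ?ler_nat// subr_le0 ltW//.
Qed.

Lemma ramp_mean_lip P k t (r : R) : 0 <= r -> J P k (t + r) <= J P k t + k%:R * r.
Proof.
move=> r0; rewrite -(Rintegral_prob_cst P (k%:R * r)).
rewrite -bmeas_RintegralD; [|exact: bmeas_ramp_expN|exact: bmeas_cst].
apply: le_bmeas_Rintegral; [exact: bmeas_ramp_expN|apply: bmeasD; [exact: bmeas_ramp_expN|exact: bmeas_cst]|].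
move=> l; have := @ramp_lip R k%:R (t + r) t (expN l) (expN l) (ler0n _ _).
rewrite (_ : _ - _ - _ = r); last by ring.
by rewrite (ger0_norm r0) => /(le_trans (ler_norm _)); rewrite lerBlDl.
Qed.

Lemma ramp_mean_lo P : J P 1 (-1) = 0.
Proof.
rewrite /J (_ : (fun l => _) = fun=> 0); first by rewrite Rintegral_prob_cst.
by apply/funext => l; rewrite ramp_eq0// mul1r opprK lerDr expN_ge0.
Qed.

Lemma ramp_mean_hi P k (t : R) : 1 <= t -> J P k t = 1.
Proof.
move=> t1; rewrite /J (_ : (fun l => _) = fun=> 1); first by rewrite Rintegral_prob_cst.
by apply/funext => l; rewrite ramp_eq1// (le_trans (expN_le1 l)).
Qed.

Lemma ramp_mean_cvg P t : J P k t @[k --> \oo] --> fine (P (@expN R @^-1` `]-oo, t])).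
Proof.
have mE : measurable (@expN R @^-1` `]-oo, t]).
  by apply: measurable_preimage; [exact: measurable_expN|exact: measurable_itv].
rewrite -(Rintegral_prob_indic P mE).
apply: (@bounded_cvg_Rintegral _ _ _ _ _ _ 1) => [n|n x|x].
- by have [] := bmeas_ramp_expN n t.
- exact: norm_ramp_le1.
- exact: ramp_cvg.
Qed.

(** A continuous function is approximated by combinations of ramps uniformly over all probabilities.
    The limits in [n] and [k] are never interchanged: it suffices that [A k] and the ramp means of
    [nu] have the same limit [F]. *)
Lemma weak_cvg_ramp_mean (nu_ : nat -> probability E R) (nu : probability E R)
    (A : nat -> R -> R) (F : R -> R) :
  (forall k t, J (nu_ n) k t @[n --> \oo] --> A k t) ->
  (forall t, A k t @[k --> \oo] --> F t) ->
  (forall t, J nu k t @[k --> \oo] --> F t) ->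
  weak_cvg (@bounded_continuous R E) nu_ nu.
Proof.
have aux (e a a' v v' w : R) : `|w - a| <= e / 12 -> `|w - a'| <= e / 12 ->
    `|v - a'| <= e / 3 -> `|a - v'| <= e / 3 + e / 6 -> `|v - v'| <= e.
  by rewrite !ler_norml => /andP[? ?] /andP[? ?] /andP[? ?] /andP[? ?]; apply/andP; split; lra.
move=> cA AF JF f bcf; have [cf _] := bcf; have bf := bmeas_ext bcf.
apply/cvgrPdist_le => e e0; have e3 : 0 < e / 3 by rewrite divr_gt0.
have cg : continuous (f \o einv).
  by move=> u; apply: continuous_comp; [exact: continuous_einv|exact: cf].
have [N gN] := ramp_grid cg e3.
pose c (i : nat) := (f \o einv) (i%:R / N.+1%:R).
pose S (G : R -> R) : R := \sum_(i < N.+2) c i *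
     (G (i%:R / N.+1%:R) - G (i%:R / N.+1%:R - N.+1%:R^-1)).
have SP (P : probability E R) k : (N < k)%N -> `|\int[P]_l f l - S (J P k)| <= e / 3.
  move=> Nk.
  have bw i : bmeas (fun l : E => c i * (ramp k%:R (i%:R / N.+1%:R) (expN l) - ramp k%:R (i%:R / N.+1%:R - N.+1%:R^-1) (expN l))).
    by apply: bmeasZ; apply: bmeasB; exact: bmeas_ramp_expN.
  have [bS SE] : bmeas (fun l : E => S (fun t => ramp k%:R t (expN l))) /\
      \int[P]_l S (fun t => ramp k%:R t (expN l)) = S (J P k).
    rewrite /S; elim: (index_enum _) => [|i s [ih1 ih2]].
      under eq_fun do rewrite big_nil.
      by split; [exact: bmeas_cst|rewrite Rintegral_prob_cst big_nil].
    under eq_fun do rewrite big_cons.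
    split; first exact: bmeasD.
    rewrite bmeas_RintegralD// ih2 big_cons; congr (_ + _).
    rewrite bmeas_RintegralZ; last by apply: bmeasB; exact: bmeas_ramp_expN.
    by rewrite bmeas_RintegralB//; exact: bmeas_ramp_expN.
  rewrite -SE -(Rintegral_prob_cst P (e / 3)).
  apply: bmeas_Rintegral_dist_le => //; first exact: bmeas_cst.
  move=> l; have := gN k Nk (expN l); rewrite expN_ge0 expN_le1 /= expNK.
  exact.
have S_cvg (G_ : nat -> R -> R) (G : R -> R) :
    (forall t, G_ n t @[n --> \oo] --> G t) -> S (G_ n) @[n --> \oo] --> S G.
  move=> GG; rewrite /S; elim: (index_enum _) => [|i s ih].
    by rewrite big_nil; under eq_fun do rewrite big_nil; exact: cvg_cst.
  rewrite big_cons; under eq_fun do rewrite big_cons.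
  by apply: cvgD ih; apply: cvgMr; apply: cvgB; exact: GG.
have h1 k : (N < k)%N -> \forall n \near \oo, `|S (A k) - \int[nu_ n]_l f l| <= e / 3 + e / 6.
  move=> Nk; have e6 : 0 < e / 6 by rewrite divr_gt0.
  have /cvgrPdist_le/(_ _ e6) := S_cvg (fun n => J (nu_ n) k) (A k) (cA k).
  apply: filterS => n H.
  have := SP (nu_ n) k Nk; rewrite distrC => H'.
  apply: (le_trans (ler_distD (S (J (nu_ n) k)) _ _)).
  by rewrite [leRHS]addrC; exact: lerD.
have e12 : 0 < e / 12 by rewrite divr_gt0.
have /cvgrPdist_le/(_ _ e12) HA := S_cvg A F AF.
have /cvgrPdist_le/(_ _ e12) HJ := S_cvg (J nu) F JF.
near \oo => k.
have Nk : (N < k)%N by near: k; exact: nbhs_infty_gt.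
have k1 : `|S F - S (A k)| <= e / 12 by near: k.
have k2 : `|S F - S (J nu k)| <= e / 12 by near: k.
have k3 := SP nu k Nk.
apply: filterS (h1 k Nk) => n k4.
exact: aux k1 k2 k3 k4.
Unshelve. all: by end_near. Qed.

(** The limits [A k] of the ramp means are monotone and Lipschitz in [t], and [F] is their
    decreasing limit in [k]; an infimum of continuous nondecreasing functions is right continuous.
    No mass escapes because [expN] takes values in [0, 1], and [einv] carries the law back. *)
Theorem weak_limit_exists (nu_ : nat -> probability E R) :
  (forall f, @bounded_continuous R E f -> cvgn (fun n => \int[nu_ n]_l f l)) ->
  exists nu : probability E R, weak_cvg (@bounded_continuous R E) nu_ nu.
Proof.
move=> cv; pose A k t := lim (J (nu_ n) k t @[n --> \oo]).
have cA k t : J (nu_ n) k t @[n --> \oo] --> A k t.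
  exact: cv (continuous_ramp_expN k t).
have A01 k t : 0 <= A k t <= 1.
  apply/andP; split; [apply: limr_ge; first exact: cA|apply: limr_le; first exact: cA];
    by apply: nearW => n; have /andP[] := ramp_mean01 (nu_ n) k t.
have Ahomo k : {homo A k : t t' / t <= t'}.
  move=> t t' tt'; apply: ler_lim; [exact: cA|exact: cA|].
  by apply: nearW => n; exact: ramp_mean_homo.
have Aanti t : {homo A^~ t : k k' / (k <= k')%N >-> k' <= k}.
  move=> k k' kk'; apply: ler_lim; [exact: cA|exact: cA|].
  by apply: nearW => n; exact: ramp_mean_anti.
have Alip k t (r : R) : 0 <= r -> A k (t + r) <= A k t + k%:R * r.
  move=> r0; have h : J (nu_ n) k t + k%:R * r @[n --> \oo] --> A k t + k%:R * r.
    by apply: cvgD; [exact: cA|exact: cvg_cst].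
  rewrite -(cvg_lim (@Rhausdorff R) h); apply: ler_lim; [exact: cA|by apply: cvgP h|].
  by apply: nearW => n; exact: ramp_mean_lip.
have cF t : cvgn (A^~ t).
  apply: nonincreasing_is_cvgn; first by move=> k k' /Aanti.
  by exists 0 => _ [k _ <-]; have /andP[] := A01 k t.
pose F t := lim (A k t @[k --> \oo]).
have FA k t : F t <= A k t.
  by apply: nonincreasing_cvgn_ge; [move=> ? ? /Aanti|exact: cF].
have F01 t : 0 <= F t <= 1.
  apply/andP; split; [apply: limr_ge; first exact: cF|apply: limr_le; first exact: cF];
    by apply: nearW => k; have /andP[] := A01 k t.
have A_hi k (t : R) : 1 <= t -> A k t = 1.
  move=> t1; apply: (cvg_lim (@Rhausdorff R)); apply: cvg_near_cst; apply: nearW => n.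
  exact: ramp_mean_hi.
have F_hi (t : R) : 1 <= t -> F t = 1.
  move=> t1; apply: (cvg_lim (@Rhausdorff R)); apply: cvg_near_cst; apply: nearW => k.
  exact: A_hi.
have cdfF : is_cdf F.
  split; [|exact: F01|..].
  - move=> t t' tt'; apply: ler_lim; [exact: cF|exact: cF|].
    by apply: nearW => k; exact: Ahomo.
  - move=> y e e0; have e2 : 0 < e / 2 by rewrite divr_gt0.
    have /cvgrPdist_le/(_ _ e2) H : A k y @[k --> \oo] --> F y by exact: cF.
    near \oo => k.
    have Fk : `|F y - A k y| <= e / 2 by near: k.
    have r0 : 0 < e / 2 / k.+1%:R by rewrite divr_gt0.
    exists (e / 2 / k.+1%:R) => //; apply: (le_trans (FA k _)).
    have : A k (y + e / 2 / k.+1%:R) <= A k y + k%:R * (e / 2 / k.+1%:R).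
      exact: Alip (ltW r0).
    have : k%:R * (e / 2 / k.+1%:R) <= e / 2.
      by rewrite mulrCA ler_piMr ?(ltW e2)// ler_pdivrMr// mul1r ler_nat.
    move=> h1 h2; apply: (le_trans h2); apply: (le_trans (lerD (lexx _) h1)).
    move: Fk; rewrite distrC => /(le_trans (ler_norm _)); rewrite lerBlDl => Fk.
    by rewrite [X in _ <= _ + X](splitr e) addrA lerD2r.
  - move=> e e0; exists (-1); apply: (le_trans (FA 1%N _)).
    rewrite (_ : A 1%N (-1) = 0) ?(ltW e0)//.
    apply: (cvg_lim (@Rhausdorff R)); apply: cvg_near_cst; apply: nearW => n.
    exact: ramp_mean_lo.
  - by move=> e e0; exists 1; rewrite F_hi// lerBlDr lerDl ltW.
have [kap kapE] := is_cdf_probability cdfF.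
pose X : {mfun (R : measurableType _) >-> E} := mfun_Sub (mem_set (@measurable_einv R)).
exists (distribution kap X).
apply: (@weak_cvg_ramp_mean _ _ A F cA) => t; first exact: cF.
have mE (s : R) : measurable (@expN R @^-1` `]-oo, s]).
  by apply: measurable_preimage; [exact: measurable_expN|exact: measurable_itv].
suff -> : F t = fine (distribution kap X (@expN R @^-1` `]-oo, t])) by exact: ramp_mean_cvg.
have pre : X @^-1` (@expN R @^-1` `]-oo, t]) = [set u | Num.max 0 (Num.min 1 u) <= t].
  by apply/seteqP; split=> u /=; rewrite in_itv/= expN_einv.
rewrite /distribution /pushforward pre.
have [t0|t0] := ltP t 0.
  rewrite (_ : [set u | _] = set0) ?measure0; last first.
    by apply/seteqP; split => u //=; rewrite leNgt lt_max t0.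
  rewrite /=; apply/eqP; rewrite eq_le; have /andP[-> _] := F01 t; rewrite andbT.
  near \oo => k.
  have kt : 1 <= k%:R * (- t).
    rewrite -ler_pdivrMr ?oppr_gt0//; near: k; exact: nbhs_infty_ger.
  apply: (le_trans (FA k _)); rewrite (_ : A k t = 0)//.
  apply: (cvg_lim (@Rhausdorff R)); apply: cvg_near_cst; apply: nearW => n.
  rewrite /J (_ : (fun l => _) = fun=> 0); first by rewrite Rintegral_prob_cst.
  apply/funext => l; rewrite ramp_eq0//; apply: (le_trans kt).
  by rewrite ler_wpM2l// lerDr expN_ge0.
have [t1|t1] := leP 1 t.
  rewrite (_ : [set u | _] = setT) ?probability_setT ?F_hi//.
  by apply/seteqP; split => u //= _; rewrite ge_max t0 ge_min t1.
rewrite (_ : [set u | _] = `]-oo, t]%classic) ?kapE//.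
apply/seteqP; split => u /=; rewrite in_itv/= ge_max t0/= ge_min leNgt t1/=//.
Unshelve. all: by end_near. Qed.

End weak_convergence_halfline.

(** * An i.i.d. sequence of Gaussian pairs *)

Section clip.
Context {R : realType}.
Implicit Types x y : R.

Definition clip x := Num.max 0 (Num.min 1 x).

Lemma clipE x : [\/ x <= 0 /\ clip x = 0, 0 <= x <= 1 /\ clip x = x | 1 <= x /\ clip x = 1].
Proof.
rewrite /clip; have [x0|x0] := leP x 0; first by constructor 1; rewrite min_r ?max_l// (le_trans x0).
have [x1|x1] := leP 1 x; first by constructor 3; rewrite max_r.
by constructor 2; rewrite max_r ?(ltW x0) ?(ltW x1).
Qed.

Lemma clip01 x : 0 <= clip x <= 1.
Proof. by case: (clipE x) => -[h ->] //; rewrite ?lexx ler01. Qed.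

(** Self-similarity of the uniform law, whose distribution function is [clip]: conditioning on the
    first binary digit. *)
Lemma clip_half x : clip x = 2^-1 * clip (2 * x) + 2^-1 * clip (2 * x - 1).
Proof.
case: (clipE x) => -[h ->]; case: (clipE (2 * x)) => -[h' ->];
  case: (clipE (2 * x - 1)) => -[h'' ->]; lra.
Qed.

Lemma continuous_clip : continuous clip.
Proof. exact: continuous_clamp. Qed.

End clip.

Section restricted_law.
Context d (T : measurableType d) (R : realType) (P : probability T R).
Variables (p : T -> R) (E : set T).
Hypotheses (mp : measurable_fun setT p) (mE : measurable E).
Local Open Scope ereal_scope.

(** A finite measure in [A] for each fixed event [E]: independence can then be extended from
    half-lines to Borel sets by uniqueness, one variable at a time. *)
Definition restricted_law (A : set R) := P (p @^-1` A `&` E).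

Let restricted0 : restricted_law set0 = 0.
Proof. by rewrite /restricted_law preimage_set0 set0I measure0. Qed.

Let restricted_ge0 A : 0 <= restricted_law A.
Proof. exact: measure_ge0. Qed.

Let restricted_sigma_additive : semi_sigma_additive restricted_law.
Proof.
move=> F mF tF mUF; rewrite /restricted_law preimage_bigcup setI_bigcupl.
apply: measure_semi_sigma_additive.
- by move=> n; apply: measurableI => //; exact: measurable_preimage.
- apply/trivIsetP => /= i j _ _ ij; rewrite setIACA setIid -preimage_setI.
  by move/trivIsetP : tF => /(_ _ _ _ _ ij) ->//; rewrite preimage_set0 set0I.
- rewrite -setI_bigcupl -preimage_bigcup; apply: measurableI => //.
  exact: measurable_preimage.
Qed.

HB.instance Definition _ := isMeasure.Build _ _ _
  restricted_law restricted0 restricted_ge0 restricted_sigma_additive.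

Lemma restricted_law_unique (U : probability R R) (c : {nonneg R}) :
  (forall x : R, P (p @^-1` `]-oo, x]%classic `&` E) = c%:num%:E * U `]-oo, x]%classic) ->
  P E = c%:num%:E ->
  forall A, measurable A -> P (p @^-1` A `&` E) = c%:num%:E * U A.
Proof.
move=> H PE A mA.
have rT : restricted_law setT = P E by rewrite /restricted_law preimage_setT setTI.
apply: (@measure_Nyc_unique R restricted_law (mscale c U)) => //.
- have uT : mscale c U setT = c%:num%:E by rewrite /mscale/= (probability_setT U) mule1.
  exact: (etrans rT (etrans PE (esym uT))).
- by rewrite [X in (X < _)%E]rT; apply: le_lt_trans (ltry 1); exact: probability_le1.
Qed.

End restricted_law.

(** * Splitting one uniform variable into two independent ones *)

Section uniform_splitting.
Context {R : realType}.
Implicit Types (u x y t : R).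
Variable U : probability R R.
Hypothesis U_cdf : forall t : R, 0 <= t <= 1 -> U `]-oo, t]%classic = t%:E.
Hypothesis U01 : U `]0, 1[%classic = 1%E.

Lemma uniform_ext A B : measurable A -> measurable B ->
  (forall u, 0 < u < 1 -> A u <-> B u) -> U A = U B.
Proof.
move=> mA mB AB; have m01 : measurable (`]0, 1[%classic : set R) by exact: measurable_itv.
have N0 : U (~` `]0, 1[%classic) = 0%E.
  rewrite -(fineK (probability_fin_num U (measurableC m01))).
  by rewrite fine_probability_setC// U01/= subrr.
have I C : measurable C -> U C = U (C `&` `]0, 1[%classic).
  move=> mC; rewrite (measureDI U mC m01).
  rewrite [X in (X + _)%E](_ : _ = 0%E) ?add0e//.
  apply/eqP; rewrite eq_le measure_ge0 andbT -N0; apply: le_measure; rewrite ?inE//.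
  - exact: measurableD.
  - exact: measurableC.
rewrite I// (I B)//; congr (U _); apply/seteqP; split => u [uA] /=; rewrite in_itv/= => u01.
  by split => //; apply/AB.
by split => //; apply/AB.
Qed.

Lemma uniform_clip x : U `]-oo, x]%classic = (clip x)%:E.
Proof.
apply: uniform_set (clip01 x) _ => // u u01 /=; rewrite in_itv/=; move: u01 => /andP[u0 u1].
by case: (clipE x) => -[h ->] //; split; lra.
Qed.

Let s0 u := u / 2.
Let s1 u := (u + 1) / 2.

Let ms0 : measurable_fun setT s0.
Proof. exact: measurable_funM. Qed.

Let ms1 : measurable_fun setT s1.
Proof. by apply: measurable_funM => //; exact: measurable_funD. Qed.

Let half_ge0 : 0 <= 2^-1 :> R. Proof. by rewrite invr_ge0. Qed.
Let half : {nonneg R} := NngNum half_ge0.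

Let uniform_half A : measurable A ->
  U A = (2^-1%:E * U (s0 @^-1` A) + 2^-1%:E * U (s1 @^-1` A))%E.
Proof.
move=> mA.
pose S0 : {mfun (R : measurableType _) >-> (R : measurableType _)} := mfun_Sub (mem_set ms0).
pose S1 : {mfun (R : measurableType _) >-> (R : measurableType _)} := mfun_Sub (mem_set ms1).
pose m1 := mscale half (distribution U S0).
pose m2 := mscale half (distribution U S1).
have -> : U A = measure_add m1 m2 A; last by rewrite measure_addE.
apply: measure_Nyc_unique => //.
- move=> x; rewrite -[RHS]/(measure_add m1 m2 _) measure_addE.
  have E0 : m1 `]-oo, x]%classic = (2^-1 * clip (2 * x))%:E.
    rewrite EFinM -uniform_clip; congr (_ * U _)%E.
    by apply/seteqP; split => u /=; rewrite !in_itv/= /s0; lra.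
  have E1 : m2 `]-oo, x]%classic = (2^-1 * clip (2 * x - 1))%:E.
    rewrite EFinM -uniform_clip; congr (_ * U _)%E.
    by apply/seteqP; split => u /=; rewrite !in_itv/= /s1; lra.
  apply: (etrans (uniform_clip x)); rewrite clip_half EFinD.
  by congr (_ + _)%E; [exact: esym E0|exact: esym E1].
- have mT (S : {mfun (R : measurableType _) >-> (R : measurableType _)}) :
      mscale half (distribution U S) setT = 2^-1%:E.
    exact: etrans (congr1 (mule 2^-1%:E) (probability_setT (distribution U S))) (mule1 _).
  rewrite -[RHS]/(measure_add m1 m2 _) measure_addE.
  apply: (etrans (probability_setT U)); apply: esym.
  have -> : 1%E = (2^-1%:E + 2^-1%:E)%E :> \bar R by rewrite -EFinD; congr (_%:E); lra.
  exact: (congr2 adde (mT S0) (mT S1)).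
- exact: (le_lt_trans (probability_le1 U measurableT) (ltry _)).
Qed.

Let bit u : R := (2^-1 < u)%R%:R.
Let shift u := 2 * u - bit u.

(* The [m]-th approximation splits the first [m] binary digits of [u] into those
   of odd and of even rank. *)
Fixpoint digits (m : nat) u : R * R :=
  if m is m'.+1 then ((bit u + (digits m' (shift u)).2) / 2, (digits m' (shift u)).1)
  else (0, 0).

Let bit01 u : 0 <= bit u <= 1.
Proof. by rewrite /bit; case: (_ < _); rewrite ?lexx ?ler01. Qed.

Let digits01 m u : 0 <= (digits m u).1 <= 1 /\ 0 <= (digits m u).2 <= 1.
Proof.
elim: m u => [|m ih] u /=; first by rewrite lexx ler01.
have [h1 h2] := ih (shift u); split=> //.
by have := bit01 u; move: h2 => /andP[? ?] /andP[? ?]; apply/andP; split; lra.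
Qed.

Let digits_homo m u : (digits m u).1 <= (digits m.+1 u).1 /\ (digits m u).2 <= (digits m.+1 u).2.
Proof.
elim: m u => [|m ih] u.
  by have [/andP[h1 _] /andP[h2 _]] := digits01 1 u.
have [h1 h2] := ih (shift u); split; last exact: h1.
by rewrite [leLHS]/= [leRHS]/= ler_wpM2r// lerD2l.
Qed.

Let measurable_digits m :
  measurable_fun setT (fun u => (digits m u).1) /\ measurable_fun setT (fun u => (digits m u).2).
Proof.
have mbit : measurable_fun setT bit.
  rewrite (_ : bit = fun u => if 2^-1 < u then 1 else 0); last first.
    by apply/funext => u; rewrite /bit; case: (_ < _).
  by apply: measurable_fun_ifT => //; exact: measurable_fun_ltr.
have mshift : measurable_fun setT shift.
  by apply: measurable_funB => //; exact: measurable_funM.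
elim: m => [|m [ih1 ih2]] /=; first by split; exact: measurable_cst.
split; last exact: (measurableT_comp ih1 mshift).
apply: measurable_funM => //; apply: measurable_funD => //.
exact: (measurableT_comp ih2 mshift).
Qed.

Let cell m x y := [set u | (digits m u).1 <= x /\ (digits m u).2 <= y].

Let measurable_cell m x y : measurable (cell m x y).
Proof.
have [m1 m2] := measurable_digits m.
rewrite (_ : cell m x y = (fun u => (digits m u).1) @^-1` `]-oo, x] `&`
                          (fun u => (digits m u).2) @^-1` `]-oo, y]); last first.
  by apply/seteqP; split => u /=; rewrite !in_itv.
by apply: measurableI; apply: measurable_preimage => //; exact: measurable_itv.
Qed.

(** Given the first digit, the shifted variable is again uniform, and the two coordinates exchange
    roles; hence [y] comes first on the right. *)
Let cell_prob m x y : fine (U (cell m.+1 x y)) =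
  2^-1 * fine (U (cell m y (2 * x))) + 2^-1 * fine (U (cell m y (2 * x - 1))).
Proof.
rewrite uniform_half//.
have -> : U (s0 @^-1` cell m.+1 x y) = U (cell m y (2 * x)).
  apply: uniform_ext => //; first exact: measurable_preimage.
  move=> u /andP[u0 u1]; rewrite /cell/=.
  have b0 : bit (s0 u) = 0 by rewrite /bit ltNge (_ : s0 u <= 2^-1)// /s0; lra.
  have -> : shift (s0 u) = u by rewrite /shift b0 /s0; field.
  by rewrite b0 add0r; split => -[h1 h2]; split => //; lra.
have -> : U (s1 @^-1` cell m.+1 x y) = U (cell m y (2 * x - 1)).
  apply: uniform_ext => //; first exact: measurable_preimage.
  move=> u /andP[u0 u1]; rewrite /cell/=.
  have b1 : bit (s1 u) = 1 by rewrite /bit (_ : 2^-1 < s1 u)// /s1; lra.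
  have -> : shift (s1 u) = u by rewrite /shift b1 /s1; field.
  by rewrite b1; split => -[h1 h2]; split => //; lra.
have f1 := probability_fin_num U (measurable_cell m y (2 * x)).
have f2 := probability_fin_num U (measurable_cell m y (2 * x - 1)).
by rewrite -[in LHS](fineK f1) -[in LHS](fineK f2) -!EFinM -EFinD.
Qed.

(** After [m] digits the first coordinate has received half of them rounded up and the second half
    rounded down, so the truncation errors are at most [gap m.+1] and [gap m]. *)
Let gap (m : nat) : R := 2^-1 ^+ m./2.

Let cell_bounds m x y : clip x * clip y <= fine (U (cell m x y)) <=
  clip (x + gap m.+1) * clip (y + gap m).
Proof.
elim: m x y => [|m ih] x y.
  rewrite /gap/= expr0.
  have [/andP[x0 y0]|xy] := boolP ((0 <= x) && (0 <= y)).
    rewrite (_ : cell 0 x y = setT); last by apply/seteqP; split => u.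
    rewrite probability_setT.
    have -> : clip (x + 1) = 1 by case: (clipE (x + 1)) => -[h ->]; lra.
    have -> : clip (y + 1) = 1 by case: (clipE (y + 1)) => -[h ->]; lra.
    have := clip01 x; have := clip01 y; rewrite mulr1 lexx andbT => /andP[? ?] /andP[? ?].
    by rewrite mulr_ile1.
  rewrite (_ : cell 0 x y = set0); last first.
    by apply/seteqP; split => u //= [h1 h2]; move: xy; rewrite h1 h2.
  rewrite measure0/= mulr_ge0 ?andbT; [|by have /andP[] := clip01 (x + 1)|by have /andP[] := clip01 (y + 1)].
  move: xy; rewrite negb_and -!ltNge => /orP[x0|y0].
    have -> : clip x = 0 by case: (clipE x) => -[h ->]; lra.
    by rewrite mul0r.
  have -> : clip y = 0 by case: (clipE y) => -[h ->]; lra.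
  by rewrite mulr0.
rewrite cell_prob.
have /andP[l1 u1] := ih y (2 * x); have /andP[l2 u2] := ih y (2 * x - 1).
have gapE : gap m.+2 = gap m / 2 by rewrite /gap/= exprSr.
rewrite gapE [X in X * _ <= _ <= _]clip_half [X in _ <= _ <= X * _]clip_half.
rewrite (_ : 2 * (x + gap m / 2) = 2 * x + gap m); last by field.
rewrite (_ : 2 * x + gap m - 1 = 2 * x - 1 + gap m); last by ring.
move: l1 u1 l2 u2.
set a := clip (2 * x); set b := clip (2 * x - 1); set c := clip (2 * x + _); set d := clip (2 * x - 1 + _).
set e := clip y; set f := clip (y + _) => l1 u1 l2 u2.
have -> : (2^-1 * a + 2^-1 * b) * e = 2^-1 * (e * a) + 2^-1 * (e * b) by ring.
have -> : (2^-1 * c + 2^-1 * d) * f = 2^-1 * (f * c) + 2^-1 * (f * d) by ring.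
by apply/andP; split; lra.
Qed.

Let cell_cvg x y : fine (U (cell m x y)) @[m --> \oo] --> clip x * clip y.
Proof.
have gap0 : gap m @[m --> \oo] --> (0 : R).
  have h : (fun m => 2^-1 ^+ m : R) @ \oo --> (0 : R).
    by apply: cvg_expr; rewrite ger0_norm// invf_lt1// ltr1n.
  have h2 : (fun m => m./2) @ \oo --> \oo.
    move=> A [N _ NA]; exists N.*2 => // m /= Nm; apply: NA => /=.
    by rewrite -(doubleK N) half_leq.
  exact: (cvg_comp _ _ h2 h).
have gap0S : gap m.+1 @[m --> \oo] --> (0 : R) by rewrite (cvg_shiftS gap).
apply: (squeeze_cvgr (f := fun=> clip x * clip y) (h := fun m => clip (x + gap m.+1) * clip (y + gap m))).
- by apply: nearW => m; exact: cell_bounds.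
- exact: cvg_cst.
- have cc z g : g m @[m --> \oo] --> (0 : R) -> clip (z + g m) @[m --> \oo] --> clip z.
    move=> g0; have h : z + g m @[m --> \oo] --> z by rewrite -[X in _ --> X]addr0; exact: cvgD (cvg_cst _) g0.
    exact: (cvg_comp _ _ h (@continuous_clip R z)).
  by apply: cvgM; exact: cc.
Qed.

(** With suprema of increasing approximations, [p u <= x] is the conjunction of the same condition
    on all approximations, and a quadrant becomes a decreasing intersection of cells. *)
Let p u := sup (range (fun m => (digits m u).1)).
Let q u := sup (range (fun m => (digits m u).2)).

Let p_le u x : p u <= x <-> forall m, (digits m u).1 <= x.
Proof.
split=> [px m|H].
  apply: le_trans px; apply: ub_le_sup; last by exists m.
  by exists 1 => _ [k _ <-]; have [/andP[]] := digits01 k u.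
apply: sup_le_ub; first by exists (digits 0 u).1; exists 0%N.
by move=> _ [k _ <-].
Qed.

Let q_le u x : q u <= x <-> forall m, (digits m u).2 <= x.
Proof.
split=> [px m|H].
  apply: le_trans px; apply: ub_le_sup; last by exists m.
  by exists 1 => _ [k _ <-]; have [_ /andP[]] := digits01 k u.
apply: sup_le_ub; first by exists (digits 0 u).2; exists 0%N.
by move=> _ [k _ <-].
Qed.

Let measurable_sup (g : nat -> R -> R) (h : R -> R) :
  (forall m, measurable_fun setT (g m)) -> (forall u x, h u <= x <-> forall m, g m u <= x) ->
  measurable_fun setT h.
Proof.
move=> mg hg; apply: (measurability _ (RGenOInfty.measurableE R)) => _ [_ [y ->] <-].
rewrite setTI (_ : _ @^-1` _ = ~` \bigcap_m (g m @^-1` `]-oo, y])).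
  apply: measurableC; apply: bigcapT_measurable => m.
  by apply: measurable_preimage => //; exact: measurable_itv.
apply/seteqP; split => u /=; rewrite in_itv/= andbT.
  move=> yh H; suff : h u <= y by rewrite leNgt yh.
  by apply/hg => m; have := H m I; rewrite /= in_itv.
move=> H; rewrite ltNge; apply/negP => /hg hy; apply: H => m _ /=.
by rewrite in_itv/=.
Qed.

Let mp : measurable_fun setT p.
Proof. by apply: measurable_sup p_le => m; have [] := measurable_digits m. Qed.

Let mq : measurable_fun setT q.
Proof. by apply: measurable_sup q_le => m; have [] := measurable_digits m. Qed.

Let pq_quadrant x y :
  U (p @^-1` `]-oo, x] `&` q @^-1` `]-oo, y]) = (clip x * clip y)%:E.
Proof.
have -> : p @^-1` `]-oo, x] `&` q @^-1` `]-oo, y] = \bigcap_m cell m x y.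
  apply/seteqP; split => u /=; rewrite ?in_itv/=.
    by move=> [/p_le h1 /q_le h2] m _; split.
  by move=> H; split; [apply/p_le|apply/q_le] => m; have [] := H m I.
have mI : measurable (\bigcap_m cell m x y) by apply: bigcapT_measurable.
have cv : (U \o (fun m => cell m x y)) k @[k --> \oo] --> U (\bigcap_m cell m x y).
  apply: nonincreasing_cvg_mu => //.
    by apply: (@le_lt_trans _ _ 1%E); [exact: probability_le1|exact: ltry].
  apply/nonincreasing_seqP => m; apply/subsetPset => u [h1 h2].
  have [h3 h4] := digits_homo m u.
  by split; [exact: le_trans h3 h1|exact: le_trans h4 h2].
rewrite -(fineK (probability_fin_num U mI)); congr (_%:E).
have h : fine (U (cell m x y)) @[m --> \oo] --> fine (U (\bigcap_m cell m x y)).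
  by apply: fine_cvg; rewrite fineK// probability_fin_num.
rewrite -(cvg_lim (@Rhausdorff R) h).
exact: (cvg_lim (@Rhausdorff R) (@cell_cvg x y)).
Qed.

(** [pq_quadrant] gives the product formula for half-lines. [restricted_law_unique] extends it first
    to all events of [p], and then, with such an event fixed, to all events of [q]. *)
Lemma uniform_splitting : exists p q : R -> R,
  [/\ measurable_fun setT p, measurable_fun setT q &
   forall A B, measurable A -> measurable B ->
     U (p @^-1` A `&` q @^-1` B) = (U A * U B)%E].
Proof.
exists p, q; split => //.
have p1 : p @^-1` `]-oo, 1] = setT.
  by apply/seteqP; split => u //= _; rewrite in_itv/=; apply/p_le => m; have [/andP[]] := digits01 m u.
have q1 : q @^-1` `]-oo, 1] = setT.
  by apply/seteqP; split => u //= _; rewrite in_itv/=; apply/q_le => m; have [_ /andP[]] := digits01 m u.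
have c1 : clip (1 : R) = 1 by case: (clipE (1 : R)) => -[h ->]; lra.
have mi (x : R) : measurable (`]-oo, x]%classic : set R) by exact: measurable_itv.
have H1 A y : measurable A -> U (p @^-1` A `&` q @^-1` `]-oo, y]) = (U A * (clip y)%:E)%E.
  move=> mA; have c0 : 0 <= clip y by have /andP[] := clip01 y.
  rewrite muleC; apply: (@restricted_law_unique _ _ _ U p _ mp _ U (NngNum c0)) => //=.
  - exact: measurable_preimage.
  - by move=> x; rewrite pq_quadrant uniform_clip -EFinM mulrC.
  - by have := pq_quadrant 1 y; rewrite p1 setTI c1 mul1r.
move=> A B mA mB; have fA := probability_fin_num U mA.
have UA0 : 0 <= fine (U A) by rewrite fine_ge0.
rewrite setIC -(fineK fA).
apply: (@restricted_law_unique _ _ _ U q _ mq _ U (NngNum UA0)) => //=.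
- exact: measurable_preimage.
- by move=> x; rewrite setIC H1// uniform_clip (fineK fA).
- by have := H1 A 1 mA; rewrite q1 setIT c1 mule1 (fineK fA).
Qed.

End uniform_splitting.

Theorem iid_gaussian_pairs (R : realType) :
  exists (P : probability R R) (Z : nat -> R -> R * R),
  [/\ forall i, measurable_fun setT (Z i), independent P Z &
      forall i A, measurable A ->
        P (Z i @^-1` A) = (probR (normal_prob (0:R) 1) \x probR (normal_prob (0:R) 1))%E A].
Proof.
have [U [U_cdf U01]] := @exists_uniform R; exists U.
have [p [q [mp mq Upq]]] := uniform_splitting U_cdf U01.
pose N01 := probR (normal_prob (0:R) 1).
pose K x := fine (N01 `]-oo, x]%classic).
have cK : is_cdf K := probability_is_cdf N01.
pose Q := quantile K.
have mQ : measurable_fun setT Q.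
  have := @measurable_quantile R _ R (fun=> K) (fun=> cK) (fun y => measurable_cst (K y)).
  by move=> m; have := measurableT_comp m (@measurable_pair1 _ _ R R 0).
have UQ A : measurable A -> U (Q @^-1` A) = N01 A.
  move=> mA; pose X : {mfun (R : measurableType _) >-> (R : measurableType _)} := mfun_Sub (mem_set mQ).
  apply: (@probability_Nyc_unique R (distribution U X) N01) mA => x.
  apply: (etrans (uniform_quantile_law U_cdf U01 cK x)).
  by rewrite fineK// probability_fin_num.
have Up A : measurable A -> U (p @^-1` A) = U A.
  by move=> mA; have := Upq A setT mA measurableT; rewrite preimage_setT setIT probability_setT mule1.
have Uq A : measurable A -> U (q @^-1` A) = U A.
  by move=> mA; have := Upq setT A measurableT mA; rewrite preimage_setT setTI probability_setT mul1e.
pose F u := (Q (p u), Q (q u)).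
have mF : measurable_fun setT F.
  by apply/measurable_fun_pairP; split; [exact: (measurableT_comp mQ mp)|exact: (measurableT_comp mQ mq)].
have UF A : measurable A -> U (F @^-1` A) = (N01 \x N01)%E A.
  move=> mA; pose X : {mfun (R : measurableType _) >-> (R * R)%type} := mfun_Sub (mem_set mF).
  apply: esym; apply: (product_measure_unique (m' := distribution U X)) mA => B C mB mC.
  have H : U (F @^-1` (B `*` C)) = (U (Q @^-1` B) * U (Q @^-1` C))%E.
    by apply: (Upq (Q @^-1` B) (Q @^-1` C)); exact: measurable_preimage.
  exact: (etrans H (congr2 mule (UQ B mB) (UQ C mC))).
(* Each step sets aside [p] of the current uniform variable and continues with [q], which is
   independent of it. [F] splits the variable set aside once more and applies Gaussian quantiles. *)
pose Z i u := F (p (iter i q u)).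
have ZS i u : Z i.+1 u = Z i (q u) by rewrite /Z iterSr.
have mZ i : measurable_fun setT (Z i).
  elim: i => [|i ih]; first exact: (measurableT_comp mF mp).
  by rewrite (_ : Z i.+1 = Z i \o q); [exact: (measurableT_comp ih mq)|apply/funext => u; exact: ZS].
have UZ i A : measurable A -> U (Z i @^-1` A) = U (F @^-1` A).
  move=> mA; elim: i => [|i ih]; first by apply: (Up (F @^-1` A)); exact: measurable_preimage.
  rewrite -ih -[RHS]Uq; last exact: measurable_preimage.
  by congr (U _); apply/funext => u /=; rewrite ZS.
exists Z; split => //; last by move=> i A mA; rewrite UZ// UF.
have ind n (A : nat -> set (R * R)) : (forall i, measurable (A i)) ->
    U (\bigcap_(i in [set i | (i < n)%N]) (Z i @^-1` A i)) = (\prod_(i < n) U (Z i @^-1` A i))%E.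
  elim: n A => [|n ih] A mA.
    by rewrite big_ord0 (_ : \bigcap_(i in _) _ = setT) ?probability_setT//; apply/seteqP; split.
  rewrite (_ : \bigcap_(i in _) _ = p @^-1` (F @^-1` A 0%N) `&`
      q @^-1` (\bigcap_(i in [set i | (i < n)%N]) (Z i @^-1` A i.+1))); last first.
    apply/seteqP; split => u /=.
      move=> H; split; first exact: (H 0%N).
      by move=> i /= ni; have := H i.+1 ni; rewrite /= ZS.
    by move=> [h0 H] [|i] //= ni; rewrite ZS; exact: H.
  rewrite Upq; [|exact: measurable_preimage|].
    rewrite big_ord_recl -(UZ 0%N)// ih//; congr (_ * _)%E; apply: eq_bigr => i _.
    by rewrite !UZ.
  by apply: bigcap_measurableType => i _; exact: measurable_preimage.
move=> J A mA.
pose n := (\max_(i <- J) i).+1.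
(* Taking the whole space outside [J] reduces a finite index set to an initial segment. *)
pose A' i := if i \in J then A i else setT.
have Jn i : i \in J -> (i < n)%N by move=> iJ; rewrite /n ltnS; exact: leq_bigmax_seq.
rewrite (_ : \bigcap_(i in _) _ = \bigcap_(i in [set i | (i < n)%N]) (Z i @^-1` A' i)); last first.
  apply/seteqP; split => u H i /=.
    by move=> _; rewrite /A'; case: ifPn => // iJ; exact: (H i iJ).
  by move=> iJ; have := H i (Jn i iJ); rewrite /A' iJ.
rewrite ind; last by move=> i; rewrite /A'; case: ifP.
rewrite (eq_bigr (fun i : 'I_n => if (i : nat) \in J then U (Z i @^-1` A i) else 1%E)); last first.
  by move=> i _; rewrite /A'; case: ifP => // _; rewrite preimage_setT probability_setT.
rewrite -(big_mkord xpredT (fun i => if i \in J then U (Z i @^-1` A i) else 1%E)) -big_mkcond/=.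
rewrite -big_filter; apply: perm_big; apply: uniq_perm.
- by rewrite filter_uniq// iota_uniq.
- exact: fset_uniq.
- move=> i; rewrite mem_filter mem_index_iota/=.
  by apply/andP/idP => [[]//|iJ]; split => //; exact: Jn.
Qed.

(** * Attaining every limit *)

Section van_der_corput.
Context {R : realType}.
Implicit Types (x y : R).

(* The van der Corput sequence, started at [1 / 2] instead of [0]; [f] is fuel,
   sufficient when [n <= f], see [radicalE]. *)
Fixpoint radical_rec (f n : nat) : R :=
  if f is f'.+1 then
    if n is _.+1 then (radical_rec f' n./2 + (odd n)%:R) / 2 else 2^-1
  else 2^-1.

Definition radical (n : nat) : R := radical_rec n n.

Let half_leS (n f : nat) : (n.+1 <= f.+1)%N -> (n.+1./2 <= f)%N.
Proof. by move=> nf; lia. Qed.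

Let radical_fuel (f g n : nat) : (n <= f)%N -> (n <= g)%N ->
  radical_rec f n = radical_rec g n.
Proof.
elim: f g n => [|f ih] [|g] [|n] //= nf ng.
by congr ((_ + _) / 2); apply: ih; exact: half_leS.
Qed.

Lemma radicalE n : (0 < n)%N -> radical n = (radical n./2 + (odd n)%:R) / 2.
Proof.
case: n => // n _; rewrite /radical [LHS]/=; congr ((_ + _) / 2).
by apply: radical_fuel => //; exact: half_leS.
Qed.

Lemma radical01 n : 0 < radical n < 1.
Proof.
elim/ltn_ind: n => -[_|n ih]; first by rewrite /radical/=; apply/andP; split; lra.
rewrite radicalE//.
have /andP[h1 h2] := ih n.+1./2 ltac:(lia).
by case: (odd _); rewrite /= ?mulr1n ?mulr0n; apply/andP; split; lra.
Qed.

Let count N y : R := \sum_(i < N) (radical i <= y)%R%:R.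

Let countS N y : count N.+1 y = count N y + (radical N <= y)%R%:R.
Proof. by rewrite /count big_ord_recr. Qed.

(** Indices [2 * i] and [2 * i + 1] carry the two halves of the i-th value. The only exception is
    index 0, whose value is 1/2 instead of 1/4, and the error 1 accounts for it. *)
Let count_double m y :
  `|count m.*2 y - count m (2 * y) - count m (2 * y - 1)| <= 1.
Proof.
have E k : count k.+1.*2 y = (radical 0 <= y)%R%:R + (radical 1 <= y)%R%:R +
    (count k.+1 (2 * y) - (radical 0 <= 2 * y)%R%:R) +
    (count k.+1 (2 * y - 1) - (radical 0 <= 2 * y - 1)%R%:R).
  elim: k => [|k ih].
    by rewrite -[1.*2]/2%N !countS /count !big_ord0; ring.
  rewrite [in LHS]doubleS !(countS k.+1.*2.+1) !(countS k.+1.*2) ih !(countS k.+1).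
  rewrite [radical k.+1.*2](radicalE (n := k.+1.*2))// [radical k.+1.*2.+1](radicalE (n := k.+1.*2.+1))//.
  rewrite (_ : k.+1.*2.+1./2 = k.+1); last by lia.
  rewrite (_ : k.+1.*2./2 = k.+1); last by lia.
  rewrite (_ : odd k.+1.*2.+1 = true); last by lia.
  rewrite (_ : odd k.+1.*2 = false); last by lia.
  rewrite [false%:R]/= [true%:R]/=.
  have -> : ((radical k.+1 + 0) / 2 <= y) = (radical k.+1 <= 2 * y) by apply/idP/idP; lra.
  have -> : ((radical k.+1 + 1) / 2 <= y) = (radical k.+1 <= 2 * y - 1) by apply/idP/idP; lra.
  by ring.
case: m => [|m]; first by rewrite /count !big_ord0 !subr0 normr0.
rewrite E; set a := count _ _; set c := count _ _.
rewrite (_ : _ - a - c = (radical 0 <= y)%R%:R + (radical 1 <= y)%R%:R - (radical 0 <= 2 * y)%R%:R -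
  (radical 0 <= 2 * y - 1)%R%:R); last by ring.
have -> : radical 1 = 3 / 4 by rewrite /radical/=; lra.
have -> : radical 0 = 1 / 2 by rewrite /radical/=; lra.
have -> : (1 / 2 <= 2 * y - 1) = (3 / 4 <= y) by apply/idP/idP; lra.
rewrite (_ : _ + _ - _ - _ = (1 / 2 <= y)%R%:R - (1 / 2 <= 2 * y)%R%:R); last by ring.
by case: (_ <= y); case: (_ <= 2 * y); rewrite ?subrr ?subr0 ?sub0r ?normrN ?normr0 ?normr1.
Qed.

Let count_lo N y : y <= 0 -> count N y = 0.
Proof.
move=> y0; rewrite /count big1// => i _; have /andP[h _] := radical01 i.
by rewrite leNgt (le_lt_trans y0 h).
Qed.

Let count_hi N y : 1 <= y -> count N y = N%:R.
Proof.
move=> y1; rewrite /count (eq_bigr (fun=> 1)) ?sumr_const ?card_ord// => i _.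
by have /andP[_ h] := radical01 i; rewrite (le_trans (ltW h) y1).
Qed.

(* If [N = 2m] or [N = 2m + 1], one of the two halves of [count_double] is
   trivial, so the error grows by at most 2 from [m] to [N]. *)
Let count_bound N y : `|count N y - N%:R * clip y| <= 7 * Num.sqrt N%:R.
Proof.
elim/ltn_ind: N y => -[_ y|N ih y].
  by rewrite /count big_ord0 mul0r subrr normr0 mulr_ge0// sqrtr_ge0.
set n := N.+1; pose m := n./2.
have nE : n = (odd n + m.*2)%N by rewrite odd_double_half.
have mn : (m < n)%N by rewrite /m /n; lia.
pose s := Num.sqrt (n%:R : R).
have s1 : 1 <= s by rewrite -[leLHS]sqrtr1 ler_wsqrtr// ler1n.
(* Since [m] is at most half of [n], [49 * m <= 25 * n]; the remaining [2 * s >= 2] covers the two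
   errors bounded by 1. *)
have ms : 7 * Num.sqrt (m%:R : R) <= 5 * s.
  rewrite -(@ler_pXn2r _ 2)// ?nnegrE ?mulr_ge0 ?sqrtr_ge0//.
  rewrite !exprMn !sqr_sqrtr// -!natrX -!natrM ler_nat; lia.
have cE : count n y = count m.*2 y + (odd n)%:R * (radical m.*2 <= y)%R%:R.
  rewrite {1}nE; case: (odd n); last by rewrite mul0r addr0.
  by rewrite mul1r add1n /count big_ord_recr.
have nR : n%:R = (odd n)%:R + 2 * m%:R :> R by rewrite {1}nE natrD -muln2 natrM mulrC.
have half : `|(count m (2 * y) - m%:R * clip (2 * y)) + (count m (2 * y - 1) - m%:R * clip (2 * y - 1))| <=
    7 * Num.sqrt m%:R.
  have [y2|y2] := leP y 2^-1.
    rewrite (count_lo m (y := 2 * y - 1)); last by lra.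
    have -> : clip (2 * y - 1) = 0 by case: (clipE (2 * y - 1)) => -[h ->]; lra.
    by rewrite mulr0 subrr addr0; exact: ih.
  rewrite (count_hi m (y := 2 * y)); last by lra.
  have -> : clip (2 * y) = 1 by case: (clipE (2 * y)) => -[h ->]; lra.
  by rewrite mulr1 subrr add0r; exact: ih.
have odd1 : `|(odd n)%:R * ((radical m.*2 <= y)%R%:R - clip y)| <= 1.
  have /andP[? ?] := clip01 y.
  by case: (odd n); case: (_ <= y); rewrite /= ?mulr1n ?mulr0n ?mul0r ?normr0 ?mul1r// ler_norml; apply/andP; split; lra.
rewrite (_ : _ - _ = (count m.*2 y - count m (2 * y) - count m (2 * y - 1)) +
   (((count m (2 * y) - m%:R * clip (2 * y)) + (count m (2 * y - 1) - m%:R * clip (2 * y - 1))) +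
   (odd n)%:R * ((radical m.*2 <= y)%R%:R - clip y))); last first.
  rewrite cE nR.
  have -> : ((odd n)%:R + 2 * m%:R) * clip y = (odd n)%:R * clip y + m%:R * (clip (2 * y) + clip (2 * y - 1)).
    by rewrite mulrDl; congr (_ + _); rewrite [X in _ * X = _]clip_half; field.
  by ring.
apply: (le_trans (ler_normD _ _)); apply: (le_trans (lerD (count_double m y) (ler_normD _ _))).
apply: (le_trans (lerD (lexx _) (lerD half odd1))); rewrite -/s; lra.
Qed.

Lemma radical_equidistributed y :
  n.+1%:R^-1 * \sum_(i < n.+1) (radical i <= y)%R%:R @[n --> \oo] --> clip y.
Proof.
apply/cvgrPdist_le => e e0; near=> n.
have n0 : 0 < n.+1%:R :> R by [].
have := count_bound n.+1 y; rewrite /count; set c := \sum_(_ < _) _ => H.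
rewrite distrC (_ : _ - _ = n.+1%:R^-1 * (c - n.+1%:R * clip y)); last by field; rewrite gt_eqF.
rewrite normrM gtr0_norm ?invr_gt0// ler_pdivrMl//; apply: (le_trans H).
rewrite -[X in _ <= X * _](sqr_sqrtr (ltW n0)) expr2 mulrAC mulrC [leRHS]mulrC.
rewrite ler_pM2l ?sqrtr_gt0// -ler_pdivrMr//.
rewrite -[leLHS]gtr0_norm ?divr_gt0// -sqrtr_sqr ler_wsqrtr//.
apply: (@le_trans _ _ n%:R); last by rewrite ler_nat.
by near: n; exact: nbhs_infty_ger.
Unshelve. all: by end_near. Qed.

End van_der_corput.

(** * Ramps as averages of half-line indicators *)

Section staircase.
Context {R : realType}.
Implicit Types (t u v y : R).

Let trunc (N : nat) v : R := Num.max 0 (Num.min N%:R (N%:R - v)).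

Let truncE N v : [/\ v <= 0 & trunc N v = N%:R] \/ [/\ 0 <= v, v <= N%:R & trunc N v = N%:R - v] \/
  [/\ N%:R <= v & trunc N v = 0].
Proof.
rewrite /trunc; have [v0|v0] := leP v 0.
  by left; split => //; rewrite min_l ?max_r// lerDl oppr_ge0.
right; have [vN|vN] := leP v N%:R.
  by left; split; rewrite ?(ltW v0)// min_r ?max_r ?subr_ge0// gerBl ltW.
right; split; first exact: ltW.
by rewrite min_r ?max_l ?subr_le0 ?(ltW vN)// gerBl ltW.
Qed.

Let steps_bound N v : 0 <= \sum_(j < N) (v <= j%:R)%R%:R :> R /\
  trunc N v - 1 <= \sum_(j < N) (v <= j%:R)%R%:R <= trunc N v.
Proof.
elim: N => [|N [ih0 ih]].
  rewrite big_ord0; split => //.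
  by case: (truncE 0 v) => [[? ->]|[[? ? ->]|[? ->]]]; apply/andP; split; lra.
rewrite big_ord_recr/=; move: ih0 ih; set S := \sum_(_ < _) _ => S0 /andP[lo up].
have N0 : 0 <= N%:R :> R by [].
have NS : N.+1%:R = N%:R + 1 :> R by rewrite natr1.
split; first by rewrite addr_ge0.
have [vN|vN] := leP v N%:R; rewrite ?mulr1n ?mulr0n ?addr0;
  by move: lo up; case: (truncE N v) => [[? ->]|[[? ? ->]|[? ->]]] lo up;
     case: (truncE N.+1 v) => [[? ->]|[[? ? ->]|[? ->]]]; apply/andP; split; lra.
Qed.

(** Equidistribution is known for half-line indicators at every threshold; averaging [N] of them
    transfers it to ramps, with an error independent of [u]. *)
Lemma ramp_steps (k N : nat) t u : (0 < k)%N -> (0 < N)%N ->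
  `|ramp k%:R t u - N%:R^-1 * \sum_(j < N) (u <= t + j%:R / (k%:R * N%:R))%R%:R| <= N%:R^-1.
Proof.
move=> k0 N0; have kR : 0 < k%:R :> R by rewrite ltr0n.
have NR : 0 < N%:R :> R by rewrite ltr0n.
pose v := k%:R * N%:R * (u - t).
have rE : ramp k%:R t u = N%:R^-1 * trunc N v.
  have E : 1 + k%:R * (t - u) = N%:R^-1 * (N%:R - v) by rewrite /v; field; rewrite gt_eqF.
  have E1 : N%:R^-1 * N%:R = 1 :> R by rewrite mulVf// gt_eqF.
  rewrite /ramp /trunc E -[X in Num.min X _]E1.
  by rewrite maxr_pMr ?invr_ge0 ?(ltW NR)// minr_pMr ?invr_ge0 ?(ltW NR)// mulr0.
rewrite rE -mulrBr normrM gtr0_norm ?invr_gt0// ler_piMr ?invr_ge0 ?(ltW NR)//.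
rewrite (eq_bigr (fun j : 'I_N => (v <= j%:R)%R%:R)); last first.
  move=> j _; congr (nat_of_bool _)%:R; rewrite /v -lerBlDl ler_pdivlMr ?mulr_gt0//.
  by rewrite mulrC.
by have [_ /andP[lo up]] := steps_bound N v; rewrite ler_norml; apply/andP; split; lra.
Qed.

End staircase.

(** * Correlations attaining a given measure *)

Section attainment.
Context {R : realType}.
Local Notation E := (ext_nneg R).
Local Notation J := ramp_mean.
Variable b : nat -> R.
Hypothesis hb : forall n, (0 < n)%N -> b n = n%:R * normal_pdf 0 1 (b n).
Variable nu : probability E R.

Let K (t : R) := fine (nu (@expN R @^-1` `]-oo, t])).

Let measurable_below (t : R) : measurable (@expN R @^-1` `]-oo, t]).
Proof. by apply: measurable_preimage; [exact: measurable_expN|exact: measurable_itv]. Qed.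

Let cK : is_cdf K.
Proof.
pose X : {mfun E >-> (R : measurableType _)} := mfun_Sub (mem_set (@measurable_expN R)).
exact: (probability_is_cdf (distribution nu X)).
Qed.

Let K_lt0 (t : R) : t < 0 -> K t = 0.
Proof.
move=> t0; rewrite /K (_ : _ @^-1` _ = set0) ?measure0//.
apply/seteqP; split => l //=; rewrite in_itv/= => lt.
by have := expN_ge0 l; rewrite leNgt (le_lt_trans lt t0).
Qed.

Let K_ge1 (t : R) : 1 <= t -> K t = 1.
Proof.
move=> t1; rewrite /K (_ : _ @^-1` _ = setT) ?probability_setT//.
by apply/seteqP; split => l //= _; rewrite in_itv/= (le_trans (expN_le1 l)).
Qed.

Let u i := quantile K (radical i).

Let u_le i (t : R) : (u i <= t) = (radical i <= K t).
Proof. by rewrite /u quantile_le// /unit_clamp radical01. Qed.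

Let u_ge0 i : 0 <= u i.
Proof.
rewrite leNgt; apply/negP => u0; have := lexx (u i); rewrite u_le K_lt0// leNgt.
by have /andP[->] := @radical01 R i.
Qed.

Let u_le1 i : u i <= 1.
Proof. by rewrite u_le K_ge1// ltW//; have /andP[] := @radical01 R i. Qed.

Let u_equidistributed (t : R) :
  n.+1%:R^-1 * \sum_(i < n.+1) (u i <= t)%R%:R @[n --> \oo] --> K t.
Proof.
have [_ /(_ t)/andP[K0 K1] _ _ _] := cK.
have -> : K t = clip (K t) by rewrite /clip min_r// max_r.
rewrite (_ : (fun n => _) = fun n => n.+1%:R^-1 * \sum_(i < n.+1) (radical i <= K t)%R%:R).
  exact: radical_equidistributed.
by apply/funext => n; congr (_ * _); apply: eq_bigr => i _; rewrite u_le.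
Qed.

Let average_ramp_cvg (k : nat) (t : R) :
  n.+1%:R^-1 * \sum_(i < n.+1) ramp k%:R t (u i) @[n --> \oo] --> J nu k t.
Proof.
have aux (e a a' c c' v : R) : `|a - c| <= v -> `|a' - c'| <= v -> v <= e / 4 ->
    `|c - c'| <= e / 2 -> `|a - a'| <= e.
  by rewrite !ler_norml => /andP[? ?] /andP[? ?] ? /andP[? ?]; apply/andP; split; lra.
have avg1 n : n.+1%:R^-1 * \sum_(i < n.+1) 1 = 1 :> R.
  by rewrite sumr_const card_ord mulVf// pnatr_eq0.
have [->|k0] := posnP k.
  have r1 (x : R) : ramp 0 t x = 1 by rewrite /ramp mul0r addr0 minxx max_r.
  rewrite /J; under [X in _ --> X]eq_Rintegral do rewrite r1.
  rewrite Rintegral_prob_cst (_ : (fun n => _) = fun=> 1); first exact: cvg_cst.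
  by apply/funext => n; rewrite -[RHS](avg1 n); congr (_ * _); apply: eq_bigr => i _; exact: r1.
apply/cvgrPdist_le => e e0.
have e4 : 0 < e / 4 by rewrite divr_gt0.
have e2 : 0 < e / 2 by rewrite divr_gt0.
have [N [N0 Ne]] : exists N : nat, (0 < N)%N /\ N%:R^-1 <= e / 4.
  near \oo => m; exists m.+1; split => //; apply: ltW.
  by near: m; exact: (near_infty_natSinv_lt (PosNum e4)).
pose s (j : nat) := t + j%:R / (k%:R * N%:R).
pose S (G : R -> R) := N%:R^-1 * \sum_(j < N) G (s j).
have JS : `|J nu k t - S K| <= N%:R^-1.
  pose g (l : E) := S (fun y => \1_(@expN R @^-1` `]-oo, y]) l).
  have bi y : bmeas (\1_(@expN R @^-1` `]-oo, y]) : E -> R) by exact: bmeas_indic.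
  have bs : bmeas (fun l : E => \sum_(j < N) (\1_(@expN R @^-1` `]-oo, (s j)]) l : R)).
    by apply: bmeas_sum => j; exact: bi.
  have gE : \int[nu]_l g l = S K.
    rewrite /g /S bmeas_RintegralZ// bmeas_Rintegral_sum//.
    by congr (_ * _); apply: eq_bigr => j _; rewrite Rintegral_prob_indic.
  rewrite -gE -(Rintegral_prob_cst nu N%:R^-1).
  apply: bmeas_Rintegral_dist_le; [exact: bmeas_ramp_expN|exact: bmeasZ|exact: bmeas_cst|].
  move=> l; have := ramp_steps t (expN l) k0 N0; rewrite /g /S.
  rewrite (eq_bigr (fun j : 'I_N => \1_(@expN R @^-1` `]-oo, (s j)]) l)) => [//|j _].
  rewrite indicE; congr (nat_of_bool _)%:R.
  by apply/idP/idP; rewrite inE/= in_itv.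
pose F n (y : R) : R := n.+1%:R^-1 * \sum_(i < n.+1) (u i <= y)%R%:R.
have AS n : `|n.+1%:R^-1 * \sum_(i < n.+1) ramp k%:R t (u i) - S (F n)| <= N%:R^-1.
  have -> : S (F n) = n.+1%:R^-1 * \sum_(i < n.+1) S (fun y => (u i <= y)%R%:R).
    rewrite /S /F -mulr_sumr -[in RHS]mulr_sumr mulrCA; congr (_ * (_ * _)).
    by rewrite exchange_big.
  rewrite -mulrBr -sumrB normrM ger0_norm ?invr_ge0//.
  rewrite ler_pdivrMl// mulr_natl.
  have -> : N%:R^-1 *+ n.+1 = \sum_(i < n.+1) N%:R^-1 :> R by rewrite sumr_const card_ord.
  apply: (le_trans (ler_norm_sum _ _ _)); apply: ler_sum => i _.
  exact: ramp_steps.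
have SF : S (F n) @[n --> \oo] --> S K.
  rewrite /S; apply: cvgMr; elim: (index_enum _) => [|j r ih].
    by rewrite big_nil; under eq_fun do rewrite big_nil; exact: cvg_cst.
  rewrite big_cons; under eq_fun do rewrite big_cons.
  by apply: cvgD ih; exact: u_equidistributed.
have /cvgrPdist_le/(_ _ e2) := SF; apply: filterS => n H.
exact: aux JS (AS n) Ne H.
Unshelve. all: by end_near. Qed.

(** The quantile [u i] can be 0, when [nu] charges infinity, and the correlation has to stay above
    -1. The vanishing cutoff [expR (- b i.+1)] ensures both, since it gives [c i <= 1]. *)
Let v i := Num.max (u i) (expR (- b i.+1)).
Let c i := - ln (v i) / b i.+1.

(** Solves [Num.sqrt ((1 - rho) / 2) = c i]. Then [expN] of the i-th atom at stage [n] is [v i]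
    raised to the power [b n.+1 / b i.+1]. *)
Definition attained_rho (i : nat) : R := 1 - 2 * c i ^+ 2.

Let b_gt0 i : 0 < b i.+1.
Proof. exact: normalizing_gt0 hb _ _. Qed.

Let v_gt0 i : 0 < v i.
Proof. by rewrite /v lt_max expR_gt0 orbT. Qed.

Let v_le1 i : v i <= 1.
Proof. by rewrite /v ge_max u_le1 expR_le1 oppr_le0 ltW. Qed.

Let c_ge0 i : 0 <= c i.
Proof. by rewrite divr_ge0 ?(ltW (b_gt0 i))// oppr_ge0 ln_le0. Qed.

Let c_le1 i : c i <= 1.
Proof.
rewrite /c ler_pdivrMr// mul1r lerNl -[leLHS]expRK ler_ln ?posrE ?expR_gt0//.
by rewrite /v le_max lexx orbT.
Qed.

Lemma attained_rho_bounds i : -1 <= attained_rho i <= 1.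
Proof.
have := c_ge0 i; have := c_le1 i; rewrite /attained_rho => h1 h0.
by apply/andP; split; nra.
Qed.

Let atom n i := expN (lambda_of (b n.+1) (attained_rho i)).

Let atomE n i : atom n i = expR (- (b n.+1 * c i)).
Proof.
rewrite /atom /expN/=; congr (expR (- _)).
rewrite (_ : _ / 2 = (b n.+1 * c i) ^+ 2); last by rewrite /attained_rho; field.
by rewrite sqrtr_sqr ger0_norm// mulr_ge0// ltW.
Qed.

Let atom_dist_le1 n i : `|atom n i - u i| <= 1.
Proof.
have := expN_ge0 (lambda_of (b n.+1) (attained_rho i)).
have := expN_le1 (lambda_of (b n.+1) (attained_rho i)).
rewrite -/(atom n i) => h1 h2; have := u_ge0 i; have := u_le1 i => h3 h4.
by rewrite ler_norml; apply/andP; split; lra.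
Qed.

(** For [r >= 1], $e^{-x} - e^{-rx} \le (r-1) x e^{-x} \le r - 1$ uniformly in [x >= 0]; the second
    term is the cost of the cutoff in [v i]. *)
Let atom_dist n i : (i <= n)%N ->
  `|atom n i - u i| <= (b n.+1 / b i.+1 - 1) + expR (- b i.+1).
Proof.
move=> ni; have bb : b i.+1 <= b n.+1 by exact: normalizing_homo.
set r := b n.+1 / b i.+1; have r1 : 1 <= r by rewrite ler_pdivlMr ?mul1r.
have vE : v i = expR (ln (v i)) by rewrite lnK ?posrE.
set x := - ln (v i); have x0 : 0 <= x by rewrite oppr_ge0 ln_le0.
have aE : atom n i = expR (- (r * x)).
  by rewrite atomE /c -/x /r; congr (expR (- _)); field; rewrite gt_eqF.
have h1 : `|atom n i - v i| <= r - 1.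
  have rx : expR (- (r * x)) <= expR (- x) by rewrite ler_expR lerN2 ler_peMl.
  have -> : v i = expR (- x) by rewrite /x opprK.
  rewrite aE distrC ger0_norm ?subr_ge0//.
  have -> : expR (- (r * x)) = expR (- x) * expR (- ((r - 1) * x)).
    by rewrite -expRD; congr expR; ring.
  have := expR_ge1Dx (- ((r - 1) * x)) => h.
  have ex : expR (- x) * x <= 1.
    by rewrite expRN mulrC ler_pdivrMr ?expR_gt0// mul1r; have := expR_ge1Dx x; lra.
  have e0 := expR_ge0 (- x).
  apply: (@le_trans _ _ (expR (- x) * ((r - 1) * x))).
    rewrite -[X in X - _]mulr1 -mulrBr ler_wpM2l//; lra.
  by rewrite mulrCA ler_piMr// subr_ge0.
have h2 : `|v i - u i| <= expR (- b i.+1).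
  have := expR_ge0 (- b i.+1); rewrite /v; case: (leP (u i)) => h e0.
    by rewrite ger0_norm ?subr_ge0// gerBl.
  by rewrite subrr normr0.
by apply: (le_trans (ler_distD (v i) _ _)); exact: lerD.
Qed.

Let few_small (N : nat) (y : R) : 0 <= y -> \sum_(i < N) (i.+1%:R < y)%R%:R <= y.
Proof.
move=> y0; elim: N => [|N ih]; first by rewrite big_ord0.
rewrite big_ord_recr/=; have [Ny|Ny] := ltP N.+1%:R y; last by rewrite addr0.
apply: (le_trans _ (ltW Ny)); rewrite -natr1 lerD2r.
rewrite -[X in _ <= X%:R]card_ord -sumr_const; apply: ler_sum => i _.
by case: (_ < _).
Qed.

Let average_dist_cvg : n.+1%:R^-1 * \sum_(i < n.+1) `|atom n i - u i| @[n --> \oo] --> (0 : R).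
Proof.
apply/cvgrPdist_le => e e0.
(* [dl] is the proportion of early indices, where the distance is only known to be at most 1; for
   the others the ratio of the [b] is controlled through [L], a bound for
   [ln n.+1%:R - ln i.+1%:R]. *)
pose dl := Num.min (e / 4) 1.
have dl0 : 0 < dl by rewrite lt_min divr_gt0/=.
have dle : dl <= e / 4 by rewrite ge_min lexx.
have dl1 : dl <= 1 by rewrite ge_min lexx orbT.
pose L := - ln dl; have L0 : 0 <= L by rewrite oppr_ge0 ln_le0.
(* Once [b i.+1] exceeds [B], both [L / b i.+1 ^+ 2] and the cutoff [expR (- b i.+1)] are small:
   together at most [(L + 1) / B]. *)
pose B := Num.max 1 (8 * (L + 1) / e).
have B1 : 1 <= B by rewrite le_max lexx.
have B0 : 0 < B by exact: lt_le_trans B1.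
have BL : (L + 1) / B <= e / 8.
  have : 8 * (L + 1) / e <= B by rewrite le_max lexx orbT.
  by rewrite !ler_pdivrMr// => h; lra.
have [M MB] : exists M, forall m, (M <= m)%N -> B <= b m.+1.
  have /cvgryPge/(_ B)[M _ HM] := normalizing_cvg hb.
  by exists M => m Mm; exact: HM.
near=> n; have nR : 0 < n.+1%:R :> R by [].
have Mn : M.+1%:R <= dl * n.+1%:R.
  rewrite mulrC -ler_pdivrMr//; apply: (@le_trans _ _ n%:R); last by rewrite ler_nat.
  by near: n; exact: nbhs_infty_ger.
rewrite sub0r normrN ger0_norm; last by rewrite mulr_ge0 ?invr_ge0// sumr_ge0.
rewrite ler_pdivrMl//.
apply: (@le_trans _ _ (\sum_(i < n.+1) ((i.+1%:R < dl * n.+1%:R)%R%:R + e / 8))).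
  apply: ler_sum => i _; have [lt|ge] := ltP i.+1%:R (dl * n.+1%:R).
    by apply: (le_trans (atom_dist_le1 n i)); rewrite lerDl divr_ge0// ltW.
  rewrite add0r; have ni : (i <= n)%N by rewrite -ltnS.
  apply: (le_trans (atom_dist ni)); apply: le_trans BL.
  have Bi : B <= b i.+1.
    by apply: MB; rewrite -ltnS -(ler_nat R); exact: le_trans ge.
  have := normalizing_ratio hb (ltn0Sn i) (ni : (i.+1 <= n.+1)%N) => H.
  have lnL : ln n.+1%:R - ln i.+1%:R <= L.
    have : ln (dl * n.+1%:R) <= ln i.+1%:R by rewrite ler_ln ?posrE ?mulr_gt0.
    rewrite lnM ?posrE// /L; lra.
  rewrite mulrDl; apply: lerD.
    apply: (le_trans H); rewrite ler_pdivrMr ?exprn_gt0 ?(lt_le_trans B0 Bi)//.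
    apply: (le_trans lnL); rewrite mulrAC -mulrA ler_peMr// ler_pdivlMr// mul1r.
    rewrite expr2; apply: (le_trans Bi); rewrite ler_peMl ?(le_trans (ltW B0) Bi)//.
    exact: le_trans B1 Bi.
  rewrite expRN mul1r lef_pV2 ?posrE ?expR_gt0//.
  by apply: (le_trans Bi); have := expR_ge1Dx (b i.+1); lra.
rewrite big_split/= sumr_const card_ord.
have := few_small n.+1 (ltW (mulr_gt0 dl0 nR)).
have : dl * n.+1%:R <= e / 4 * n.+1%:R by rewrite ler_pM2r.
have : (e / 8) *+ n.+1 = e / 8 * n.+1%:R by rewrite mulr_natr.
have : 0 < e * n.+1%:R by rewrite mulr_gt0.
move=> h0 -> h1 h2; apply: (le_trans (lerD (le_trans h2 h1) (lexx _))).
have -> : e / 4 * n.+1%:R + e / 8 * n.+1%:R = (e * n.+1%:R) * (3 / 8) by field.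
by rewrite [leRHS]mulrC; move: h0; set z := e * _; lra.
Unshelve. all: by end_near. Qed.

Theorem empirical_attained :
  weak_cvg (@bounded_continuous R E) (fun n => empirical (b n.+1) attained_rho n) nu.
Proof.
apply: (@weak_cvg_ramp_mean _ _ nu (J nu) K) => [k t|t|t]; [|exact: ramp_mean_cvg|exact: ramp_mean_cvg].
pose D n := n.+1%:R^-1 * \sum_(i < n.+1) `|atom n i - u i|.
pose A n := n.+1%:R^-1 * \sum_(i < n.+1) ramp k%:R t (u i).
have JA n : `|J (empirical (b n.+1) attained_rho n) k t - A n| <= k%:R * D n.
  rewrite /J Rintegral_empirical; last exact: bmeas_ramp_expN.
  rewrite -mulrBr -sumrB normrM ger0_norm ?invr_ge0// mulrCA ler_pM2l ?invr_gt0//.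
  rewrite mulr_sumr; apply: (le_trans (ler_norm_sum _ _ _)); apply: ler_sum => i _.
  have := @ramp_lip R k%:R t t (atom n i) (u i) (ler0n _ _).
  by rewrite (_ : t - _ - _ = - (atom n i - u i)) ?normrN//; ring.
have D0 : k%:R * D n @[n --> \oo] --> (0 : R).
  by rewrite -(mulr0 k%:R); apply: cvgMr; exact: average_dist_cvg.
have JA0 : J (empirical (b n.+1) attained_rho n) k t - A n @[n --> \oo] --> (0 : R).
  apply/cvgrPdist_le => e e0; have /cvgrPdist_le/(_ _ e0) := D0.
  apply: filterS => n; rewrite !sub0r !normrN => H.
  by apply: (le_trans (JA n)); exact: le_trans (ler_norm _) H.
rewrite (_ : (fun n => _) = fun n => (J (empirical (b n.+1) attained_rho n) k t - A n) + A n); last first.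
  by apply/funext => n; rewrite subrK.
by rewrite -[J nu k t]add0r; apply: cvgD JA0 _; exact: average_ramp_cvg.
Qed.

End attainment.

Theorem corollary2p7 (R : realType) (b : nat -> R)
    (hb : forall n, (0 < n)%N -> b n = n%:R * normal_pdf 0 1 (b n)) :
  (forall (d : measure_display) (T : measurableType d) (P : probability T R)
      (X : nat -> {RV P >-> (R * R)%type}) (rho : nat -> R),
    independent P X ->
    (forall i, std_gaussian_vector P (rho i) (X i)) ->
    let law_max n := distribution P (normalized_max (b n.+1) X n) in
    let nu_ n := empirical (b n.+1) rho n in
    ((exists mu : probability (R * R)%type R,
        weak_cvg (@bounded_continuous R (R * R)%type) law_max mu) <->
     (exists nu : probability (ext_nneg R) R,
        weak_cvg (@bounded_continuous R (ext_nneg R)) nu_ nu)) /\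
    (forall (mu : probability (R * R)%type R)
        (nu : probability (ext_nneg R) R),
      weak_cvg (@bounded_continuous R (R * R)%type) law_max mu ->
      weak_cvg (@bounded_continuous R (ext_nneg R)) nu_ nu ->
      has_joint_cdf mu (limit_cdf nu))) /\
  (forall nu : probability (ext_nneg R) R,
    exists (d : measure_display) (T : measurableType d) (P : probability T R)
      (X : nat -> {RV P >-> (R * R)%type}) (rho : nat -> R),
      [/\ independent P X,
          (forall i, std_gaussian_vector P (rho i) (X i)) &
          exists mu : probability (R * R)%type R,
            weak_cvg (@bounded_continuous R (R * R)%type)
              (fun n => distribution P (normalized_max (b n.+1) X n)) mu /\
            has_joint_cdf mu (limit_cdf nu)]).
Proof.
split.
  move=> d T P X rho indX gaussX /=; split; last first.
    by move=> mu nu; exact: (maximum_weak_cvg_joint_cdf hb indX gaussX).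
  split=> [[mu wmu]|[nu wnu]]; last first.
    have [mu muE] := limit_law_exists nu.
    by exists mu; exact: (empirical_weak_cvg_maximum hb indX gaussX muE).
  (* The limit measure need not be guessed: integrals of all continuous functions converge as soon
     as those of the limit integrands do, and the latter tend to minus the logarithm of the limiting
     distribution function. *)
  apply: weak_limit_exists => f [cf _].
  suff [_ ] : mean_cvg (fun n => empirical (b n.+1) rho n) f by [].
  apply: mean_cvg_continuous cf => x y; split.
    by apply: bmeas_limit_integrand.
  by apply: cvgP; exact: (maximum_weak_cvg_mean hb indX gaussX wmu).
move=> nu.
have [P [Z [mZ indZ lawZ]]] := iid_gaussian_pairs R.
pose rho := attained_rho b nu.
have rho1 i : -1 <= rho i <= 1 by exact: attained_rho_bounds.
have mX i : measurable_fun setT (gauss_pair (rho i) \o Z i).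
  exact: measurableT_comp (measurable_gauss_pair _) (mZ i).
pose X i : {RV P >-> (R * R)%type} := mfun_Sub (mem_set (mX i)).
have indX : independent P X.
  move=> J A mA.
  apply: (indZ J (fun i => gauss_pair (rho i) @^-1` A i)) => i.
  exact: measurable_preimage (measurable_gauss_pair _) (mA i).
have gaussX i : std_gaussian_vector P (rho i) (X i).
  by apply: gauss_pair_std_gaussian => //; exact: lawZ.
exists _, _, P, X, rho; split => //.
have [mu muE] := limit_law_exists nu; exists mu; split => //.
apply: (empirical_weak_cvg_maximum hb indX gaussX muE).
exact: empirical_attained.
Qed.
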